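(* Assume $( * )$, i.e. work in ZF + DC + ''every subset of $2^{\omega}$ has the Baire property''. If $A$ is an abelian group that fails to be slender, then $|2^{\omega}|\leq|A|$. Also, if $H$ is a group that fails to be n-slender (noncommutatively slender), then $|2^{\omega}|\leq|H|$.
   Context: $( * )$ denotes the theory ZF + DC + ''every subset of the Cantor space $2^{\omega}=\{0,1\}^{\omega}$ (product topology) has the Baire property''; the full axiom of choice is not assumed. DC is the axiom of dependent choice: if $R$ is a binary relation on a nonempty set $X$ with $(\forall x)(\exists y)(xRy)$, then there is a sequence $(z_n)_{n\in\omega}$ with $z_nRz_{n+1}$ for all $n$. A subset $Y$ of a space $X$ has the Baire property if there is an open $U\subseteq X$ such that $Y\Delta U$ is meager in $X$. For sets $X,Y$, $|X|\leq|Y|$ means that there is an injection from $X$ to $Y$. An abelian group $A$ is slender if for every homomorphism $\phi:\mathbb{Z}^{\omega}\rightarrow A$ there exists $N\in\omega$ such that $\phi=\phi\circ\mathrm{proj}_N$, where $\mathrm{proj}_N:\mathbb{Z}^{\omega}\rightarrow\prod_{n=0}^{N-1}\mathbb{Z}\times(0)_{n=N}^{\infty}$ is the retraction projecting to the first $N$ coordinates. Hawaiian earring group. Let $\{a_n^{\pm1}\}_{n\in\omega}$ be a countably infinite set with formal inverses. A word is a function $W:\overline{W}\rightarrow\{a_n^{\pm1}\}_{n\in\omega}$ from a countable (possibly finite or empty) totally ordered set $\overline{W}$ such that for each $n\in\omega$ the set $W^{-1}(\{a_n^{\pm1}\})$ is finite. Write $U\equiv V$ if there is an order isomorphism $f:\overline{U}\rightarrow\overline{V}$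 with $U(i)=V(f(i))$ for all $i\in \overline{U}$; words are considered up to $\equiv$, and $\mathcal{W}$ denotes the set of words so considered. For $N\in\omega$ let $p_N(W)=W\upharpoonright\{i\in\overline{W}: W(i)\in\{a_n^{\pm1}\}_{n=0}^N\}$, a finite word. For $U,V\in\mathcal{W}$ let $U\sim V$ if for each $N\in\omega$ one has $p_N(U)=p_N(V)$ in the free group $F(\{a_0,\ldots,a_N\})$. For words $U,V$, the concatenation $UV$ has as domain the disjoint union of $\overline{U}$ and $\overline{V}$, ordered by extending the two orders and placing all elements of $\overline{U}$ before those of $\overline{V}$, with values given by $U$ and $V$; $U^{-1}$ has domain $\overline{U}$ with reversed order and $U^{-1}(i)=(U(i))^{-1}$. The group $\mathrm{HEG}$ is $\mathcal{W}/\sim$ with $[U][V]=[UV]$, $[U]^{-1}=[U^{-1}]$ and identity the class of the empty word. The free group $\mathrm{HEG}_N=F(\{a_0,\ldots,a_N\})$ is regarded as a subgroup of $\mathrm{HEG}$ in the obvious way, and the word map $p_N$ induces a group retraction $p_N:\mathrm{HEG}\rightarrow\mathrm{HEG}_N$. A group $H$ is n-slender if for every homomorphism $\phi:\mathrm{HEG}\rightarrow H$ there exists $N\in\omega$ such that $\phi=\phi\circ p_N$. *)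

(* Defs.v *)
Set Implicit Arguments.
Unset Strict Implicit.
Unset Printing Implicit Defensive.

(* Rocq's own type theory is compatible with choice principles under which
   "every subset of 2^omega has the Baire property" is false.  The theory
   ZF + DC + "every subset of 2^omega has the Baire property" is therefore
   represented by its models: a structure (S, mem) for the language of set
   theory, with first-order Separation and Replacement schemas.  Every notion
   below is a formula of set theory evaluated in S: all quantifiers range over
   the elements of S, and natural numbers, functions, groups, words, ... are
   elements of S. *)

Record eps_structure : Type := EpsStructure {
  carrier :> Type;
  mem : carrier -> carrier -> Prop
}.

Notation "x ∈ a" := (mem x a) (at level 70, no associativity).
Notation "x ∉ a" := (~ mem x a) (at level 70, no associativity).

(** * First-order formulas of set theory (de Bruijn indices) *)

Inductive formula : Type :=
| FMem : nat -> nat -> formula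
| FEq : nat -> nat -> formula
| FFalse : formula
| FImp : formula -> formula -> formula
| FAll : formula -> formula.

Definition scons (T : Type) (x : T) (env : nat -> T) (n : nat) : T :=
  match n with O => x | S k => env k end.

Fixpoint sat (S : eps_structure) (env : nat -> S) (phi : formula) : Prop :=
  match phi with
  | FMem i j => env i ∈ env j
  | FEq i j => env i = env j
  | FFalse => False
  | FImp p q => sat env p -> sat env q
  | FAll p => forall x : S, sat (scons x env) p
  end.

(** * Basic set-theoretic vocabulary *)

Definition sub (S : eps_structure) (a b : S) : Prop := forall x, x ∈ a -> x ∈ b.

Definition is_empty (S : eps_structure) (a : S) : Prop := forall x, x ∉ a.

Definition is_upair (S : eps_structure) (p x y : S) : Prop :=
  forall z, z ∈ p <-> z = x \/ z = y.

Definition is_opair (S : eps_structure) (p x y : S) : Prop :=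
  exists s d, is_upair s x x /\ is_upair d x y /\ is_upair p s d.

Definition is_succ (S : eps_structure) (s n : S) : Prop :=
  forall z, z ∈ s <-> z ∈ n \/ z = n.

Definition is_inductive (S : eps_structure) (w : S) : Prop :=
  (exists z, is_empty z /\ z ∈ w) /\
  (forall n, n ∈ w -> exists s, is_succ s n /\ s ∈ w).

(** * The axioms of ZF *)

Record ZF (S : eps_structure) : Prop := {
  ZF_extensionality :
    forall a b : S, (forall x, x ∈ a <-> x ∈ b) -> a = b;
  ZF_foundation :
    forall a : S, (exists x, x ∈ a) ->
      exists x, x ∈ a /\ forall y, y ∈ a -> y ∉ x;
  ZF_pairing :
    forall x y : S, exists p, is_upair p x y;
  ZF_union :
    forall a : S, exists u, forall x, x ∈ u <-> exists b, b ∈ a /\ x ∈ b;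
  ZF_power :
    forall a : S, exists p, forall x, x ∈ p <-> sub x a;
  ZF_infinity :
    exists w : S, is_inductive w;
  ZF_separation :
    forall (phi : formula) (env : nat -> S) (a : S),
      exists b, forall x, x ∈ b <-> x ∈ a /\ sat (scons x env) phi;
  ZF_replacement :
    forall (phi : formula) (env : nat -> S) (a : S),
      (forall x, x ∈ a -> exists! y, sat (scons y (scons x env)) phi) ->
      exists b, forall y,
        y ∈ b <-> exists x, x ∈ a /\ sat (scons y (scons x env)) phi
}.

(** * Natural numbers, relations, functions, cardinality *)

(* von Neumann naturals, so that for naturals [i < n] is [i ∈ n] *)
Definition is_omega (S : eps_structure) (w : S) : Prop :=
  is_inductive w /\ forall v, is_inductive v -> sub w v.

Definition is_nat (S : eps_structure) (n : S) : Prop :=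
  exists w, is_omega w /\ n ∈ w.

Definition is_one (S : eps_structure) (o : S) : Prop :=
  exists z, is_empty z /\ is_succ o z.

Definition is_two (S : eps_structure) (t : S) : Prop :=
  exists o, is_one o /\ is_succ t o.

(* [(x, y) ∈ r]; when r is a function this reads r(x) = y *)
Definition rel (S : eps_structure) (r x y : S) : Prop :=
  exists p, p ∈ r /\ is_opair p x y.

Definition is_fun_on (S : eps_structure) (f X : S) : Prop :=
  (forall p, p ∈ f -> exists x y, x ∈ X /\ is_opair p x y) /\
  (forall x, x ∈ X -> exists! y, rel f x y).

Definition is_fun (S : eps_structure) (f X Y : S) : Prop :=
  is_fun_on f X /\ (forall x y, rel f x y -> y ∈ Y).

Definition is_injection (S : eps_structure) (f X Y : S) : Prop :=
  is_fun f X Y /\ (forall x x' y, rel f x y -> rel f x' y -> x = x').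

Definition is_bijection (S : eps_structure) (f X Y : S) : Prop :=
  is_injection f X Y /\ (forall y, y ∈ Y -> exists x, rel f x y).

Definition card_le (S : eps_structure) (X Y : S) : Prop :=
  exists f, is_injection f X Y.

Definition is_finite (S : eps_structure) (X : S) : Prop :=
  exists n f, is_nat n /\ is_bijection f X n.

Definition is_countable (S : eps_structure) (X : S) : Prop :=
  exists w, is_omega w /\ card_le X w.

(** * Dependent choice *)

Definition DC (S : eps_structure) : Prop :=
  forall X R : S,
    (exists x, x ∈ X) ->
    (forall x, x ∈ X -> exists y, y ∈ X /\ rel R x y) ->
    exists w z, is_omega w /\ is_fun z w X /\
      forall n sn x y, n ∈ w -> is_succ sn n ->
        rel z n x -> rel z sn y -> rel R x y.

(** * The Cantor space and the Baire property *)

Definition is_cantor (S : eps_structure) (C : S) : Prop :=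
  exists w t, is_omega w /\ is_two t /\ forall f, f ∈ C <-> is_fun f w t.

(* Product topology of the discrete space 2: around each of its points, an open
   set contains a basic box, which constrains finitely many coordinates. *)
Definition is_open (S : eps_structure) (C U : S) : Prop :=
  sub U C /\
  forall x, x ∈ U ->
    exists w F, is_omega w /\ sub F w /\ is_finite F /\
      forall y, y ∈ C ->
        (forall i b, i ∈ F -> rel x i b -> rel y i b) -> y ∈ U.

Definition adherent (S : eps_structure) (C N x : S) : Prop :=
  x ∈ C /\
  forall U, is_open C U -> x ∈ U -> exists y, y ∈ U /\ y ∈ N.

Definition is_nowhere_dense (S : eps_structure) (C N : S) : Prop :=
  sub N C /\
  forall U, is_open C U -> (forall x, x ∈ U -> adherent C N x) -> is_empty U.

Definition is_meager (S : eps_structure) (C A : S) : Prop :=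
  exists w f, is_omega w /\ is_fun_on f w /\
    (forall n N, rel f n N -> is_nowhere_dense C N) /\
    (forall x, x ∈ A <-> exists n N, rel f n N /\ x ∈ N).

Definition is_symdiff (S : eps_structure) (D Y U : S) : Prop :=
  forall x, x ∈ D <-> (x ∈ Y /\ x ∉ U) \/ (x ∈ U /\ x ∉ Y).

Definition has_Baire_property (S : eps_structure) (C Y : S) : Prop :=
  exists U D, is_open C U /\ is_symdiff D Y U /\ is_meager C D.

Definition all_sets_Baire (S : eps_structure) : Prop :=
  forall C Y : S, is_cantor C -> sub Y C -> has_Baire_property C Y.

(** * Groups *)

(* [m (x, y) = z], i.e. [((x, y), z) ∈ m] *)
Definition rel2 (S : eps_structure) (m x y z : S) : Prop :=
  exists p, is_opair p x y /\ rel m p z.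

Definition is_binop (S : eps_structure) (A m : S) : Prop :=
  (forall t, t ∈ m ->
     exists x y z p, x ∈ A /\ y ∈ A /\ z ∈ A /\
                     is_opair p x y /\ is_opair t p z) /\
  (forall x y, x ∈ A -> y ∈ A -> exists! z, rel2 m x y z).

Definition is_identity (S : eps_structure) (A m e : S) : Prop :=
  e ∈ A /\ forall x, x ∈ A -> rel2 m e x x /\ rel2 m x e x.

Definition is_group (S : eps_structure) (A m : S) : Prop :=
  is_binop A m /\
  (forall x y z xy yz t,
     rel2 m x y xy -> rel2 m y z yz -> (rel2 m xy z t <-> rel2 m x yz t)) /\
  (exists e, is_identity A m e /\
     forall x, x ∈ A -> exists y, y ∈ A /\ rel2 m x y e /\ rel2 m y x e).

Definition is_abelian_group (S : eps_structure) (A m : S) : Prop :=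
  is_group A m /\ forall x y z, rel2 m x y z -> rel2 m y x z.

(* The graphs [opG], [opH] of the operations are Rocq relations only so that
   definable operations can be used directly; they are never quantified over. *)
Definition is_hom (S : eps_structure) (G : S) (opG : S -> S -> S -> Prop)
    (H : S) (opH : S -> S -> S -> Prop) (phi : S) : Prop :=
  is_fun phi G H /\
  forall x y z x' y' z', x ∈ G -> y ∈ G -> z ∈ G -> opG x y z ->
    rel phi x x' -> rel phi y y' -> rel phi z z' -> opH x' y' z'.

(** * The integers, Z^omega and slenderness *)

Definition is_nat_add (S : eps_structure) (w a : S) : Prop :=
  is_binop w a /\
  (forall n z, n ∈ w -> is_empty z -> rel2 a n z n) /\
  (forall n k r sk sr, is_succ sk k -> is_succ sr r ->
     rel2 a n k r -> rel2 a n sk sr).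

Definition nat_add (S : eps_structure) (m n k : S) : Prop :=
  exists w a, is_omega w /\ is_nat_add w a /\ rel2 a m n k.

(* z is the integer m - n, i.e. the class of (m, n) in (omega * omega) / ~
   where (m, n) ~ (m', n') iff m + n' = m' + n *)
Definition int_class (S : eps_structure) (z m n : S) : Prop :=
  is_nat m /\ is_nat n /\
  forall p, p ∈ z <->
    exists m' n' k, is_nat m' /\ is_nat n' /\ is_opair p m' n' /\
                    nat_add m n' k /\ nat_add m' n k.

Definition is_int_set (S : eps_structure) (Z : S) : Prop :=
  forall z, z ∈ Z <-> exists m n, int_class z m n.

Definition int_add (S : eps_structure) (x y z : S) : Prop :=
  exists m n m' n' s t,
    int_class x m n /\ int_class y m' n' /\
    nat_add m m' s /\ nat_add n n' t /\ int_class z s t.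

Definition int_zero (S : eps_structure) (z : S) : Prop :=
  exists o, is_empty o /\ int_class z o o.

Definition is_Zomega (S : eps_structure) (G : S) : Prop :=
  exists w Z, is_omega w /\ is_int_set Z /\ forall f, f ∈ G <-> is_fun f w Z.

Definition Zomega_add (S : eps_structure) (x y z : S) : Prop :=
  forall i a b c, rel x i a -> rel y i b -> rel z i c -> int_add a b c.

(* y = proj_N x; the first N coordinates are those with index in N *)
Definition Zomega_proj (S : eps_structure) (N x y : S) : Prop :=
  forall i a b, rel x i a -> rel y i b ->
    (i ∈ N -> b = a) /\ (i ∉ N -> int_zero b).

Definition slender (S : eps_structure) (A m : S) : Prop :=
  forall G, is_Zomega G ->
  forall phi, is_hom G (@Zomega_add S) A (rel2 m) phi ->
  exists N, is_nat N /\
    forall x y a, x ∈ G -> y ∈ G -> Zomega_proj N x y ->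
      (rel phi x a <-> rel phi y a).

(** * Words *)

(* The letter a_n is coded by (n, 0) and its formal inverse by (n, 1). *)
Definition is_letter (S : eps_structure) (x n : S) : Prop :=
  is_nat n /\ exists t e, is_two t /\ e ∈ t /\ is_opair x n e.

Definition inverse_letters (S : eps_structure) (x y : S) : Prop :=
  exists n d e, is_letter x n /\ is_letter y n /\
    is_opair x n d /\ is_opair y n e /\ d <> e.

(* x is one of a_0^{+-1}, ..., a_N^{+-1} *)
Definition letter_upto (S : eps_structure) (N x : S) : Prop :=
  exists n, is_letter x n /\ (n ∈ N \/ n = N).

Definition is_strict_total_order (S : eps_structure) (D R : S) : Prop :=
  (forall p, p ∈ R -> exists i j, i ∈ D /\ j ∈ D /\ is_opair p i j) /\
  (forall i, ~ rel R i i) /\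
  (forall i j k, rel R i j -> rel R j k -> rel R i k) /\
  (forall i j, i ∈ D -> j ∈ D -> i = j \/ rel R i j \/ rel R j i).

(* A word is coded as the pair (R, f) of a function f and a strict total order
   R of the domain of f. *)
Definition is_word (S : eps_structure) (W : S) : Prop :=
  exists D R f,
    is_opair W R f /\ is_countable D /\ is_strict_total_order D R /\
    is_fun_on f D /\
    (forall i x, rel f i x -> exists n, is_letter x n) /\
    (forall n, is_nat n -> exists F, is_finite F /\
       forall i, i ∈ F <-> exists x, rel f i x /\ is_letter x n).

Definition letter_at (S : eps_structure) (W i x : S) : Prop :=
  exists R f, is_opair W R f /\ rel f i x.

Definition before (S : eps_structure) (W i j : S) : Prop :=
  exists R f, is_opair W R f /\ rel R i j.

Definition in_dom (S : eps_structure) (W i : S) : Prop :=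
  exists x, letter_at W i x.

Definition is_dom (S : eps_structure) (W D : S) : Prop :=
  forall i, i ∈ D <-> in_dom W i.

Definition word_iso (S : eps_structure) (U V : S) : Prop :=
  exists D E f, is_dom U D /\ is_dom V E /\ is_bijection f D E /\
    (forall i j i' j', rel f i i' -> rel f j j' ->
       (before U i j <-> before V i' j')) /\
    (forall i i' x, rel f i i' -> (letter_at U i x <-> letter_at V i' x)).

(* V is the restriction of U to the positions satisfying P *)
Definition is_restriction (S : eps_structure) (U : S) (P : S -> Prop) (V : S)
    : Prop :=
  is_word V /\
  (forall i x, letter_at V i x <-> letter_at U i x /\ P i) /\
  (forall i j, before V i j <-> before U i j /\ P i /\ P j).

Definition word_proj (S : eps_structure) (N U V : S) : Prop :=
  is_restriction U (fun i => exists x, letter_at U i x /\ letter_upto N x) V.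

(* T is UV, with domain the disjoint union {0} * dom U + {1} * dom V *)
Definition in_left (S : eps_structure) (k i : S) : Prop :=
  exists o, is_empty o /\ is_opair k o i.

Definition in_right (S : eps_structure) (k i : S) : Prop :=
  exists o, is_one o /\ is_opair k o i.

Definition is_concat (S : eps_structure) (U V T : S) : Prop :=
  is_word T /\
  (forall k x, letter_at T k x <->
     (exists i, in_left k i /\ letter_at U i x) \/
     (exists i, in_right k i /\ letter_at V i x)) /\
  (forall k l, before T k l <->
     (exists i j, in_left k i /\ in_left l j /\ before U i j) \/
     (exists i j, in_left k i /\ in_right l j /\ in_dom U i /\ in_dom V j) \/
     (exists i j, in_right k i /\ in_right l j /\ before V i j)).

(** * Equality in the free group F({a_0, ..., a_N}) *)

Definition is_finite_word (S : eps_structure) (N U : S) : Prop :=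
  is_word U /\
  (exists D, is_dom U D /\ is_finite D) /\
  (forall i x, letter_at U i x -> letter_upto N x).

(* V is U with two consecutive, mutually inverse letters deleted *)
Definition cancels (S : eps_structure) (U V : S) : Prop :=
  exists i j x y,
    before U i j /\ (forall k, ~ (before U i k /\ before U k j)) /\
    letter_at U i x /\ letter_at U j y /\ inverse_letters x y /\
    is_restriction U (fun k => k <> i /\ k <> j) V.

Definition free_step (S : eps_structure) (U V : S) : Prop :=
  word_iso U V \/ cancels U V \/ cancels V U.

(* a finite chain s(0), ..., s(k) of elementary steps from U to V *)
Definition free_eq (S : eps_structure) (N U V : S) : Prop :=
  exists k sk s z,
    is_nat k /\ is_succ sk k /\ is_empty z /\ is_fun_on s sk /\
    (forall i X, rel s i X -> is_finite_word N X) /\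
    rel s z U /\ rel s k V /\
    (forall i si X Y, i ∈ k -> is_succ si i ->
       rel s i X -> rel s si Y -> free_step X Y).

(** * The Hawaiian earring group and n-slenderness *)

Definition word_sim (S : eps_structure) (U V : S) : Prop :=
  forall N, is_nat N ->
  forall U' V', word_proj N U U' -> word_proj N V V' -> free_eq N U' V'.

(* h = [U].  All words together form a proper class, so [U] collects only the
   words ~-equivalent to U whose domain is a subset of omega; every word is
   isomorphic to one of these, and isomorphic words are ~-equivalent.  The word U
   itself may have any countable domain. *)
Definition heg_class (S : eps_structure) (h U : S) : Prop :=
  is_word U /\
  forall V, V ∈ h <->
    is_word V /\ (forall i, in_dom V i -> is_nat i) /\ word_sim U V.

Definition is_HEG (S : eps_structure) (G : S) : Prop :=
  forall h, h ∈ G <-> exists U, heg_class h U.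

Definition heg_mul (S : eps_structure) (g h k : S) : Prop :=
  exists U V T, heg_class g U /\ heg_class h V /\ is_concat U V T /\
                heg_class k T.

(* k = p_N h, with HEG_N seen inside HEG *)
Definition heg_proj (S : eps_structure) (N h k : S) : Prop :=
  exists U U', heg_class h U /\ word_proj N U U' /\ heg_class k U'.

Definition n_slender (S : eps_structure) (H m : S) : Prop :=
  forall G, is_HEG G ->
  forall phi, is_hom G (@heg_mul S) H (rel2 m) phi ->
  exists N, is_nat N /\
    forall h k a, h ∈ G -> k ∈ G -> heg_proj N h k ->
      (rel phi h a <-> rel phi k a).

(* Main.v *)
(* If a homomorphism phi witnesses that A is not slender, dependent choice gives
   x_n in Z^omega, zero on the first n coordinates, with phi(x_n) <> 1.  Put
   F(al) = phi(sum of the x_n with al(n) = 1): changing one coordinate of al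
   changes F(al).  For HEG the x_n are words in the letters beyond a_n, and F(al)
   is the image of the infinite concatenation of those x_n with al(n) = 1.

   Any such F : 2^omega -> A yields |2^omega| <= |A|.  The set
   Y = {(x, y) | F(x) = F(y)} has the Baire property; it is meager, since if it
   were comeager in a basic box, some (x, y) and (x, y') in the box with y, y'
   differing in one coordinate would both belong to Y.  So there are an interval
   partition (I_k) of omega and a pair (z, z') such that (x, y) lies outside the
   j-th nowhere dense set covering Y as soon as x = z and y = z' on some I_k with
   a(k) = j, where k |-> (a(k), b(k)) enumerates omega x omega.  Sending s to the
   point that on I_k equals z if s(b(k)) = 0 and z' if s(b(k)) = 1 gives pairwise
   Y-inequivalent points. *)

(* Everything takes place inside the model [S], where sets exist only by the axioms: separation asks
   for a first-order formula, so each predicate in use must be shown definable, and recursions run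
   through [DC]. The metatheoretic [epsilon] only names objects that are uniquely determined, so no
   choice enters the model. The Baire property is assumed for subsets of 2^omega, not of its square,
   so Y is coded by interleaving x on the even and y on the odd coordinates. Blocks with even ends
   keep the two halves aligned and do the work of category theorems on the square: a point that
   agrees with a fixed one on all blocks escapes every nowhere dense set, while the coordinates
   before the first block stay free. If Y were comeager in a box, an odd coordinate could thus be
   flipped without leaving Y; with blocks starting at 0, the same construction gives z and z' as the
   halves of one point. Two points s and t may differ in a single coordinate i, which must have a
   block for each nowhere dense set j; hence the enumeration of all pairs (j, i). On the group side
   x_n is isolated by cancelling the other factors. *)
Require Import Defs.
From Stdlib Require Import Classical ClassicalEpsilon Arith Lia.

Set Implicit Arguments.
Unset Strict Implicit.

(** * Definable predicates *)

Existing Class ZF.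

Section Definability.
Context {M : eps_structure} {zf : ZF M}.

(* Variables of even index are parameters [rho]; the others are read in [e]. *)
Definition mix (rho e : nat -> M) (n : nat) : M :=
  if Nat.even n then rho (Nat.div2 n) else e (Nat.div2 n).

(** A semantic notion: the closure lemmas act on predicates of the metatheory, and formulas occur
    only inside their proofs. The unlimited supply of parameter slots lets two predicates merge
    their parameters without counting free variables. *)
Definition definable (P : (nat -> M) -> Prop) : Prop :=
  exists phi rho, forall e, P e <-> sat (mix rho e) phi.

Definition up (r : nat -> nat) (n : nat) : nat :=
  match n with O => O | S k => S (r k) end.

Fixpoint rename (r : nat -> nat) (phi : formula) : formula :=
  match phi with
  | FMem i j => FMem (r i) (r j)
  | FEq i j => FEq (r i) (r j)
  | FFalse => FFalse
  | FImp p q => FImp (rename r p) (rename r q)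
  | FAll p => FAll (rename (up r) p)
  end.

Lemma sat_rename (phi : formula) : forall (r : nat -> nat) (e e' : nat -> M),
  (forall n, e (r n) = e' n) -> (sat e (rename r phi) <-> sat e' phi).
Proof.
  induction phi as [i j|i j| |p IHp q IHq|p IHp]; intros r e e' H; simpl.
  - now rewrite !H.
  - now rewrite !H.
  - tauto.
  - rewrite (IHp r e e' H), (IHq r e e' H). tauto.
  - split; intros K x; specialize (K x); revert K; apply IHp; intros [|n]; simpl; auto.
Qed.

Lemma D_iff (P Q : (nat -> M) -> Prop) :
  (forall e, P e <-> Q e) -> definable P -> definable Q.
Proof.
  intros H (phi & rho & K). exists phi, rho. intros e. rewrite <- H. apply K.
Qed.

Lemma mix_even rho e n : mix rho e (2 * n) = rho n.
Proof. unfold mix. now rewrite Nat.even_even, Nat.div2_even. Qed.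

Lemma mix_odd rho e n : mix rho e (2 * n + 1) = e n.
Proof. unfold mix. now rewrite Nat.even_odd, Nat.div2_odd'. Qed.

Lemma even_odd_cases (n : nat) : exists k, n = 2 * k \/ n = 2 * k + 1.
Proof. exists (Nat.div2 n). pose proof (Nat.div2_odd n). destruct (Nat.odd n); simpl in *; lia. Qed.

Lemma D_rename (P : (nat -> M) -> Prop) (r : nat -> nat) :
  definable P -> definable (fun e => P (fun i => e (r i))).
Proof.
  intros (phi & rho & K).
  exists (rename (fun n => if Nat.even n then n else 2 * r (Nat.div2 n) + 1) phi), rho.
  intros e. rewrite K. symmetry. apply sat_rename.
  intros n. destruct (even_odd_cases n) as [k [->| ->]].
  - rewrite Nat.even_even, !mix_even. reflexivity.
  - rewrite Nat.even_odd, Nat.div2_odd', !mix_odd. reflexivity.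
Qed.

Lemma ZF_inhabited : inhabited M.
Proof. destruct (ZF_infinity zf) as [w _]. exact (inhabits w). Qed.

Lemma D_var_mem i j : definable (fun e => e i ∈ e j).
Proof.
  destruct ZF_inhabited as [o]. exists (FMem (2 * i + 1) (2 * j + 1)), (fun _ => o).
  intros e. cbn [sat]. now rewrite !mix_odd.
Qed.

Lemma D_var_eq i j : definable (fun e => e i = e j).
Proof.
  destruct ZF_inhabited as [o]. exists (FEq (2 * i + 1) (2 * j + 1)), (fun _ => o).
  intros e. cbn [sat]. now rewrite !mix_odd.
Qed.

Lemma D_False : definable (fun _ => False).
Proof. destruct ZF_inhabited as [o]. now exists FFalse, (fun _ => o). Qed.

Lemma D_imp (P Q : (nat -> M) -> Prop) : definable P -> definable Q -> definable (fun e => P e -> Q e).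
Proof.
  intros (p & rho & Hp) (q & sigma & Hq).
  (* The parameter lists are interleaved: the k-th parameter of [p] becomes number 2k and that of
     [q] number 2k + 1, so an even index n turns into 2n or 2(n + 1). *)
  exists (FImp (rename (fun n => if Nat.even n then 2 * n else n) p)
               (rename (fun n => if Nat.even n then 2 * (n + 1) else n) q)),
    (fun n => if Nat.even n then rho (Nat.div2 n) else sigma (Nat.div2 n)).
  intros e. rewrite Hp, Hq. cbn [sat].
  rewrite (@sat_rename p _ _ (mix rho e)), (@sat_rename q _ _ (mix sigma e)); [tauto| |].
  - intros n. destruct (even_odd_cases n) as [k [->| ->]].
    + rewrite Nat.even_even.
      rewrite !mix_even, Nat.even_odd, Nat.div2_odd'. reflexivity.
    + rewrite Nat.even_odd, !mix_odd. reflexivity.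
  - intros n. destruct (even_odd_cases n) as [k [->| ->]].
    + rewrite Nat.even_even, !mix_even, Nat.even_even, Nat.div2_even. reflexivity.
    + rewrite Nat.even_odd, !mix_odd. reflexivity.
Qed.

Lemma D_all (P : (nat -> M) -> M -> Prop) :
  definable (fun e => P (fun i => e (S i)) (e 0)) -> definable (fun e => forall x, P e x).
Proof.
  intros (p & rho & Hp).
  (* In [p] the quantified element is variable 0, at index 1. Below [FAll] it has index 0 and all
     outer indices move up by one, so parameters land on odd and the other variables on even
     positions. *)
  exists (FAll (rename (fun n => if Nat.even n then n + 1 else
                 match Nat.div2 n with O => 0 | S k => 2 * k + 2 end) p)), rho.
  intros e. cbn [sat]. split; intros K x; specialize (K x).
  - rewrite (@sat_rename p _ _ (mix rho (scons x e))); [apply (proj1 (Hp (scons x e))); exact K|].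
    intros n. destruct (even_odd_cases n) as [k [->| ->]].
    + rewrite Nat.even_even, mix_even, Nat.add_1_r. cbn [scons]. apply mix_even.
    + rewrite Nat.even_odd, mix_odd, Nat.div2_odd'. destruct k; [reflexivity|].
      rewrite Nat.add_succ_r. cbn [scons]. apply mix_odd.
  - rewrite (@sat_rename p _ _ (mix rho (scons x e))) in K; [apply (proj2 (Hp (scons x e))); exact K|].
    intros n. destruct (even_odd_cases n) as [k [->| ->]].
    + rewrite Nat.even_even, mix_even, Nat.add_1_r. cbn [scons]. apply mix_even.
    + rewrite Nat.even_odd, mix_odd, Nat.div2_odd'. destruct k; [reflexivity|].
      rewrite Nat.add_succ_r. cbn [scons]. apply mix_odd.
Qed.

Lemma D_not (P : (nat -> M) -> Prop) : definable P -> definable (fun e => ~ P e).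
Proof. intros H. exact (D_imp H D_False). Qed.

Lemma D_and (P Q : (nat -> M) -> Prop) : definable P -> definable Q -> definable (fun e => P e /\ Q e).
Proof.
  intros H K. apply (D_iff (P := fun e => ~ (P e -> ~ Q e))); [intros e; tauto|].
  apply D_not, D_imp, D_not; assumption.
Qed.

Lemma D_or (P Q : (nat -> M) -> Prop) : definable P -> definable Q -> definable (fun e => P e \/ Q e).
Proof.
  intros H K. apply (D_iff (P := fun e => ~ P e -> Q e)); [intros e; tauto|].
  apply D_imp, K. now apply D_not.
Qed.

Lemma D_equiv (P Q : (nat -> M) -> Prop) : definable P -> definable Q -> definable (fun e => P e <-> Q e).
Proof. intros H K. apply D_and; now apply D_imp. Qed.

Lemma D_ex (P : (nat -> M) -> M -> Prop) :
  definable (fun e => P (fun i => e (S i)) (e 0)) -> definable (fun e => exists x, P e x).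
Proof.
  intros H. apply (D_iff (P := fun e => ~ forall x, ~ P e x)).
  - intros e. split.
    + intros K. apply NNPP. intros L. apply K. intros x Hx. eauto.
    + intros [x Hx] K. exact (K x Hx).
  - apply D_not, D_all, D_not, H.
Qed.

Definition definable_term (t : (nat -> M) -> M) : Prop := definable (fun e => e 0 = t (fun i => e (S i))).

Lemma DT_var i : definable_term (fun e => e i).
Proof. apply D_var_eq. Qed.

Lemma DT_const c : definable_term (fun _ => c).
Proof.
  exists (FEq 1 0), (fun _ => c). intros e. cbn [sat]. unfold mix. reflexivity.
Qed.

Lemma DT_comp t (P : (nat -> M) -> M -> Prop) :
  definable_term t -> definable (fun e => P (fun i => e (S i)) (e 0)) -> definable (fun e => P e (t e)).
Proof.
  intros H K. apply (D_iff (P := fun e => exists x, x = t e /\ P e x)).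
  - intros e. split; [intros (x & -> & Hx); exact Hx|eauto].
  - apply D_ex, D_and; assumption.
Qed.

Lemma DT_shift t : definable_term t -> definable_term (fun e => t (fun i => e (S i))).
Proof.
  intros H. exact (D_rename (fun i => match i with 0 => 0 | S j => S (S j) end) H).
Qed.

(** Formulated for arbitrary definable terms in place of variables, so that these properties can
    serve as type classes and [dfn] can descend into an atomic formula argument by argument. *)
Definition definable1 (R : M -> Prop) : Prop := forall t, definable_term t -> definable (fun e => R (t e)).
Definition definable2 (R : M -> M -> Prop) : Prop :=
  forall t u, definable_term t -> definable_term u -> definable (fun e => R (t e) (u e)).
Definition definable3 (R : M -> M -> M -> Prop) : Prop :=
  forall t u v, definable_term t -> definable_term u -> definable_term v ->
    definable (fun e => R (t e) (u e) (v e)).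
Definition definable4 (R : M -> M -> M -> M -> Prop) : Prop :=
  forall t u v w, definable_term t -> definable_term u -> definable_term v -> definable_term w ->
    definable (fun e => R (t e) (u e) (v e) (w e)).

Lemma definable1_intro R : definable (fun e => R (e 0)) -> definable1 R.
Proof.
  intros H t Ht. apply (DT_comp (P := fun e x => R x)); [exact Ht|].
  exact H.
Qed.

Lemma definable2_intro R : definable (fun e => R (e 0) (e 1)) -> definable2 R.
Proof.
  intros H t u Ht Hu.
  apply (DT_comp (P := fun e x => R x (u e))); [exact Ht|].
  apply (DT_comp (P := fun e x => R (e 0) x)); [now apply DT_shift|].
  (* Each substitution pushes the values already introduced one index up, so the arguments arrive in
     reverse order. *)
  exact (D_rename (fun i => match i with 0 => 1 | _ => 0 end) H).
Qed.

Lemma definable3_intro R : definable (fun e => R (e 0) (e 1) (e 2)) -> definable3 R.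
Proof.
  intros H t u v Ht Hu Hv.
  apply (DT_comp (P := fun e x => R x (u e) (v e))); [exact Ht|].
  apply (DT_comp (P := fun e x => R (e 0) x (v (fun i => e (S i))))); [now apply DT_shift|].
  apply (DT_comp (P := fun e x => R (e 1) (e 0) x)); [exact (DT_shift (DT_shift Hv))|].
  exact (D_rename (fun i => match i with 0 => 2 | 1 => 1 | _ => 0 end) H).
Qed.

Lemma definable4_intro R : definable (fun e => R (e 0) (e 1) (e 2) (e 3)) -> definable4 R.
Proof.
  intros H t u v w Ht Hu Hv Hw.
  apply (DT_comp (P := fun e x => R x (u e) (v e) (w e))); [exact Ht|].
  apply (DT_comp (P := fun e x => R (e 0) x (v (fun i => e (S i))) (w (fun i => e (S i)))));
    [now apply DT_shift|].
  apply (DT_comp (P := fun e x => R (e 1) (e 0) x (w (fun i => e (S (S i))))));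
    [exact (DT_shift (DT_shift Hv))|].
  apply (DT_comp (P := fun e x => R (e 2) (e 1) (e 0) x)); [exact (DT_shift (DT_shift (DT_shift Hw)))|].
  exact (D_rename (fun i => match i with 0 => 3 | 1 => 2 | 2 => 1 | _ => 0 end) H).
Qed.

Lemma def_mem : definable2 (@mem M).
Proof. apply definable2_intro, D_var_mem. Qed.

Lemma def_eq : definable2 (@eq M).
Proof. apply definable2_intro, D_var_eq. Qed.

Lemma D_exuniq (P : (nat -> M) -> M -> Prop) :
  definable (fun e => P (fun i => e (S i)) (e 0)) -> definable (fun e => exists! x, P e x).
Proof.
  intros H. apply D_ex, D_and; [exact H|].
  apply D_all, D_imp.
  - exact (D_rename (fun i => match i with 0 => 0 | S j => S (S j) end) H).
  - apply D_var_eq.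
Qed.

(* The empty set if [P] has no unique witness; fixing this value makes the graph of
   [iota P] definable together with [P]. *)
Definition iota (P : M -> Prop) : M :=
  epsilon ZF_inhabited (fun y =>
    (P y /\ forall y', P y' -> y' = y) \/
    (~ (exists y, P y /\ forall y', P y' -> y' = y) /\ is_empty y)).

Lemma ex_empty : exists z : M, is_empty z.
Proof. destruct (ZF_infinity zf) as (w & (z & Hz & _) & _). eauto. Qed.

Lemma iota_graph (P : M -> Prop) y :
  y = iota P <->
  (P y /\ forall y', P y' -> y' = y) \/
  (~ (exists y, P y /\ forall y', P y' -> y' = y) /\ is_empty y).
Proof.
  assert (K : exists y, (P y /\ forall y', P y' -> y' = y) \/
    (~ (exists y, P y /\ forall y', P y' -> y' = y) /\ is_empty y)).
  { destruct (classic (exists y, P y /\ forall y', P y' -> y' = y)) as [[x Hx]|H].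
    - exists x. now left.
    - destruct ex_empty as [z Hz]. exists z. now right. }
  apply (epsilon_spec ZF_inhabited) in K. fold (iota P) in K.
  split; [now intros ->|].
  intros [[H1 H2]|[H1 H2]]; destruct K as [[K1 K2]|[K1 K2]].
  - now apply K2.
  - exfalso; eauto.
  - exfalso; eauto.
  - apply (ZF_extensionality zf). intros x. split; intros Hx; exfalso;
      [now apply (H2 x)|now apply (K2 x)].
Qed.

Lemma iota_spec (P : M -> Prop) :
  (exists y, P y) -> (forall y y', P y -> P y' -> y = y') -> P (iota P).
Proof.
  intros [y Hy] U. replace (iota P) with y; [exact Hy|].
  apply iota_graph. left. split; [exact Hy|]. intros y' Hy'. now apply U.
Qed.

Lemma DT_iota (P : (nat -> M) -> M -> Prop) :
  definable (fun e => P (fun i => e (S i)) (e 0)) -> definable_term (fun e => iota (P e)).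
Proof.
  intros H. unfold definable_term.
  apply (D_iff (P := fun e => (P (fun i => e (S i)) (e 0) /\
      forall y', P (fun i => e (S i)) y' -> y' = e 0) \/
    (~ (exists y, P (fun i => e (S i)) y /\ forall y', P (fun i => e (S i)) y' -> y' = y)
       /\ forall x, ~ x ∈ e 0))).
  - intros e. symmetry. apply iota_graph.
  - apply D_or; apply D_and.
    + exact H.
    + apply D_all, D_imp; [|apply D_var_eq].
      exact (D_rename (fun i => match i with 0 => 0 | S j => S (S j) end) H).
    + apply D_not, D_ex, D_and;
        [exact (D_rename (fun i => match i with 0 => 0 | S j => S (S j) end) H)|].
      apply D_all, D_imp; [|apply D_var_eq].
      exact (D_rename (fun i => match i with 0 => 0 | S j => S (S (S j)) end) H).
    + apply D_all, D_not, D_var_mem.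
Qed.

End Definability.

Existing Class definable1.
Existing Class definable2.
Existing Class definable3.
Existing Class definable4.
#[export] Existing Instance def_mem.
#[export] Existing Instance def_eq.
#[global] Opaque definable definable_term.

Ltac dinst := solve [assumption | typeclasses eauto].

(** Connectives are peeled off first. In the atomic case the largest arity is tried first, because a
    shorter pattern could absorb constant arguments into the head and leave a relation without an
    instance. *)
Ltac dfn_step :=
  cbv beta;
  lazymatch goal with
  | |- definable (fun e => forall x : carrier _, _) => apply D_all
  | |- definable (fun e => _ -> _) => apply D_imp
  | |- definable (fun e => _ <-> _) => apply D_equiv
  | |- definable (fun e => _ /\ _) => apply D_and
  | |- definable (fun e => _ \/ _) => apply D_or
  | |- definable (fun e => ~ _) => apply D_not
  | |- definable (fun e => exists! x, _) => apply D_exuniq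
  | |- definable (fun e => exists x, _) => apply D_ex
  | |- definable (fun e => False) => apply D_False
  | |- definable _ => first
    [ match goal with |- definable (fun e => ?R (@?t e) (@?u e) (@?v e) (@?w e)) =>
        notypeclasses refine ((_ : definable4 R) t u v w _ _ _ _); [dinst|..] end
    | match goal with |- definable (fun e => ?R (@?t e) (@?u e) (@?v e)) =>
        notypeclasses refine ((_ : definable3 R) t u v _ _ _); [dinst|..] end
    | match goal with |- definable (fun e => ?R (@?t e) (@?u e)) =>
        notypeclasses refine ((_ : definable2 R) t u _ _); [dinst|..] end
    | match goal with |- definable (fun e => ?R (@?t e)) =>
        notypeclasses refine ((_ : definable1 R) t _); [dinst|..] end ]
  | |- definable_term _ => first
    [ apply DT_var | apply DT_const | apply DT_iota ]
  | |- definable1 _ => apply definable1_intro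
  | |- definable2 _ => apply definable2_intro
  | |- definable3 _ => apply definable3_intro
  | |- definable4 _ => apply definable4_intro
  end.
Ltac dfn := repeat dfn_step.

(** * Definability of the set-theoretic and word-theoretic vocabulary *)

Section Inst.
Context {M : eps_structure} {zf : ZF M}.

#[export] Instance def_sub : definable2 (@sub M).
Proof. apply definable2_intro. unfold sub. dfn. Qed.
#[export] Instance def_is_empty : definable1 (@is_empty M).
Proof. apply definable1_intro. unfold is_empty. dfn. Qed.
#[export] Instance def_is_upair : definable3 (@is_upair M).
Proof. apply definable3_intro. unfold is_upair. dfn. Qed.
#[export] Instance def_is_opair : definable3 (@is_opair M).
Proof. apply definable3_intro. unfold is_opair. dfn. Qed.
#[export] Instance def_is_succ : definable2 (@is_succ M).
Proof. apply definable2_intro. unfold is_succ. dfn. Qed.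
#[export] Instance def_is_inductive : definable1 (@is_inductive M).
Proof. apply definable1_intro. unfold is_inductive. dfn. Qed.
#[export] Instance def_is_omega : definable1 (@is_omega M).
Proof. apply definable1_intro. unfold is_omega. dfn. Qed.
#[export] Instance def_is_nat : definable1 (@is_nat M).
Proof. apply definable1_intro. unfold is_nat. dfn. Qed.
#[export] Instance def_is_one : definable1 (@is_one M).
Proof. apply definable1_intro. unfold is_one. dfn. Qed.
#[export] Instance def_is_two : definable1 (@is_two M).
Proof. apply definable1_intro. unfold is_two. dfn. Qed.
#[export] Instance def_rel : definable3 (@rel M).
Proof. apply definable3_intro. unfold rel. dfn. Qed.
#[export] Instance def_is_fun_on : definable2 (@is_fun_on M).
Proof. apply definable2_intro. unfold is_fun_on. dfn. Qed.
#[export] Instance def_is_fun : definable3 (@is_fun M).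
Proof. apply definable3_intro. unfold is_fun. dfn. Qed.
#[export] Instance def_is_injection : definable3 (@is_injection M).
Proof. apply definable3_intro. unfold is_injection. dfn. Qed.
#[export] Instance def_is_bijection : definable3 (@is_bijection M).
Proof. apply definable3_intro. unfold is_bijection. dfn. Qed.
#[export] Instance def_card_le : definable2 (@card_le M).
Proof. apply definable2_intro. unfold card_le. dfn. Qed.
#[export] Instance def_is_finite : definable1 (@is_finite M).
Proof. apply definable1_intro. unfold is_finite. dfn. Qed.
#[export] Instance def_is_countable : definable1 (@is_countable M).
Proof. apply definable1_intro. unfold is_countable. dfn. Qed.
#[export] Instance def_rel2 : definable4 (@rel2 M).
Proof. apply definable4_intro. unfold rel2. dfn. Qed.
#[export] Instance def_nat_add : definable3 (@nat_add M).
Proof. apply definable3_intro. unfold nat_add, is_nat_add, is_binop. dfn. Qed.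
#[export] Instance def_int_class : definable3 (@int_class M).
Proof. apply definable3_intro. unfold int_class. dfn. Qed.
#[export] Instance def_is_letter : definable2 (@is_letter M).
Proof. apply definable2_intro. unfold is_letter. dfn. Qed.
#[export] Instance def_inverse_letters : definable2 (@inverse_letters M).
Proof. apply definable2_intro. unfold inverse_letters. dfn. Qed.
#[export] Instance def_letter_upto : definable2 (@letter_upto M).
Proof. apply definable2_intro. unfold letter_upto. dfn. Qed.
#[export] Instance def_is_sto : definable2 (@is_strict_total_order M).
Proof. apply definable2_intro. unfold is_strict_total_order. dfn. Qed.
#[export] Instance def_is_word : definable1 (@is_word M).
Proof. apply definable1_intro. unfold is_word. dfn. Qed.
#[export] Instance def_letter_at : definable3 (@letter_at M).
Proof. apply definable3_intro. unfold letter_at. dfn. Qed.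
#[export] Instance def_before : definable3 (@before M).
Proof. apply definable3_intro. unfold before. dfn. Qed.
#[export] Instance def_in_dom : definable2 (@in_dom M).
Proof. apply definable2_intro. unfold in_dom. dfn. Qed.
#[export] Instance def_is_dom : definable2 (@is_dom M).
Proof. apply definable2_intro. unfold is_dom. dfn. Qed.
#[export] Instance def_word_iso : definable2 (@word_iso M).
Proof. apply definable2_intro. unfold word_iso. dfn. Qed.
#[export] Instance def_word_proj : definable3 (@word_proj M).
Proof. apply definable3_intro. unfold word_proj, is_restriction. dfn. Qed.
#[export] Instance def_is_finite_word : definable2 (@is_finite_word M).
Proof. apply definable2_intro. unfold is_finite_word. dfn. Qed.
#[export] Instance def_cancels : definable2 (@cancels M).
Proof. apply definable2_intro. unfold cancels, is_restriction. dfn. Qed.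
#[export] Instance def_free_step : definable2 (@free_step M).
Proof. apply definable2_intro. unfold free_step. dfn. Qed.
#[export] Instance def_free_eq : definable3 (@free_eq M).
Proof. apply definable3_intro. unfold free_eq. dfn. Qed.
#[export] Instance def_word_sim : definable2 (@word_sim M).
Proof. apply definable2_intro. unfold word_sim. dfn. Qed.
#[export] Instance def_heg_class : definable2 (@heg_class M).
Proof. apply definable2_intro. unfold heg_class. dfn. Qed.
End Inst.

(** * Sets and functions *)

Section Sets.
Context {M : eps_structure} {zf : ZF M}.

Lemma set_ext (a b : M) : (forall x, x ∈ a <-> x ∈ b) -> a = b.
Proof. apply (ZF_extensionality zf). Qed.

(** All operations are unique descriptions, so [DT_iota] makes them definable terms that may occur
    inside separation predicates. *)
Definition empty : M := iota (@is_empty M).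
Definition upair (x y : M) : M := iota (fun p => is_upair p x y).
Definition pair (x y : M) : M := iota (fun p => is_opair p x y).
Definition succ (n : M) : M := iota (fun s => is_succ s n).
Definition union (a : M) : M := iota (fun u => forall x, x ∈ u <-> exists b, b ∈ a /\ x ∈ b).
Definition power (a : M) : M := iota (fun u => forall x, x ∈ u <-> sub x a).
Definition sep (a : M) (P : M -> Prop) : M := iota (fun b => forall x, x ∈ b <-> x ∈ a /\ P x).
Definition app (f x : M) : M := iota (fun y => rel f x y).

Lemma in_empty (x : M) : ~ x ∈ empty.
Proof.
  apply (iota_spec (P := @is_empty M)); [exact ex_empty|].
  intros y y' H K. apply set_ext. firstorder.
Qed.

Lemma in_upair (x y z : M) : z ∈ upair x y <-> z = x \/ z = y.
Proof.
  apply (iota_spec (P := fun p => is_upair p x y)); [apply (ZF_pairing zf)|].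
  intros p q H K. apply set_ext. intros t. now rewrite (H t), (K t).
Qed.

Lemma is_upair_iff (p x y : M) : is_upair p x y <-> p = upair x y.
Proof.
  split; [|intros ->; exact (in_upair x y)].
  intros H. apply set_ext. intros t. now rewrite (H t), in_upair.
Qed.

Lemma is_opair_iff (p x y : M) : is_opair p x y <-> p = pair x y.
Proof.
  assert (K : forall p, is_opair p x y <-> p = upair (upair x x) (upair x y)).
  { intros q. split.
    - intros (s & d & H1 & H2 & H3). rewrite is_upair_iff in *. now subst.
    - intros ->. exists (upair x x), (upair x y). now rewrite !is_upair_iff. }
  assert (L : is_opair (pair x y) x y).
  { apply (iota_spec (P := fun p => is_opair p x y)).
    - exists (upair (upair x x) (upair x y)). now apply K.
    - intros a b Ha Hb. apply K in Ha, Hb. congruence. }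
  split; [|now intros ->]. intros H. apply K in H, L. congruence.
Qed.

Lemma pair_kuratowski (x y : M) : pair x y = upair (upair x x) (upair x y).
Proof.
  symmetry. apply is_opair_iff. exists (upair x x), (upair x y). now rewrite !is_upair_iff.
Qed.

Lemma pair_inj (x y x' y' : M) : pair x y = pair x' y' <-> x = x' /\ y = y'.
Proof.
  split; [|now intros [-> ->]]. rewrite !pair_kuratowski. intros H.
  assert (A : forall a b c d : M, upair a b = upair c d ->
    (a = c /\ b = d) \/ (a = d /\ b = c)).
  { intros a b c d E.
    assert (a ∈ upair c d) by (rewrite <- E; apply in_upair; auto).
    assert (b ∈ upair c d) by (rewrite <- E; apply in_upair; auto).
    assert (c ∈ upair a b) by (rewrite E; apply in_upair; auto).
    assert (d ∈ upair a b) by (rewrite E; apply in_upair; auto).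
    rewrite in_upair in *. intuition congruence. }
  apply A in H as [[H1 H2]|[H1 H2]].
  - apply A in H1, H2. intuition congruence.
  - apply A in H1, H2. intuition congruence.
Qed.

Lemma in_succ (n z : M) : z ∈ succ n <-> z ∈ n \/ z = n.
Proof.
  apply (iota_spec (P := fun s => is_succ s n)).
  - destruct (ZF_union zf (upair n (upair n n))) as [u Hu]. exists u. intros x. rewrite Hu. split.
    + intros (b & Hb & Hx). apply in_upair in Hb as [->| ->]; [tauto|].
      apply in_upair in Hx. tauto.
    + intros [H| ->]; [exists n|exists (upair n n)]; rewrite !in_upair; auto.
  - intros a b Ha Hb. apply set_ext. intros x. now rewrite (Ha x), (Hb x).
Qed.

Lemma is_succ_iff (s n : M) : is_succ s n <-> s = succ n.
Proof.
  split; [|intros ->; exact (in_succ n)]. intros H. apply set_ext. intros x.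
  now rewrite (H x), in_succ.
Qed.

Lemma is_empty_iff (z : M) : is_empty z <-> z = empty.
Proof.
  split; [|intros ->; exact in_empty]. intros H. apply set_ext. intros x.
  split; intros K; exfalso; [exact (H x K)|exact (in_empty K)].
Qed.

Lemma in_union (a x : M) : x ∈ union a <-> exists b, b ∈ a /\ x ∈ b.
Proof.
  apply (iota_spec (P := fun u => forall x, x ∈ u <-> exists b, b ∈ a /\ x ∈ b)).
  - apply (ZF_union zf).
  - intros u v Hu Hv. apply set_ext. intros t. now rewrite Hu, Hv.
Qed.

Lemma in_power (a x : M) : x ∈ power a <-> sub x a.
Proof.
  apply (iota_spec (P := fun u => forall x, x ∈ u <-> sub x a)).
  - apply (ZF_power zf).
  - intros u v Hu Hv. apply set_ext. intros t. now rewrite Hu, Hv.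
Qed.

Lemma in_sep (a : M) (P : M -> Prop) :
  definable (fun e => P (e 0)) -> forall x, x ∈ sep a P <-> x ∈ a /\ P x.
Proof.
  intros HP. apply (iota_spec (P := fun b => forall x, x ∈ b <-> x ∈ a /\ P x)).
  - destruct HP as (phi & rho & H).
    (* [P] reads variable 0, at index 1; it is moved to the slot of the element being separated, and
       the remaining variables are filled with [a]. *)
    destruct (ZF_separation zf (rename (fun n => match n with 1 => 0 | _ => S n end) phi)
      (mix rho (fun _ => a)) a) as [b Hb].
    exists b. intros x. rewrite Hb.
    rewrite (@sat_rename _ phi _ _ (mix rho (scons x (fun _ => a)))).
    + now rewrite <- H.
    + intros [|[|n]]; [reflexivity|reflexivity|].
      cbn [scons]. unfold mix. cbn [Nat.even Nat.div2].
      destruct (Nat.even n); [reflexivity|].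
      reflexivity.
  - intros u v Hu Hv. apply set_ext. intros t. now rewrite Hu, Hv.
Qed.

Definition cup (a b : M) : M := union (upair a b).
Lemma in_cup (a b x : M) : x ∈ cup a b <-> x ∈ a \/ x ∈ b.
Proof.
  unfold cup. rewrite in_union. split.
  - intros (c & Hc & Hx). apply in_upair in Hc as [->| ->]; auto.
  - intros [H|H]; [exists a|exists b]; rewrite in_upair; auto.
Qed.

Definition prod (a b : M) : M :=
  sep (power (power (cup a b))) (fun p => exists x y, x ∈ a /\ y ∈ b /\ p = pair x y).
Lemma in_prod (a b p : M) : p ∈ prod a b <-> exists x y, x ∈ a /\ y ∈ b /\ p = pair x y.
Proof.
  unfold prod. rewrite in_sep by dfn. split; [tauto|]. intros H. split; [|exact H].
  destruct H as (x & y & Hx & Hy & ->). rewrite in_power. intros t Ht.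
  rewrite pair_kuratowski in Ht. rewrite in_power. intros z Hz. rewrite in_cup.
  apply in_upair in Ht as [->| ->]; apply in_upair in Hz as [->| ->]; auto.
Qed.

Lemma pair_in_prod (a b x y : M) : pair x y ∈ prod a b <-> x ∈ a /\ y ∈ b.
Proof.
  rewrite in_prod. split; [|intros [Hx Hy]; exists x, y; auto].
  intros (x' & y' & Hx & Hy & E). apply pair_inj in E as [-> ->]. auto.
Qed.

Lemma rel_iff (r x y : M) : rel r x y <-> pair x y ∈ r.
Proof.
  split.
  - intros (p & Hp & E). apply is_opair_iff in E. now subst.
  - intros H. exists (pair x y). now rewrite is_opair_iff.
Qed.

Lemma app_eq (f X Y x y : M) : is_fun f X Y -> rel f x y -> app f x = y.
Proof.
  intros [[H1 H2] H3] Hr.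
  assert (Hx : x ∈ X).
  { apply rel_iff in Hr. destruct (H1 _ Hr) as (a & b & Ha & E).
    apply is_opair_iff, pair_inj in E as [-> _]. exact Ha. }
  destruct (H2 x Hx) as (z & Hz & U).
  assert (K : rel f x (app f x)).
  { apply (iota_spec (P := fun y => rel f x y)); [eauto|].
    intros a b Ha Hb. rewrite <- (U a Ha). now apply U. }
  rewrite <- (U _ K). now apply U.
Qed.

Lemma fun_rel (f X Y x y : M) : is_fun f X Y -> (rel f x y <-> x ∈ X /\ y = app f x).
Proof.
  intros Hf. split.
  - intros Hr. split; [|symmetry; eapply app_eq; eauto].
    destruct Hf as [[H1 H2] H3]. apply rel_iff in Hr.
    destruct (H1 _ Hr) as (a & b & Ha & E).
    apply is_opair_iff, pair_inj in E as [-> _]. exact Ha.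
  - intros [Hx ->]. destruct Hf as [[H1 H2] H3] eqn:E.
    destruct (H2 x Hx) as (z & Hz & U).
    now rewrite (app_eq Hf Hz).
Qed.

Lemma fun_app_in (f X Y x : M) : is_fun f X Y -> x ∈ X -> app f x ∈ Y.
Proof.
  intros Hf Hx. assert (K : rel f x (app f x)) by (apply (fun_rel _ _ Hf); auto).
  destruct Hf as [_ H]. eauto.
Qed.

Lemma fun_app_rel (f X Y x : M) : is_fun f X Y -> x ∈ X -> rel f x (app f x).
Proof. intros Hf Hx. apply (fun_rel _ _ Hf); auto. Qed.

Lemma in_fun (f X Y p : M) : is_fun f X Y -> (p ∈ f <-> exists x, x ∈ X /\ p = pair x (app f x)).
Proof.
  intros Hf. split.
  - intros Hp. destruct Hf as [[H1 H2] H3] eqn:E.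
    destruct (H1 _ Hp) as (x & y & Hx & K). apply is_opair_iff in K. subst p.
    exists x. split; [exact Hx|]. apply rel_iff, (fun_rel _ _ Hf) in Hp as [_ ->]. reflexivity.
  - intros (x & Hx & ->). apply rel_iff. eapply fun_app_rel; eauto.
Qed.

Lemma fun_ext (f g X Y Y' : M) : is_fun f X Y -> is_fun g X Y' ->
  (forall x, x ∈ X -> app f x = app g x) -> f = g.
Proof.
  intros Hf Hg H. apply set_ext. intros p. rewrite (in_fun _ Hf), (in_fun _ Hg).
  split; intros (x & Hx & ->); exists x; (split; [exact Hx|]); now rewrite H.
Qed.

(** The double union of a set of Kuratowski pairs contains all second coordinates; it supplies the
    codomain that [is_fun_on] does not name. *)
Lemma is_fun_on_fun (f X : M) : is_fun_on f X -> exists Y, is_fun f X Y.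
Proof.
  intros Hf. exists (union (union f)). split; [exact Hf|]. intros x y Hr.
  apply rel_iff in Hr. apply in_union. exists (upair x y). rewrite in_upair. split; [|auto].
  apply in_union. exists (pair x y). split; [exact Hr|].
  rewrite pair_kuratowski. apply in_upair. auto.
Qed.

Definition funs (X Y : M) : M := sep (power (prod X Y)) (fun f => is_fun f X Y).
Lemma in_funs (X Y f : M) : f ∈ funs X Y <-> is_fun f X Y.
Proof.
  unfold funs. rewrite in_sep by dfn. rewrite in_power. split; [tauto|]. intros H.
  split; [|exact H]. intros p Hp. apply (in_fun _ H) in Hp as (x & Hx & ->).
  apply pair_in_prod. split; [exact Hx|]. eapply fun_app_in; eauto.
Qed.

(** * Natural numbers *)

Lemma ex_omega : exists w : M, is_omega w.
Proof.
  destruct (ZF_infinity zf) as [w Hw].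
  exists (sep w (fun n => forall v, is_inductive v -> n ∈ v)).
  assert (K : forall n, n ∈ sep w (fun n => forall v, is_inductive v -> n ∈ v) <->
    n ∈ w /\ forall v, is_inductive v -> n ∈ v) by (intros n; apply in_sep; dfn).
  split; [split|].
  - exists empty. rewrite is_empty_iff, K. split; [reflexivity|].
    assert (L : forall v : M, is_inductive v -> empty ∈ v).
    { intros v [(z & Hz & Hzv) _]. apply is_empty_iff in Hz. now subst. }
    auto.
  - intros n Hn. apply K in Hn as [Hn Hv]. exists (succ n).
    rewrite is_succ_iff, K. split; [reflexivity|].
    assert (L : forall v : M, is_inductive v -> n ∈ v -> succ n ∈ v).
    { intros v [_ Hi] Hnv. destruct (Hi n Hnv) as (s & Hs & Hsv).
      apply is_succ_iff in Hs. now subst. }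
    auto.
  - intros v Hv n Hn. apply K in Hn as [_ Hn]. exact (Hn v Hv).
Qed.

Definition omega : M := iota (@is_omega M).

Lemma is_omega_iff (w : M) : is_omega w <-> w = omega.
Proof.
  assert (U : forall a b : M, is_omega a -> is_omega b -> a = b).
  { intros a b [Ha Ka] [Hb Kb]. apply set_ext. intros x. split; [apply Ka|apply Kb]; assumption. }
  assert (K : is_omega omega) by (apply (iota_spec (P := @is_omega M)); [exact ex_omega|exact U]).
  split; [|now intros ->]. intros H. now apply U.
Qed.

Lemma omega_is_omega : is_omega omega.
Proof. now apply is_omega_iff. Qed.

Lemma is_nat_iff (n : M) : is_nat n <-> n ∈ omega.
Proof.
  split.
  - intros (w & Hw & Hn). apply is_omega_iff in Hw. now subst.
  - intros Hn. exists omega. now rewrite is_omega_iff.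
Qed.

Lemma zero_omega : empty ∈ omega.
Proof.
  destruct omega_is_omega as [[(z & Hz & Hzw) _] _]. apply is_empty_iff in Hz. now subst.
Qed.

Lemma succ_omega (n : M) : n ∈ omega -> succ n ∈ omega.
Proof.
  intros Hn. destruct omega_is_omega as [[_ H] _].
  destruct (H n Hn) as (s & Hs & Hsw). apply is_succ_iff in Hs. now subst.
Qed.

Lemma omega_ind (P : M -> Prop) : definable (fun e => P (e 0)) ->
  P empty -> (forall n, n ∈ omega -> P n -> P (succ n)) -> forall n, n ∈ omega -> P n.
Proof.
  intros HP H0 HS.
  assert (K : forall n, n ∈ sep omega P <-> n ∈ omega /\ P n) by now apply in_sep.
  intros n Hn. apply K. revert n Hn. destruct omega_is_omega as [_ H]. apply (H (sep omega P)).
  split.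
  - exists empty. rewrite is_empty_iff, K. auto using zero_omega.
  - intros n Hn. apply K in Hn as [Hn Hp]. exists (succ n). rewrite is_succ_iff, K.
    auto using succ_omega.
Qed.

End Sets.

Ltac nat_induct H :=
  match type of H with mem ?n _ => pattern n; revert n H; apply omega_ind end.

Section Nat.
Context {M : eps_structure} {zf : ZF M}.

Lemma omega_trans (n m : M) : n ∈ omega -> m ∈ n -> m ∈ omega.
Proof.
  intros Hn. revert m. nat_induct Hn; [dfn| |].
  - intros m Hm. now apply in_empty in Hm.
  - intros n Hn IH m Hm. apply in_succ in Hm as [Hm| ->]; auto.
Qed.

Lemma nat_trans (k m n : M) : n ∈ omega -> k ∈ m -> m ∈ n -> k ∈ n.
Proof.
  intros Hn. revert k m. pattern n. revert n Hn.
  apply omega_ind; [dfn| |].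
  - intros k m _ Hm. now apply in_empty in Hm.
  - intros n Hn IH k m Hk Hm. rewrite in_succ in *. destruct Hm as [Hm| ->]; eauto.
Qed.

Lemma nat_irrefl (n : M) : n ∈ omega -> ~ n ∈ n.
Proof.
  intros Hn. nat_induct Hn; [dfn|apply in_empty|].
  intros n Hn IH H. apply in_succ in H as [H|H].
  - apply IH. eapply nat_trans; [exact Hn| |exact H]. apply in_succ. auto.
  - apply IH. rewrite <- H at 2. apply in_succ. auto.
Qed.

Lemma nat_asym (m n : M) : n ∈ omega -> m ∈ n -> ~ n ∈ m.
Proof.
  intros Hn H K. apply (nat_irrefl Hn). eapply nat_trans; eauto.
Qed.

Lemma empty_in_succ (n : M) : n ∈ omega -> empty ∈ succ n.
Proof.
  intros Hn. nat_induct Hn; [dfn| |].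
  - apply in_succ. auto.
  - intros n Hn IH. apply in_succ. auto.
Qed.

Lemma succ_in_succ (m n : M) : n ∈ omega -> m ∈ n -> succ m ∈ succ n.
Proof.
  intros Hn. revert m. nat_induct Hn; [dfn| |].
  - intros m Hm. now apply in_empty in Hm.
  - intros n Hn IH m Hm. apply in_succ in Hm as [Hm| ->]; apply in_succ; auto.
Qed.

Lemma nat_total (m n : M) : m ∈ omega -> n ∈ omega -> m ∈ n \/ m = n \/ n ∈ m.
Proof.
  intros Hm. revert n. nat_induct Hm; [dfn| |].
  - intros n Hn. nat_induct Hn; [dfn|auto|].
    intros n Hn _. left. now apply empty_in_succ.
  - intros m Hm IH n Hn. destruct (IH n Hn) as [H|[->|H]].
    + apply (succ_in_succ Hn) in H. apply in_succ in H. intuition congruence.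
    + right; right. apply in_succ. auto.
    + right; right. apply in_succ. auto.
Qed.

Lemma succ_inj (m n : M) : m ∈ omega -> n ∈ omega -> succ m = succ n -> m = n.
Proof.
  intros Hm Hn E. assert (H : m ∈ succ n) by (rewrite <- E; apply in_succ; auto).
  assert (K : n ∈ succ m) by (rewrite E; apply in_succ; auto).
  apply in_succ in H as [H|H]; [|exact H]. apply in_succ in K as [K|K]; [|auto].
  exfalso. exact (nat_asym Hn H K).
Qed.

Lemma succ_neq_empty (n : M) : succ n <> empty.
Proof. intros E. apply (@in_empty _ _ n). rewrite <- E. apply in_succ. auto. Qed.

Lemma nat_cases (n : M) : n ∈ omega -> n = empty \/ exists m, m ∈ omega /\ n = succ m.
Proof.
  intros Hn. nat_induct Hn; [dfn|auto|eauto].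
Qed.

End Nat.

(** * Functions given by definable relations, injections and bijections *)

Section Fin.
Context {M : eps_structure} {zf : ZF M}.

(** Unique choice: since values are unique, the graph can be separated from [prod X Y], and no
    choice principle is involved. *)
Lemma ex_fun (X Y : M) (R : M -> M -> Prop) : definable2 R ->
  (forall x, x ∈ X -> exists y, y ∈ Y /\ R x y) ->
  (forall x y y', x ∈ X -> R x y -> R x y' -> y = y') ->
  exists f, is_fun f X Y /\ forall x, x ∈ X -> R x (app f x).
Proof.
  intros HR H U.
  set (f := sep (prod X Y) (fun p => exists x y, p = pair x y /\ R x y)).
  assert (K : forall x y, rel f x y <-> x ∈ X /\ y ∈ Y /\ R x y).
  { intros x y. rewrite rel_iff. unfold f. rewrite in_sep by dfn. rewrite pair_in_prod.
    split.
    - intros [[Hx Hy] (x' & y' & E & Hr)]. apply pair_inj in E as [-> ->]. auto.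
    - intros (Hx & Hy & Hr). split; [auto|]. exists x, y. auto. }
  assert (Hf : is_fun f X Y).
  { split; [split|].
    - intros p Hp. apply in_sep in Hp; [|dfn]. destruct Hp as [Hp _].
      apply in_prod in Hp as (x & y & Hx & _ & ->). exists x, y. now rewrite is_opair_iff.
    - intros x Hx. destruct (H x Hx) as (y & Hy & Hr). exists y. split; [apply K; auto|].
      intros y' Hy'. apply K in Hy' as (_ & _ & Hr'). eauto.
    - intros x y Hy. now apply K in Hy. }
  exists f. split; [exact Hf|]. intros x Hx. apply (fun_app_rel Hf), K in Hx. tauto.
Qed.

Lemma fun_dom (f X X' Y Y' : M) : is_fun f X Y -> is_fun f X' Y' -> X = X'.
Proof.
  intros H K. apply set_ext. intros x. split; intros Hx.
  - apply (fun_app_rel H), (fun_rel _ _ K) in Hx. tauto.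
  - apply (fun_app_rel K), (fun_rel _ _ H) in Hx. tauto.
Qed.

Lemma injection_intro (f X Y : M) : is_fun f X Y ->
  (forall x x', x ∈ X -> x' ∈ X -> app f x = app f x' -> x = x') -> is_injection f X Y.
Proof.
  intros Hf Hi. split; [exact Hf|]. intros x x' y Hx Hx'.
  apply (fun_rel _ _ Hf) in Hx as [Hx ->]. apply (fun_rel _ _ Hf) in Hx' as [Hx' E]. auto.
Qed.

Lemma injection_app (f X Y x x' : M) : is_injection f X Y ->
  x ∈ X -> x' ∈ X -> app f x = app f x' -> x = x'.
Proof.
  intros [Hf Hi] Hx Hx' E. apply (Hi x x' (app f x)).
  - now apply (fun_app_rel Hf).
  - rewrite E. now apply (fun_app_rel Hf).
Qed.

Lemma bijection_intro (f X Y : M) : is_fun f X Y ->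
  (forall x x', x ∈ X -> x' ∈ X -> app f x = app f x' -> x = x') ->
  (forall y, y ∈ Y -> exists x, x ∈ X /\ app f x = y) -> is_bijection f X Y.
Proof.
  intros Hf Hi Hs. split; [now apply injection_intro|]. intros y Hy.
  destruct (Hs y Hy) as (x & Hx & <-). exists x. now apply (fun_app_rel Hf).
Qed.

Lemma bijection_surj (f X Y y : M) : is_bijection f X Y -> y ∈ Y -> exists x, x ∈ X /\ app f x = y.
Proof.
  intros [[Hf _] Hs] Hy. destruct (Hs y Hy) as (x & Hx). apply (fun_rel _ _ Hf) in Hx as [Hx ->].
  eauto.
Qed.

(** * Finite sets *)

Definition sing (x : M) : M := upair x x.
Definition add (F x : M) : M := cup F (sing x).
Lemma in_sing (x y : M) : y ∈ sing x <-> y = x.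
Proof. unfold sing. rewrite in_upair. tauto. Qed.

Lemma in_add (F x y : M) : y ∈ add F x <-> y ∈ F \/ y = x.
Proof. unfold add. now rewrite in_cup, in_sing. Qed.

Lemma add_mem (F x : M) : x ∈ F -> add F x = F.
Proof. intros H. apply set_ext. intros y. rewrite in_add. intuition congruence. Qed.

Lemma fin_nat (n : M) : n ∈ omega -> is_finite n.
Proof.
  intros Hn. destruct (@ex_fun n n (fun x y => y = x)) as (f & Hf & E); [dfn|eauto|congruence|].
  exists n, f. rewrite is_nat_iff. split; [exact Hn|]. apply bijection_intro; [exact Hf| |].
  - intros x x' Hx Hx'. rewrite !E; auto.
  - intros y Hy. exists y. auto.
Qed.

Lemma fin_empty : is_finite empty.
Proof. apply fin_nat, zero_omega. Qed.

Lemma fin_add (F x : M) : is_finite F -> is_finite (add F x).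
Proof.
  intros HF. destruct (classic (x ∈ F)) as [Hx|Hx]; [now rewrite add_mem|].
  destruct HF as (n & f & Hn & Hf). apply is_nat_iff in Hn. pose proof Hf as [[Hff _] _].
  destruct (@ex_fun (add F x) (succ n)
    (fun y v => (y ∈ F /\ v = app f y) \/ (y = x /\ v = n))) as (g & Hg & E).
  - dfn.
  - intros y Hy. apply in_add in Hy as [Hy| ->].
    + exists (app f y). rewrite in_succ. split; [left; eapply fun_app_in; eauto|auto].
    + exists n. rewrite in_succ. auto.
  - intros y v v' Hy. intuition congruence.
  - exists (succ n), g. rewrite is_nat_iff. split; [now apply succ_omega|].
    assert (L : forall y, y ∈ F -> app g y = app f y /\ app f y ∈ n).
    { intros y Hy. split; [|eapply fun_app_in; eauto].
      destruct (E y) as [[_ K]|[-> _]]; [apply in_add; auto|exact K|tauto]. }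
    assert (L' : app g x = n).
    { destruct (E x) as [[K _]|[_ K]]; [apply in_add; auto|tauto|exact K]. }
    apply bijection_intro; [exact Hg| |].
    + intros y y' Hy Hy'. rewrite in_add in *.
      destruct Hy as [Hy| ->], Hy' as [Hy'| ->]; rewrite ?L'; auto.
      * destruct (L y Hy) as [-> _], (L y' Hy') as [-> _]. now apply (injection_app (proj1 Hf)).
      * destruct (L y Hy) as [-> K]. intros K'. rewrite K' in K. now apply nat_irrefl in K.
      * destruct (L y' Hy') as [-> K]. intros K'. rewrite <- K' in K. now apply nat_irrefl in K.
    + intros y Hy. apply in_succ in Hy as [Hy| ->].
      * destruct (bijection_surj Hf Hy) as (z & Hz & Ez). exists z. rewrite in_add.
        destruct (L z Hz) as [-> _]. auto.
      * exists x. rewrite in_add. auto.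
Qed.

Lemma fin_ind (P : M -> Prop) : definable (fun e => P (e 0)) -> P empty ->
  (forall F x, is_finite F -> P F -> P (add F x)) -> forall F, is_finite F -> P F.
Proof.
  intros HP H0 HS. assert (HP1 : definable1 P) by now apply definable1_intro.
  cut (forall n, n ∈ omega -> forall F f, is_bijection f F n -> P F).
  { intros K F (n & f & Hn & Hf). apply is_nat_iff in Hn. eauto. }
  intros n Hn. nat_induct Hn; [dfn| |].
  - intros F f Hf. replace F with empty; [exact H0|]. apply set_ext. intros x. split; intros Hx.
    + now apply in_empty in Hx.
    + exfalso. destruct Hf as [[Hf _] _]. apply (@in_empty _ _ (app f x)). eapply fun_app_in; eauto.
  (* The preimage [x] of the largest value n is removed; all other values lie below n, so the rest
     is in bijection with n. *)
  - intros n Hn IH F f Hf. destruct (@bijection_surj f F (succ n) n Hf) as (x & Hx & Ex);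
      [apply in_succ; auto|].
    set (F' := sep F (fun y => y <> x)).
    assert (HF' : forall y, y ∈ F' <-> y ∈ F /\ y <> x)
      by (intros y; unfold F'; rewrite in_sep by dfn; reflexivity).
    assert (EF : F = add F' x).
    { apply set_ext. intros y. rewrite in_add, HF'. destruct (classic (y = x)); intuition congruence. }
    pose proof Hf as [[Hff _] _].
    assert (K : exists g, is_bijection g F' n).
    { destruct (@ex_fun F' n (fun y v => v = app f y)) as (g & Hg & E); [dfn| |congruence|].
      - intros y Hy. apply HF' in Hy as [Hy Hyx]. exists (app f y). split; [|reflexivity].
        pose proof (fun_app_in Hff Hy) as K. apply in_succ in K as [K|K]; [exact K|].
        exfalso. apply Hyx. apply (injection_app (proj1 Hf)); auto. congruence.
      - exists g. apply bijection_intro; [exact Hg| |].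
        + intros y y' Hy Hy'. rewrite !E by assumption. apply HF' in Hy, Hy'.
          apply (injection_app (proj1 Hf)); tauto.
        + intros v Hv. destruct (@bijection_surj f F (succ n) v Hf) as (y & Hy & Ey);
            [apply in_succ; auto|].
          assert (Hy' : y ∈ F').
          { apply HF'. split; [exact Hy|]. intros ->. rewrite Ex in Ey. subst v.
            now apply nat_irrefl in Hv. }
          exists y. rewrite E by exact Hy'. auto. }
    destruct K as [g Hg]. rewrite EF. apply HS; [|eauto].
    exists n, g. now rewrite is_nat_iff.
Qed.

End Fin.

Ltac fin_induct H :=
  match type of H with is_finite ?F => pattern F; revert F H; apply fin_ind end.

Section Fin2.
Context {M : eps_structure} {zf : ZF M}.

Lemma fin_sub (F G : M) : is_finite F -> sub G F -> is_finite G.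
Proof.
  intros HF. revert G. fin_induct HF; [dfn| |].
  - intros G HG. replace G with empty; [apply fin_empty|]. apply set_ext. intros x. split; [|apply HG].
    intros Hx. now apply in_empty in Hx.
  - intros F x _ IH G HG.
    set (G' := sep G (fun y => y <> x)).
    assert (HG' : forall y, y ∈ G' <-> y ∈ G /\ y <> x)
      by (intros y; unfold G'; rewrite in_sep by dfn; reflexivity).
    assert (K : is_finite G').
    { apply IH. intros y Hy. apply HG' in Hy as [Hy Hyx]. apply HG, in_add in Hy. tauto. }
    destruct (classic (x ∈ G)) as [Hx|Hx].
    + replace G with (add G' x); [now apply fin_add|]. apply set_ext. intros y.
      rewrite in_add, HG'. destruct (classic (y = x)); intuition congruence.
    + replace G with G'; [exact K|]. apply set_ext. intros y. rewrite HG'. intuition congruence.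
Qed.

Lemma fin_cup (F G : M) : is_finite F -> is_finite G -> is_finite (cup F G).
Proof.
  intros HF HG. fin_induct HF; [dfn| |].
  - replace (cup empty G) with G; [exact HG|]. apply set_ext. intros x. rewrite in_cup.
    split; [auto|]. intros [H|H]; [now apply in_empty in H|exact H].
  - intros F x _ IH. replace (cup (add F x) G) with (add (cup F G) x); [now apply fin_add|].
    apply set_ext. intros y. rewrite in_add, !in_cup, in_add. tauto.
Qed.

Lemma fin_image (R : M -> M -> Prop) (F G : M) : definable2 R ->
  (forall x y y', x ∈ F -> R x y -> R x y' -> y = y') -> is_finite F ->
  (forall y, y ∈ G -> exists x, x ∈ F /\ R x y) -> is_finite G.
Proof.
  intros HR U HF HG. revert G U HG. fin_induct HF; [dfn| |].
  - intros G _ HG. apply (fin_sub fin_empty). intros y Hy. destruct (HG y Hy) as (x & Hx & _).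
    now apply in_empty in Hx.
  - intros F x _ IH G U HG.
    set (G' := sep G (fun y => exists x, x ∈ F /\ R x y)).
    assert (HG' : forall y, y ∈ G' <-> y ∈ G /\ exists x, x ∈ F /\ R x y)
      by (intros y; unfold G'; rewrite in_sep by dfn; reflexivity).
    assert (K : is_finite G').
    { apply IH.
      - intros x' y y' Hx'. apply U. apply in_add. auto.
      - intros y Hy. now apply HG' in Hy. }
    destruct (classic (exists y, y ∈ G /\ R x y)) as [(y0 & Hy0 & Hr0)|N].
    + apply (fin_sub (fin_add y0 K)). intros y Hy. apply in_add.
      destruct (HG y Hy) as (x' & Hx' & Hr). apply in_add in Hx' as [Hx'| ->].
      * left. apply HG'. eauto.
      * right. apply (U x); auto. apply in_add. auto.
    + apply (fin_sub K). intros y Hy. destruct (HG y Hy) as (x' & Hx' & Hr).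
      apply in_add in Hx' as [Hx'| ->]; [apply HG'; eauto|]. exfalso. eauto.
Qed.

Lemma fin_bounded (F : M) : is_finite F -> sub F omega -> exists m, m ∈ omega /\ sub F m.
Proof.
  intros HF. fin_induct HF; [dfn| |].
  - intros _. exists empty. split; [apply zero_omega|]. intros x Hx. exact Hx.
  - intros F x _ IH HF. destruct IH as (m & Hm & HFm).
    { intros y Hy. apply HF, in_add. auto. }
    assert (Hx : x ∈ omega) by (apply HF, in_add; auto).
    destruct (nat_total Hm Hx) as [H|[<-|H]].
    + exists (succ x). split; [now apply succ_omega|]. intros y Hy. apply in_add in Hy as [Hy| ->].
      * apply in_succ. left. exact (nat_trans Hx (HFm y Hy) H).
      * apply in_succ. auto.
    + exists (succ m). split; [now apply succ_omega|]. intros y Hy. apply in_succ.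
      apply in_add in Hy as [Hy| ->]; auto.
    + exists m. split; [exact Hm|]. intros y Hy. apply in_add in Hy as [Hy| ->]; auto.
Qed.
End Fin2.

(** * Consequences of dependent choice *)

Section Choice.
Context {M : eps_structure} {zf : ZF M}.
Hypothesis dc : DC M.

(** [DC] prescribes no first term, and its relation cannot see the index. It is therefore applied to
    finite approximations of the sequence, which start at [x0] and whose length remembers the stage,
    under extension by one term. *)
Lemma dc_sequence (X x0 : M) (Q : M -> M -> M -> Prop) : definable3 Q -> x0 ∈ X ->
  (forall k x, k ∈ omega -> x ∈ X -> exists y, y ∈ X /\ Q k x y) ->
  exists z, is_fun z omega X /\ app z empty = x0 /\
    forall k, k ∈ omega -> Q k (app z k) (app z (succ k)).
Proof.
  intros HQ Hx0 Hstep.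
  pose (good := fun p n => n ∈ omega /\ is_fun p (succ n) X /\ app p empty = x0 /\
    forall k, k ∈ n -> Q k (app p k) (app p (succ k))).
  pose (P := sep (power (prod omega X)) (fun p => exists n, good p n)).
  assert (HP : forall p, p ∈ P <-> exists n, good p n).
  { intros p. unfold P, good. rewrite in_sep by dfn. split; [tauto|]. intros H. split; [|exact H].
    destruct H as (n & Hn & Hp & _). apply in_power. intros t Ht.
    apply (in_fun _ Hp) in Ht as (x & Hx & ->). apply pair_in_prod. split.
    - eapply omega_trans; [|exact Hx]. now apply succ_omega.
    - eapply fun_app_in; eauto. }
  pose (ext := fun p q => exists n, good p n /\ good q (succ n) /\
    forall k, k ∈ succ n -> app q k = app p k).
  pose (R := sep (prod P P) (fun t => exists p q, t = pair p q /\ ext p q)).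
  assert (HR : forall p q, rel R p q <-> p ∈ P /\ q ∈ P /\ ext p q).
  { intros p q. rewrite rel_iff. unfold R. rewrite in_sep by (unfold ext, good; dfn).
    rewrite pair_in_prod. split.
    - intros [[Hp Hq] (p' & q' & E & H)]. apply pair_inj in E as [-> ->]. auto.
    - intros (Hp & Hq & H). split; [auto|]. exists p, q. auto. }
  destruct (dc (X := P) (R := R)) as (w & s & Hw & Hs & Hss).
  - destruct (@ex_fun _ _ (succ empty) X (fun k y => y = x0)) as (p & Hp & E);
      [dfn|eauto|congruence|].
    exists p. apply HP. exists empty. split; [apply zero_omega|]. split; [exact Hp|]. split.
    + apply E, in_succ. auto.
    + intros k Hk. now apply in_empty in Hk.
  - intros p Hp. pose proof Hp as Hp'. apply HP in Hp' as (n & Hg).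
    pose proof Hg as (Hn & Hpf & Hp0 & Hps).
    destruct (Hstep n (app p n) Hn) as (y & Hy & Hq);
      [eapply fun_app_in; eauto; apply in_succ; auto|].
    destruct (@ex_fun _ _ (succ (succ n)) X
      (fun k v => (k ∈ succ n /\ v = app p k) \/ (k = succ n /\ v = y))) as (q & Hqf & E).
    + dfn.
    + intros k Hk. apply in_succ in Hk as [Hk| ->]; [|eauto].
      exists (app p k). split; [eapply fun_app_in; eauto|auto].
    + assert (HI : ~ succ n ∈ succ n) by now apply nat_irrefl, succ_omega.
      intros k v v' Hk. intuition congruence.
    + assert (HI : ~ succ n ∈ succ n) by now apply nat_irrefl, succ_omega.
      assert (E1 : forall k, k ∈ succ n -> app q k = app p k).
      { intros k Hk. destruct (E k) as [[_ K]|[-> _]]; [apply in_succ; auto|exact K|tauto]. }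
      assert (E2 : app q (succ n) = y).
      { destruct (E (succ n)) as [[K _]|[_ K]]; [apply in_succ; auto|tauto|exact K]. }
      assert (Hgq : good q (succ n)).
      { split; [now apply succ_omega|]. split; [exact Hqf|]. split.
        - rewrite E1; [exact Hp0|now apply empty_in_succ].
        - intros k Hk. rewrite (E1 k Hk). apply in_succ in Hk as [Hk| ->].
          + rewrite E1; [auto|]. now apply succ_in_succ.
          + now rewrite E2. }
      exists q. assert (HqP : q ∈ P) by (apply HP; eauto). split; [exact HqP|].
      apply HR. split; [exact Hp|]. split; [exact HqP|]. exists n. auto.
  - apply is_omega_iff in Hw. subst w.
    assert (Hsk : forall k, k ∈ omega -> ext (app s k) (app s (succ k))).
    { intros k Hk. apply HR. apply (Hss k (succ k)); [exact Hk|now apply is_succ_iff| |];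
        apply (fun_app_rel Hs); [|apply succ_omega]; exact Hk. }
    assert (Hin : forall p n, good p n -> forall k, k ∈ succ n -> app p k ∈ X).
    { intros p n (_ & Hp & _) k Hk. eapply fun_app_in; eauto. }
    assert (Huniq : forall p n n', good p n -> good p n' -> n = n').
    { intros p n n' (Hn & Hp & _) (Hn' & Hp' & _). apply succ_inj; auto.
      eapply fun_dom; eauto. }
    (* The chain may start at an approximation of any length, so the length of [app s k] is only
       bounded from below; that is enough to read off the diagonal [app (app s k) k]. *)
    assert (HL : forall k, k ∈ omega -> exists n, good (app s k) n /\ k ∈ succ n).
    { intros k Hk. nat_induct Hk; [unfold good; dfn| |].
      - pose proof (fun_app_in Hs zero_omega) as K. apply HP in K as (n & Hn).
        exists n. split; [exact Hn|]. apply empty_in_succ, Hn.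
      - intros k Hk (n & Hn & Hkn). destruct (Hsk k Hk) as (n' & Hn' & Hn2 & _).
        rewrite <- (Huniq _ _ _ Hn Hn') in Hn2. exists (succ n). split; [exact Hn2|].
        apply succ_in_succ; [|exact Hkn]. apply succ_omega, Hn. }
    destruct (@ex_fun _ _ omega X (fun k y => y = app (app s k) k)) as (z & Hz & E);
      [dfn| |congruence|].
    { intros k Hk. destruct (HL k Hk) as (n & Hn & Hkn). eauto. }
    exists z. split; [exact Hz|]. split.
    + rewrite E by apply zero_omega. pose proof (fun_app_in Hs zero_omega) as K.
      apply HP in K as (n & _ & _ & K & _). exact K.
    + intros k Hk. rewrite !E by auto using succ_omega.
      destruct (HL k Hk) as (n & Hn & Hkn). destruct (Hsk k Hk) as (n' & Hn' & Hn2 & Hag).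
      rewrite <- (Huniq _ _ _ Hn Hn') in *. rewrite <- (Hag k Hkn). apply Hn2. exact Hkn.
Qed.

(** Countable choice is a recursion that ignores the current term; the shift by one drops the
    arbitrary starting value [y0]. *)
Lemma ac_omega (X : M) (Q : M -> M -> Prop) : definable2 Q ->
  (forall k, k ∈ omega -> exists y, y ∈ X /\ Q k y) ->
  exists g, is_fun g omega X /\ forall k, k ∈ omega -> Q k (app g k).
Proof.
  intros HQ H. destruct (H empty zero_omega) as (y0 & Hy0 & _).
  destruct (@dc_sequence X y0 (fun k _ y => Q k y)) as (z & Hz & _ & Hzs); [dfn|exact Hy0|auto|].
  destruct (@ex_fun _ _ omega X (fun k y => y = app z (succ k))) as (g & Hg & E);
    [dfn| |congruence|].
  - intros k Hk. exists (app z (succ k)). split; [|reflexivity].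
    eapply fun_app_in; eauto. now apply succ_omega.
  - exists g. split; [exact Hg|]. intros k Hk. rewrite E by exact Hk. auto.
Qed.

(** * Arithmetic *)

Definition doubling (d : M) : Prop :=
  is_fun d omega omega /\ app d empty = empty /\
  forall k, k ∈ omega -> app d (succ k) = succ (succ (app d k)).

Lemma ex_doubling : exists d, doubling d.
Proof.
  destruct (@dc_sequence omega empty (fun k x y => y = succ (succ x))) as (d & Hd);
    [dfn|apply zero_omega| |].
  - intros k x _ Hx. exists (succ (succ x)). auto using succ_omega.
  - exists d. exact Hd.
Qed.
End Choice.

Section Doubling.
Context {M : eps_structure} {zf : ZF M}.
Variable d : M.
Hypothesis Hd : doubling d.

Lemma dbl_omega (k : M) : k ∈ omega -> app d k ∈ omega.
Proof. apply fun_app_in. apply Hd. Qed.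

(** The successor makes this strong enough to yield parity, and to place an odd coordinate 2i + 1
    inside the block that contains 2i. *)
Lemma dbl_mono (j i : M) : j ∈ omega -> i ∈ j -> succ (app d i) ∈ app d j.
Proof.
  intros Hj. revert i. nat_induct Hj; [dfn| |].
  - intros i Hi. now apply in_empty in Hi.
  - intros j Hj IH i Hi. destruct Hd as (_ & _ & ->); [|exact Hj].
    rewrite !in_succ. apply in_succ in Hi as [Hi| ->]; auto.
Qed.

Lemma dbl_mono' (j i : M) : j ∈ omega -> i ∈ j -> app d i ∈ app d j.
Proof.
  intros Hj Hi. apply (@nat_trans _ _ _ (succ (app d i))); [now apply dbl_omega| |now apply dbl_mono].
  apply in_succ. auto.
Qed.

Lemma dbl_lt_inv (i j : M) : i ∈ omega -> j ∈ omega -> app d i ∈ app d j -> i ∈ j.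
Proof.
  intros Hi Hj H. destruct (nat_total Hi Hj) as [K|[->|K]]; [exact K| |].
  - exfalso. exact (nat_irrefl (dbl_omega Hj) H).
  - exfalso. apply (nat_asym (dbl_omega Hj) H). now apply dbl_mono'.
Qed.

Lemma dbl_inj (i j : M) : i ∈ omega -> j ∈ omega -> app d i = app d j -> i = j.
Proof.
  intros Hi Hj E. destruct (nat_total Hi Hj) as [K|[->|K]]; [|reflexivity|].
  - exfalso. apply dbl_mono' in K; [|exact Hj]. rewrite E in K. exact (nat_irrefl (dbl_omega Hj) K).
  - exfalso. apply dbl_mono' in K; [|exact Hi]. rewrite E in K. exact (nat_irrefl (dbl_omega Hj) K).
Qed.

Lemma dbl_parity (i j : M) : i ∈ omega -> j ∈ omega -> app d i <> succ (app d j).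
Proof.
  intros Hi Hj E. destruct (nat_total Hi Hj) as [K|[->|K]].
  - apply dbl_mono in K; [|exact Hj]. rewrite E in K.
    apply (nat_asym (dbl_omega Hj) K). rewrite !in_succ. auto.
  - apply (nat_irrefl (dbl_omega Hj)). rewrite E at 2. apply in_succ. auto.
  - apply dbl_mono in K; [|exact Hi]. rewrite E in K.
    exact (nat_irrefl (succ_omega (dbl_omega Hj)) K).
Qed.

Lemma dbl_cases (l : M) : l ∈ omega -> exists i, i ∈ omega /\ (l = app d i \/ l = succ (app d i)).
Proof.
  intros Hl. nat_induct Hl; [dfn| |].
  - exists empty. split; [apply zero_omega|]. left. symmetry. apply Hd.
  - intros l Hl (i & Hi & [->| ->]); [eauto|].
    exists (succ i). split; [now apply succ_omega|]. left. destruct Hd as (_ & _ & ->); auto.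
Qed.

Lemma dbl_ge (i : M) : i ∈ omega -> i ∈ succ (app d i).
Proof.
  intros Hi. nat_induct Hi; [dfn| |].
  - apply empty_in_succ, dbl_omega, zero_omega.
  - intros i Hi IH. destruct Hd as (_ & _ & ->); [|exact Hi].
    apply succ_in_succ; [auto using succ_omega, dbl_omega|].
    rewrite in_succ. auto.
Qed.
End Doubling.

Section Arith.
Context {M : eps_structure} {zf : ZF M}.
Hypothesis dc : DC M.

(* (m, n) is coded by 2^m (2n + 1). *)
Lemma ex_pairing : exists J, is_fun J (prod omega omega) omega /\
  forall m n m' n', m ∈ omega -> n ∈ omega -> m' ∈ omega -> n' ∈ omega ->
    app J (pair m n) = app J (pair m' n') -> m = m' /\ n = n'.
Proof.
  destruct (ex_doubling dc) as [d Hd].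
  destruct (@ex_fun _ _ omega omega (fun n v => v = succ (app d n))) as (f0 & Hf0 & E0);
    [dfn| |congruence|].
  { intros n Hn. exists (succ (app d n)). auto using succ_omega, dbl_omega. }
  destruct (@dc_sequence _ _ dc (funs omega omega) f0
    (fun k f g => forall n, n ∈ omega -> app g n = app d (app f n))) as (z & Hz & Hz0 & Hzs).
  - dfn.
  - now apply in_funs.
  - intros k f _ Hf. apply in_funs in Hf.
    destruct (@ex_fun _ _ omega omega (fun n v => v = app d (app f n))) as (g & Hg & E);
      [dfn| |congruence|].
    + intros n Hn. exists (app d (app f n)). split; [|reflexivity]. apply dbl_omega; [exact Hd|].
      eapply fun_app_in; eauto.
    + exists g. split; [now apply in_funs|exact E].
  - pose (c := fun m n => app (app z m) n).
    assert (Hc : forall m n, m ∈ omega -> n ∈ omega -> c m n ∈ omega).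
    { intros m n Hm Hn. apply (@fun_app_in _ _ _ omega); [|exact Hn].
      apply in_funs. now apply (fun_app_in Hz). }
    assert (C0 : forall n, n ∈ omega -> c empty n = succ (app d n)).
    { intros n Hn. unfold c. rewrite Hz0. now apply E0. }
    assert (CS : forall m n, m ∈ omega -> n ∈ omega -> c (succ m) n = app d (c m n)).
    { intros m n Hm Hn. now apply Hzs. }
    (* Odd values belong to row 0; from an even value one factor 2 is removed and the row number
       drops by one. *)
    assert (CI : forall m, m ∈ omega -> forall n m' n', n ∈ omega -> m' ∈ omega -> n' ∈ omega ->
      c m n = c m' n' -> m = m' /\ n = n').
    { intros m Hm. nat_induct Hm; [unfold c; dfn| |].
      - intros n m' n' Hn Hm' Hn'. destruct (nat_cases Hm') as [->|(k & Hk & ->)].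
        + rewrite !C0 by assumption. intros E. split; [reflexivity|].
          apply (dbl_inj Hd Hn Hn'). apply succ_inj; auto using dbl_omega.
        + rewrite C0, CS by assumption. intros E. symmetry in E.
          apply dbl_parity in E; auto. contradiction.
      - intros m Hm IH n m' n' Hn Hm' Hn'. destruct (nat_cases Hm') as [->|(k & Hk & ->)].
        + rewrite C0, CS by assumption. intros E.
          apply dbl_parity in E; auto. contradiction.
        + rewrite !CS by assumption. intros E. apply (dbl_inj Hd) in E; auto.
          destruct (IH n k n' Hn Hk Hn' E) as [-> ->]. auto. }
    destruct (@ex_fun _ _ (prod omega omega) omega
      (fun p v => exists m n, p = pair m n /\ v = app (app z m) n)) as (J & HJ & E).
    + dfn.
    + intros p Hp. apply in_prod in Hp as (m & n & Hm & Hn & ->).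
      exists (c m n). split; [auto|]. exists m, n. auto.
    + intros p v v' _ (m & n & -> & ->) (m' & n' & Ep & ->).
      apply pair_inj in Ep as [-> ->]. reflexivity.
    + exists J. split; [exact HJ|].
      assert (EJ : forall m n, m ∈ omega -> n ∈ omega -> app J (pair m n) = c m n).
      { intros m n Hm Hn. destruct (E (pair m n)) as (m' & n' & Ep & ->); [now apply pair_in_prod|].
        apply pair_inj in Ep as [-> ->]. reflexivity. }
      intros m n m' n' Hm Hn Hm' Hn'. rewrite !EJ by assumption. now apply CI.
Qed.

(** The injective coding is inverted. Numbers that code no pair receive the value 0, which does no
    harm since only surjectivity onto omega x omega is claimed. *)
Lemma ex_unpairing : exists a b, is_fun a omega omega /\ is_fun b omega omega /\
  forall i j, i ∈ omega -> j ∈ omega -> exists k, k ∈ omega /\ app a k = i /\ app b k = j.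
Proof.
  destruct ex_pairing as (J & HJ & IJ).
  pose (dec := fun k p => p ∈ prod omega omega /\ app J p = k).
  assert (U : forall k p p', dec k p -> dec k p' -> p = p').
  { intros k p p' [Hp E] [Hp' E']. apply in_prod in Hp as (m & n & Hm & Hn & ->).
    apply in_prod in Hp' as (m' & n' & Hm' & Hn' & ->). apply pair_inj, IJ; auto. congruence. }
  destruct (@ex_fun _ _ omega omega (fun k i =>
    (exists j, dec k (pair i j)) \/ ((~ exists p, dec k p) /\ i = empty))) as (a & Ha & Ea).
  { unfold dec. dfn. }
  { intros k Hk. destruct (classic (exists p, dec k p)) as [(p & Hp)|N].
    - pose proof Hp as [Hp' _]. apply in_prod in Hp' as (i & j & Hi & Hj & ->). eauto.
    - exists empty. auto using zero_omega. }
  { intros k i i' _ [(j & H)|[N ->]] [(j' & H')|[N' ->]].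
    - now apply (U _ _ _ H), pair_inj in H' as [-> _].
    - exfalso. eauto.
    - exfalso. eauto.
    - reflexivity. }
  destruct (@ex_fun _ _ omega omega (fun k j =>
    (exists i, dec k (pair i j)) \/ ((~ exists p, dec k p) /\ j = empty))) as (b & Hb & Eb).
  { unfold dec. dfn. }
  { intros k Hk. destruct (classic (exists p, dec k p)) as [(p & Hp)|N].
    - pose proof Hp as [Hp' _]. apply in_prod in Hp' as (i & j & Hi & Hj & ->). eauto.
    - exists empty. auto using zero_omega. }
  { intros k i i' _ [(j & H)|[N ->]] [(j' & H')|[N' ->]].
    - now apply (U _ _ _ H), pair_inj in H' as [_ ->].
    - exfalso. eauto.
    - exfalso. eauto.
    - reflexivity. }
  exists a, b. split; [exact Ha|]. split; [exact Hb|]. intros i j Hi Hj.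
  assert (Hp : pair i j ∈ prod omega omega) by now apply pair_in_prod.
  pose proof (fun_app_in HJ Hp) as Hk. exists (app J (pair i j)). split; [exact Hk|].
  assert (Hd : dec (app J (pair i j)) (pair i j)) by (split; [exact Hp|reflexivity]).
  split.
  - destruct (Ea _ Hk) as [(j' & H)|[N _]]; [|exfalso; eauto].
    apply (U _ _ _ Hd), pair_inj in H as [H _]. now symmetry.
  - destruct (Eb _ Hk) as [(i' & H)|[N _]]; [|exfalso; eauto].
    apply (U _ _ _ Hd), pair_inj in H as [_ H]. now symmetry.
Qed.

(* [app (app s n) m] is m + n. *)
Definition addition (s : M) : Prop :=
  is_fun s omega (funs omega omega) /\
  (forall m, m ∈ omega -> app (app s empty) m = m) /\
  (forall m n, m ∈ omega -> n ∈ omega -> app (app s (succ n)) m = succ (app (app s n) m)).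

Lemma ex_addition : exists s, addition s.
Proof.
  destruct (@ex_fun _ _ omega omega (fun n v => v = n)) as (f0 & Hf0 & E0);
    [dfn|eauto|congruence|].
  destruct (@dc_sequence _ _ dc (funs omega omega) f0
    (fun k f g => forall n, n ∈ omega -> app g n = succ (app f n))) as (s & Hs & Hs0 & Hss).
  - dfn.
  - now apply in_funs.
  - intros k f _ Hf. apply in_funs in Hf.
    destruct (@ex_fun _ _ omega omega (fun n v => v = succ (app f n))) as (g & Hg & E);
      [dfn| |congruence|].
    + intros n Hn. exists (succ (app f n)). split; [|reflexivity]. apply succ_omega.
      eapply fun_app_in; eauto.
    + exists g. split; [now apply in_funs|exact E].
  - exists s. split; [exact Hs|]. split.
    + intros m Hm. rewrite Hs0. now apply E0.
    + intros m n Hm Hn. now apply Hss.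
Qed.

Section Addition.
Variable s : M.
Hypothesis Hs : addition s.

Lemma plus_omega (m n : M) : m ∈ omega -> n ∈ omega -> app (app s n) m ∈ omega.
Proof.
  intros Hm Hn. apply (@fun_app_in _ _ _ omega); [|exact Hm]. apply in_funs.
  destruct Hs as [K _]. now apply (fun_app_in K).
Qed.

Lemma plus_0 (m : M) : m ∈ omega -> app (app s empty) m = m.
Proof. apply Hs. Qed.

Lemma plus_0_l (n : M) : n ∈ omega -> app (app s n) empty = n.
Proof.
  intros Hn. destruct Hs as (K & H0 & HS). nat_induct Hn; [dfn| |].
  - apply H0, zero_omega.
  - intros n Hn IH. rewrite HS by auto using zero_omega. now rewrite IH.
Qed.

(** This is what moves one summand past the later ones in a partial sum. *)
Lemma plus_swap (a b c : M) : a ∈ omega -> b ∈ omega -> c ∈ omega ->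
  app (app s c) (app (app s b) a) = app (app s b) (app (app s c) a).
Proof.
  intros Ha Hb Hc. destruct Hs as (K & H0 & HS).
  assert (L : forall m n, m ∈ omega -> n ∈ omega -> app (app s n) (succ m) = succ (app (app s n) m)).
  { intros m n Hm Hn. nat_induct Hn; [dfn| |].
    - rewrite !H0; auto using succ_omega.
    - intros n Hn IH. rewrite !HS by auto using succ_omega. now rewrite IH. }
  nat_induct Hc; [dfn| |].
  - rewrite !H0; auto using plus_omega.
  - intros c Hc IH. rewrite !HS by auto using plus_omega. rewrite IH.
    symmetry. apply L; auto using plus_omega.
Qed.

(** Connects the iterated function [s] with the graphs [is_nat_add], in terms of which the integers
    are defined. *)
Lemma nat_add_plus (m n : M) : m ∈ omega -> n ∈ omega -> nat_add m n (app (app s n) m).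
Proof.
  intros Hm Hn. destruct Hs as (K & H0 & HS).
  pose (a := sep (prod (prod omega omega) omega)
    (fun t => exists m n, t = pair (pair m n) (app (app s n) m))).
  assert (Ha : forall t, t ∈ a <-> exists m n, m ∈ omega /\ n ∈ omega /\
    t = pair (pair m n) (app (app s n) m)).
  { intros t. unfold a. rewrite in_sep by dfn. split.
    - intros [Ht (x & y & ->)]. apply pair_in_prod in Ht as [Ht _].
      apply pair_in_prod in Ht as [Hx Hy]. eauto.
    - intros (x & y & Hx & Hy & ->). rewrite !pair_in_prod. split; [auto using plus_omega|].
      exists x, y. auto. }
  assert (Hr : forall x y v, rel2 a x y v <-> x ∈ omega /\ y ∈ omega /\ v = app (app s y) x).
  { intros x y v. split.
    - intros (p & Hp & Hr). apply is_opair_iff in Hp. subst p. apply rel_iff, Ha in Hr.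
      destruct Hr as (x' & y' & Hx & Hy & E). apply pair_inj in E as [E ->].
      apply pair_inj in E as [-> ->]. auto.
    - intros (Hx & Hy & ->). exists (pair x y). rewrite is_opair_iff, rel_iff, Ha.
      split; [reflexivity|]. exists x, y. auto. }
  exists omega, a. split; [apply omega_is_omega|]. split; [|now apply Hr].
  split; [split|split].
  - intros t Ht. apply Ha in Ht as (x & y & Hx & Hy & ->).
    exists x, y, (app (app s y) x), (pair x y). rewrite !is_opair_iff. auto using plus_omega.
  - intros x y Hx Hy. exists (app (app s y) x). split; [now apply Hr|].
    intros v Hv. now apply Hr in Hv as (_ & _ & ->).
  - intros x z Hx Hz. apply is_empty_iff in Hz. subst z. apply Hr. rewrite H0 by exact Hx.
    auto using zero_omega.
  - intros x k r sk sr Hsk Hsr. rewrite is_succ_iff in *. subst sk sr. rewrite !Hr.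
    intros (Hx & Hk & ->). rewrite HS by assumption. auto using succ_omega.
Qed.
End Addition.
End Arith.

(** * Cantor space *)

Section Cantor.
Context {M : eps_structure} {zf : ZF M}.

Definition one : M := succ empty.
Definition two : M := succ one.
Definition cantor : M := funs omega two.

Lemma in_two (v : M) : v ∈ two <-> v = empty \/ v = one.
Proof.
  unfold two, one. rewrite !in_succ. split; [|tauto].
  intros [[H|H]|H]; [now apply in_empty in H|auto|auto].
Qed.

Lemma one_neq_zero : one <> empty.
Proof. apply succ_neq_empty. Qed.

Lemma is_one_iff (o : M) : is_one o <-> o = one.
Proof.
  split.
  - intros (z & Hz & Ho). apply is_empty_iff in Hz. apply is_succ_iff in Ho. now subst.
  - intros ->. exists empty. now rewrite is_empty_iff, is_succ_iff.
Qed.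

Lemma is_two_iff (t : M) : is_two t <-> t = two.
Proof.
  split.
  - intros (o & Ho & Ht). apply is_one_iff in Ho. apply is_succ_iff in Ht. now subst.
  - intros ->. exists one. now rewrite is_one_iff, is_succ_iff.
Qed.

Lemma in_cantor (x : M) : x ∈ cantor <-> is_fun x omega two.
Proof. apply in_funs. Qed.

Lemma is_cantor_cantor : is_cantor cantor.
Proof.
  exists omega, two. rewrite is_omega_iff, is_two_iff. split; [reflexivity|].
  split; [reflexivity|apply in_cantor].
Qed.

Lemma cantor_val (x i : M) : x ∈ cantor -> i ∈ omega -> app x i = empty \/ app x i = one.
Proof. intros Hx Hi. apply in_two. apply in_cantor in Hx. now apply (fun_app_in Hx). Qed.

Lemma cantor_ext (x y : M) : x ∈ cantor -> y ∈ cantor ->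
  (forall i, i ∈ omega -> app x i = app y i) -> x = y.
Proof. intros Hx Hy H. apply in_cantor in Hx, Hy. exact (fun_ext Hx Hy H). Qed.

Lemma ex_cantor (R : M -> M -> Prop) : definable2 R ->
  (forall i, i ∈ omega -> exists v, v ∈ two /\ R i v) ->
  (forall i v v', i ∈ omega -> R i v -> R i v' -> v = v') ->
  exists x, x ∈ cantor /\ forall i, i ∈ omega -> R i (app x i).
Proof.
  intros HR H U. destruct (ex_fun HR H U) as (x & Hx & K). exists x.
  now rewrite in_cantor.
Qed.

Lemma ex_patch (P : M -> Prop) (x y : M) : definable1 P -> x ∈ cantor -> y ∈ cantor ->
  exists z, z ∈ cantor /\
    (forall i, i ∈ omega -> P i -> app z i = app x i) /\
    (forall i, i ∈ omega -> ~ P i -> app z i = app y i).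
Proof.
  intros HP Hx Hy. apply in_cantor in Hx, Hy.
  destruct (@ex_cantor (fun i v => (P i /\ v = app x i) \/ (~ P i /\ v = app y i)))
    as (z & Hz & E).
  - dfn.
  - intros i Hi. destruct (classic (P i)).
    + exists (app x i). split; [now apply (fun_app_in Hx)|auto].
    + exists (app y i). split; [now apply (fun_app_in Hy)|auto].
  - intros i v v' _. intuition congruence.
  - exists z. split; [exact Hz|]. split; intros i Hi HPi; destruct (E i Hi); tauto.
Qed.

Lemma ex_update (x l v : M) : x ∈ cantor -> l ∈ omega -> v ∈ two ->
  exists z, z ∈ cantor /\ app z l = v /\ forall i, i ∈ omega -> i <> l -> app z i = app x i.
Proof.
  intros Hx Hl Hv. apply in_cantor in Hx.
  destruct (@ex_cantor (fun i w => (i = l /\ w = v) \/ (i <> l /\ w = app x i)))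
    as (z & Hz & E).
  - dfn.
  - intros i Hi. destruct (classic (i = l)); [eauto|].
    exists (app x i). split; [now apply (fun_app_in Hx)|auto].
  - intros i w w' _. intuition congruence.
  - exists z. split; [exact Hz|]. split.
    + destruct (E l Hl); tauto.
    + intros i Hi Hil. destruct (E i Hi); tauto.
Qed.

Lemma nat_sub (m n : M) : n ∈ omega -> m ∈ succ n -> sub m n.
Proof.
  intros Hn Hm x Hx. apply in_succ in Hm as [Hm| ->]; [|exact Hx]. exact (nat_trans Hn Hx Hm).
Qed.

Lemma nat_max (m n : M) : m ∈ omega -> n ∈ omega -> exists k, k ∈ omega /\ sub m k /\ sub n k.
Proof.
  intros Hm Hn. destruct (nat_total Hm Hn) as [H|[->|H]].
  - exists n. split; [exact Hn|]. split; [|intros x; auto]. apply nat_sub; [exact Hn|].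
    apply in_succ. auto.
  - exists n. split; [exact Hn|]. split; intros x; auto.
  - exists m. split; [exact Hm|]. split; [intros x; auto|]. apply nat_sub; [exact Hm|].
    apply in_succ. auto.
Qed.

Lemma sub_omega (m : M) : m ∈ omega -> sub m omega.
Proof. intros Hm x Hx. exact (omega_trans Hm Hx). Qed.

Lemma box_open (x m : M) : x ∈ cantor -> m ∈ omega ->
  is_open cantor (sep cantor (fun y => forall i, i ∈ m -> app y i = app x i)).
Proof.
  intros Hx Hm. split.
  - intros y Hy. apply in_sep in Hy; [tauto|dfn].
  - intros y Hy. apply in_sep in Hy as [Hy E]; [|dfn].
    exists omega, m. split; [apply omega_is_omega|]. split; [now apply sub_omega|].
    split; [now apply fin_nat|]. intros y' Hy' K. apply in_sep; [dfn|]. split; [exact Hy'|].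
    intros i Hi. rewrite <- E by exact Hi. apply in_cantor in Hy, Hy'.
    apply (app_eq Hy'). apply K; [exact Hi|]. apply (fun_app_rel Hy). eapply omega_trans; eauto.
Qed.

(** The finitely many coordinates fixed by a basic box have a common bound m, so boxes over initial
    segments of omega form a base. *)
Lemma open_box (U x : M) : is_open cantor U -> x ∈ U ->
  exists m, m ∈ omega /\ forall y, y ∈ cantor -> (forall i, i ∈ m -> app y i = app x i) -> y ∈ U.
Proof.
  intros [HUC HU] Hx. destruct (HU x Hx) as (w & F & Hw & HF & Fin & K).
  apply is_omega_iff in Hw. subst w. destruct (fin_bounded Fin HF) as (m & Hm & HFm).
  exists m. split; [exact Hm|]. intros y Hy E. apply K; [exact Hy|].
  intros i b Hi Hr. pose proof (HUC x Hx) as HxC. apply in_cantor in HxC, Hy.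
  apply (fun_rel _ _ HxC) in Hr as [Hio ->]. rewrite <- E by auto. now apply (fun_app_rel Hy).
Qed.

(** The box of [u] below m is open and contains [u], so it has a point that is not adherent to [N];
    a smaller box around that point misses [N]. *)
Lemma nowhere_dense_avoid (N u m : M) : is_nowhere_dense cantor N -> u ∈ cantor -> m ∈ omega ->
  exists x m', x ∈ cantor /\ m' ∈ omega /\ sub m m' /\
    (forall i, i ∈ m -> app x i = app u i) /\
    forall y, y ∈ cantor -> (forall i, i ∈ m' -> app y i = app x i) -> ~ y ∈ N.
Proof.
  intros [HNC HN] Hu Hm.
  set (B := sep cantor (fun y => forall i, i ∈ m -> app y i = app u i)).
  assert (HB : forall y, y ∈ B <-> y ∈ cantor /\ forall i, i ∈ m -> app y i = app u i)
    by (intros y; unfold B; rewrite in_sep by dfn; reflexivity).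
  assert (K : exists x, x ∈ B /\ ~ adherent cantor N x).
  { apply NNPP. intros K. apply (HN B (box_open Hu Hm)) with (x := u).
    - intros x Hx. apply NNPP. intros L. eauto.
    - apply HB. auto. }
  destruct K as (x & Hx & Hadh). apply HB in Hx as [Hx Hxu].
  assert (K : exists V, is_open cantor V /\ x ∈ V /\ forall y, y ∈ V -> ~ y ∈ N).
  { apply NNPP. intros K. apply Hadh. split; [exact Hx|]. intros V HV HxV.
    apply NNPP. intros L. apply K. exists V. split; [exact HV|]. split; [exact HxV|].
    intros y Hy HyN. eauto. }
  destruct K as (V & HV & HxV & HVN). destruct (open_box HV HxV) as (m0 & Hm0 & Hbox).
  destruct (nat_max Hm Hm0) as (m' & Hm' & H1 & H2).
  exists x, m'. split; [exact Hx|]. split; [exact Hm'|]. split; [exact H1|]. split; [exact Hxu|].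
  intros y Hy E. apply HVN, Hbox; auto.
Qed.

(* The coordinates below [j] are left free: they are released one at a time,
   avoiding [N] for both of their values in turn. *)
Lemma nowhere_dense_free (N j : M) : is_nowhere_dense cantor N -> j ∈ omega ->
  forall u m, u ∈ cantor -> m ∈ omega -> sub j m ->
  exists u' m', u' ∈ cantor /\ m' ∈ omega /\ sub m m' /\
    (forall i, i ∈ m -> ~ i ∈ j -> app u' i = app u i) /\
    forall y, y ∈ cantor -> (forall i, i ∈ m' -> ~ i ∈ j -> app y i = app u' i) -> ~ y ∈ N.
Proof.
  intros HN Hj. nat_induct Hj.
  - unfold cantor, two, one. dfn.
  - intros u m Hu Hm _. destruct (nowhere_dense_avoid HN Hu Hm) as (x & m' & Hx & Hm' & H1 & H2 & H3).
    exists x, m'. split; [exact Hx|]. split; [exact Hm'|]. split; [exact H1|]. split; [auto|].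
    intros y Hy E. apply H3; [exact Hy|]. intros i Hi. apply E; [exact Hi|apply in_empty].
  - intros j Hj IH u m Hu Hm Hjm.
    assert (Hjj : j ∈ succ j) by (apply in_succ; auto).
    assert (Hij : ~ j ∈ j) by now apply nat_irrefl.
    destruct (@ex_update u j empty) as (v0 & Hv0 & E0 & E0'); auto; [apply in_two; auto|].
    destruct (IH v0 m Hv0 Hm) as (u1 & m1 & Hu1 & Hm1 & A1 & B1 & C1).
    { intros i Hi. apply Hjm, in_succ. auto. }
    destruct (@ex_update u1 j one) as (v1 & Hv1 & E1 & E1'); auto; [apply in_two; auto|].
    destruct (IH v1 m1 Hv1 Hm1) as (u2 & m2 & Hu2 & Hm2 & A2 & B2 & C2).
    { intros i Hi. apply A1, Hjm, in_succ. auto. }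
    exists u2, m2. split; [exact Hu2|]. split; [exact Hm2|].
    split; [intros i Hi; auto|]. split.
    + intros i Hi Hns. rewrite in_succ in Hns. assert (i ∈ omega) by (eapply omega_trans; eauto).
      rewrite B2, E1', B1, E0' by (intuition auto). reflexivity.
    + intros y Hy E. destruct (cantor_val Hy Hj) as [V|V].
      * apply C1; [exact Hy|]. intros i Hi Hnj. assert (i ∈ omega) by (eapply omega_trans; eauto).
        destruct (classic (i = j)) as [->|Hne].
        -- rewrite B1 by auto. congruence.
        -- rewrite E by (try rewrite in_succ; intuition auto).
           now rewrite B2, E1' by (intuition auto).
      * apply C2; [exact Hy|]. intros i Hi Hnj.
        destruct (classic (i = j)) as [->|Hne].
        -- rewrite B2 by auto. congruence.
        -- apply E; [exact Hi|]. rewrite in_succ. tauto.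
Qed.

Variable d : M.
Hypothesis dc : DC M.
Hypothesis Hd : doubling d.

Lemma sub_dbl (m : M) : m ∈ omega -> sub m (app d m).
Proof. intros Hm. apply nat_sub; [now apply dbl_omega|now apply dbl_ge]. Qed.

Lemma dbl_sub (m n : M) : m ∈ omega -> n ∈ omega -> sub m n -> sub (app d m) (app d n).
Proof.
  intros Hm Hn H. destruct (nat_total Hm Hn) as [K|[->|K]].
  - apply nat_sub; [now apply dbl_omega|]. apply in_succ. left. now apply dbl_mono'.
  - intros x; auto.
  - exfalso. apply H in K. now apply nat_irrefl in K.
Qed.

(* The k-th block consists of the coordinates from [2 n_k] to [2 n_(k+1)], so that
   the coordinates [2i] and [2i+1] of an interleaved pair lie in the same block. *)
Lemma ex_blocks (g Y a n0 : M) : is_fun g omega Y ->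
  (forall k, k ∈ omega -> is_nowhere_dense cantor (app g k)) ->
  is_fun a omega omega -> n0 ∈ omega ->
  exists n z, is_fun n omega omega /\ z ∈ cantor /\ app n empty = n0 /\
    (forall k, k ∈ omega -> k ∈ app n (succ k)) /\
    (forall k k', k' ∈ omega -> k ∈ succ k' -> sub (app n k) (app n k')) /\
    forall k y, k ∈ omega -> y ∈ cantor ->
      (forall i, i ∈ app d (app n (succ k)) -> ~ i ∈ app d (app n k) -> app y i = app z i) ->
      ~ y ∈ app g (app a k).
Proof.
  intros Hg Hnwd Ha Hn0.
  destruct (@ex_cantor (fun i v => v = empty)) as (c0 & Hc0 & _);
    [dfn|intros i _; exists empty; rewrite in_two; auto|congruence|].
  (* A state (n, u) records the end 2n of the current block and a point whose coordinates below 2n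
     are final. The next block must work for every choice of these earlier coordinates. *)
  pose (Q := fun k s s' => exists n u n' u', s = pair n u /\ s' = pair n' u' /\ n ∈ n' /\
    (forall i, i ∈ app d n -> app u' i = app u i) /\
    forall y, y ∈ cantor ->
      (forall i, i ∈ app d n' -> ~ i ∈ app d n -> app y i = app u' i) -> ~ y ∈ app g (app a k)).
  destruct (@dc_sequence _ _ dc (prod omega cantor) (pair n0 c0) Q) as (s & Hs & Hs0 & Hss).
  - unfold Q. dfn.
  - now apply pair_in_prod.
  - intros k t Hk Ht. apply in_prod in Ht as (n & u & Hn & Hu & ->).
    pose proof (dbl_omega Hd Hn) as Hdn.
    destruct (nowhere_dense_free (Hnwd _ (fun_app_in Ha Hk)) Hdn Hu Hdn)
      as (u1 & m1 & Hu1 & Hm1 & _ & _ & C1); [intros x; auto|].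
    (* [u1] may differ from [u] below 2n. Since [C1] constrains only coordinates from 2n on, the
       final values of [u] can be put back. *)
    destruct (@ex_patch (fun i => i ∈ app d n) u u1) as (v & Hv & V1 & V2); [dfn|auto|auto|].
    destruct (nat_max Hn Hm1) as (p & Hp & P1 & P2).
    exists (pair (succ p) v). split; [apply pair_in_prod; auto using succ_omega|].
    exists n, u, (succ p), v. split; [reflexivity|]. split; [reflexivity|].
    split; [|split].
    + destruct (nat_total Hn (succ_omega Hp)) as [K|[K|K]]; [exact K| |].
      * exfalso. subst n. apply (nat_irrefl Hp). apply P1, in_succ. auto.
      * exfalso. apply P1 in K. apply (nat_asym Hp K). apply in_succ. auto.
    + intros i Hi. apply V1; [exact (omega_trans Hdn Hi)|exact Hi].
    + intros y Hy E. apply C1; [exact Hy|]. intros i Hi Hni.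
      assert (Hio : i ∈ omega) by exact (omega_trans Hm1 Hi).
      rewrite E; [now apply V2| |exact Hni].
      apply P2 in Hi. apply sub_dbl in Hi; [|exact Hp].
      eapply nat_trans; [apply dbl_omega; auto using succ_omega|exact Hi|].
      apply dbl_mono'; auto using succ_omega. apply in_succ. auto.
  - destruct (@ex_fun _ _ omega omega (fun k n => exists u, app s k = pair n u)) as (n & Hn & En).
    { dfn. }
    { intros k Hk. pose proof (fun_app_in Hs Hk) as K.
      apply in_prod in K as (m & u & Hm & Hu & E). eauto. }
    { intros k m m' _ (u & E) (u' & E'). rewrite E in E'. now apply pair_inj in E' as [-> _]. }
    destruct (@ex_fun _ _ omega cantor (fun k u => app s k = pair (app n k) u)) as (u & Hu & Eu).
    { dfn. }
    { intros k Hk. destruct (En k Hk) as (v & E). exists v. split; [|exact E].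
      pose proof (fun_app_in Hs Hk) as K. rewrite E in K. now apply pair_in_prod in K. }
    { intros k m m' _ E E'. rewrite E in E'. now apply pair_inj in E' as [_ ->]. }
    assert (Hno : forall k, k ∈ omega -> app n k ∈ omega) by (intros k; now apply fun_app_in).
    assert (Huo : forall k, k ∈ omega -> app u k ∈ cantor) by (intros k; now apply fun_app_in).
    assert (St : forall k, k ∈ omega -> app n k ∈ app n (succ k) /\
      (forall i, i ∈ app d (app n k) -> app (app u (succ k)) i = app (app u k) i) /\
      forall y, y ∈ cantor -> (forall i, i ∈ app d (app n (succ k)) -> ~ i ∈ app d (app n k) ->
        app y i = app (app u (succ k)) i) -> ~ y ∈ app g (app a k)).
    { intros k Hk. destruct (Hss k Hk) as (m & v & m' & v' & E & E' & R).
      rewrite Eu in E by exact Hk. rewrite Eu in E' by now apply succ_omega.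
      apply pair_inj in E as [-> ->]. apply pair_inj in E' as [-> ->]. exact R. }
    assert (Mono : forall k', k' ∈ omega -> forall k, k ∈ succ k' ->
      sub (app n k) (app n k') /\ sub (app d (app n k)) (app d (app n k')) /\
      forall i, i ∈ app d (app n k) -> app (app u k') i = app (app u k) i).
    { intros k' Hk'. nat_induct Hk'; [dfn| |].
      - intros k Hk. apply in_succ in Hk as [Hk| ->]; [now apply in_empty in Hk|].
        split; [intros x; auto|]. split; [intros x; auto|auto].
      - intros k' Hk' IH k Hk. apply in_succ in Hk as [Hk| ->].
        + destruct (IH k Hk) as (I1 & I2 & I3). destruct (St k' Hk') as (S1 & S2 & _).
          assert (S1' : sub (app n k') (app n (succ k'))).
          { apply nat_sub; [auto using succ_omega|]. apply in_succ. auto. }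
          split; [intros x Hx; auto|]. split.
          * intros x Hx. apply I2 in Hx. revert x Hx. apply dbl_sub; auto using succ_omega.
          * intros i Hi. rewrite S2 by auto. auto.
        + split; [intros x; auto|]. split; [intros x; auto|auto]. }
    assert (Gr : forall k, k ∈ omega -> k ∈ app n (succ k)).
    { intros k Hk. nat_induct Hk; [dfn| |].
      - destruct (St empty zero_omega) as [K _].
        destruct (nat_total zero_omega (Hno (succ empty) (succ_omega zero_omega))) as [L|[L|L]];
          [exact L| |now apply in_empty in L].
        rewrite <- L in K. now apply in_empty in K.
      - intros k Hk IH. destruct (St (succ k) (succ_omega Hk)) as [K _].
        assert (L : succ k ∈ succ (app n (succ k))) by (apply succ_in_succ; auto using succ_omega).
        apply in_succ in L as [L|L]; [|rewrite <- L in K; exact K].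
        eapply nat_trans; [|exact L|exact K]. auto using succ_omega. }
    assert (Grd : forall i, i ∈ omega -> i ∈ app d (app n (succ i))).
    { intros i Hi. apply sub_dbl; auto using succ_omega. }
    (* Coordinate i has settled by stage i + 1, because i < 2 n_(i+1). *)
    destruct (@ex_cantor (fun i v => v = app (app u (succ i)) i)) as (z & Hz & Ez).
    { dfn. }
    { intros i Hi. exists (app (app u (succ i)) i). split; [|reflexivity].
      apply (@fun_app_in _ _ _ omega); [|exact Hi]. apply in_cantor. auto using succ_omega. }
    { congruence. }
    exists n, z. split; [exact Hn|]. split; [exact Hz|]. split.
    { destruct (En empty zero_omega) as (v & E). rewrite Hs0 in E.
      apply pair_inj in E as [E _]. now symmetry. }
    split; [exact Gr|]. split; [intros k k' Hk' Hk; now apply Mono|].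
    intros k y Hk Hy E. apply (St k Hk); [exact Hy|]. intros i Hi Hni.
    assert (Hio : i ∈ omega).
    { eapply omega_trans; [|exact Hi]. apply dbl_omega; auto using succ_omega. }
    rewrite E, Ez by assumption.
    destruct (nat_total Hk Hio) as [K|[->|K]]; [|reflexivity|].
    + apply Mono; [now apply succ_omega| |exact Hi]. apply in_succ. left. now apply succ_in_succ.
    + symmetry. apply Mono; [now apply succ_omega| |auto]. apply in_succ. left.
      now apply succ_in_succ.
Qed.
End Cantor.

(** * From the Baire property to an embedding of Cantor space *)

Section Key.
Context {M : eps_structure} {zf : ZF M}.
Hypothesis dc : DC M.
Hypothesis bp : all_sets_Baire M.

Lemma ex_interleave (d x y : M) : doubling d -> x ∈ cantor -> y ∈ cantor ->
  exists z, z ∈ cantor /\ (forall i, i ∈ omega -> app z (app d i) = app x i) /\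
    (forall i, i ∈ omega -> app z (succ (app d i)) = app y i).
Proof.
  intros Hd Hx Hy.
  destruct (@ex_cantor _ _ (fun l v => exists i, i ∈ omega /\
    ((l = app d i /\ v = app x i) \/ (l = succ (app d i) /\ v = app y i)))) as (z & Hz & E).
  - dfn.
  - intros l Hl. apply in_cantor in Hx, Hy.
    destruct (dbl_cases Hd Hl) as (i & Hi & [->| ->]).
    + exists (app x i). split; [now apply (fun_app_in Hx)|]. exists i. auto.
    + exists (app y i). split; [now apply (fun_app_in Hy)|]. exists i. auto.
  - intros l v v' _ (i & Hi & [[-> ->]|[-> ->]]) (j & Hj & [[E ->]|[E ->]]).
    + apply (dbl_inj Hd Hi Hj) in E. now subst.
    + exfalso. exact (dbl_parity Hd Hi Hj E).
    + exfalso. symmetry in E. exact (dbl_parity Hd Hj Hi E).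
    + apply succ_inj in E; auto using dbl_omega. apply (dbl_inj Hd Hi Hj) in E. now subst.
  - exists z. split; [exact Hz|]. split; intros i Hi.
    + destruct (E _ (dbl_omega Hd Hi)) as (j & Hj & [[Ej ->]|[Ej _]]).
      * apply (dbl_inj Hd Hi Hj) in Ej. now subst.
      * exfalso. exact (dbl_parity Hd Hi Hj Ej).
    + destruct (E _ (succ_omega (dbl_omega Hd Hi))) as (j & Hj & [[Ej _]|[Ej ->]]).
      * exfalso. symmetry in Ej. exact (dbl_parity Hd Hj Hi Ej).
      * apply succ_inj in Ej; auto using dbl_omega. apply (dbl_inj Hd Hi Hj) in Ej. now subst.
Qed.

Lemma meager_sequence (X : M) : is_meager cantor X -> exists g Z, is_fun g omega Z /\
  (forall k, k ∈ omega -> is_nowhere_dense cantor (app g k)) /\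
  forall x, x ∈ X -> exists k, k ∈ omega /\ x ∈ app g k.
Proof.
  intros (w & g & Hw & Hg & Hn & HX). apply is_omega_iff in Hw. subst w.
  destruct (is_fun_on_fun Hg) as (Z & HZ). exists g, Z. split; [exact HZ|]. split.
  - intros k Hk. apply (Hn k). now apply (fun_app_rel HZ).
  - intros x Hx. apply HX in Hx as (k & N & Hr & Hx).
    apply (fun_rel _ _ HZ) in Hr as [Hk ->]. eauto.
Qed.

(** Once the kernel of [f] is meager, the rest is a form of Mycielski's theorem: a meager relation
    leaves a perfect set of pairwise unrelated points. Pasting two fixed points along fixed blocks
    makes the embedding definable from finitely many parameters, so no choices depend on s. *)
Lemma card_le_flip (f A : M) : is_fun f cantor A ->
  (forall x y m, x ∈ cantor -> y ∈ cantor -> m ∈ omega -> app x m <> app y m ->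
    (forall i, i ∈ omega -> i <> m -> app x i = app y i) -> app f x <> app f y) ->
  card_le cantor A.
Proof.
  intros Hf Hflip.
  destruct (ex_doubling dc) as [d Hd].
  destruct (ex_unpairing dc) as (a & b & Ha & Hb & Hab).
  (* [z] codes the pair of its even and odd halves, which turns the kernel of [f] into a subset of
     Cantor space. *)
  pose (split_eq := fun z => exists x y, x ∈ cantor /\ y ∈ cantor /\
    (forall i, i ∈ omega -> app x i = app z (app d i)) /\
    (forall i, i ∈ omega -> app y i = app z (succ (app d i))) /\ app f x = app f y).
  pose (Y := sep cantor split_eq).
  assert (HY : forall z, z ∈ Y <-> z ∈ cantor /\ split_eq z).
  { intros z. unfold Y. rewrite in_sep by (unfold split_eq, cantor, two, one; dfn). reflexivity. }
  destruct (bp is_cantor_cantor (Y := Y)) as (U & X & HU & HX & Hmeag).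
  { intros z Hz. now apply HY in Hz. }
  destruct (meager_sequence Hmeag) as (g & Z & Hg & Hnwd & HgX).
  assert (HUe : forall x, ~ x ∈ U).
  { intros x HxU. pose proof (proj1 HU x HxU) as Hx.
    destruct (open_box HU HxU) as (m & Hm & Hbox).
    (* The blocks start at 2(m + 1), beyond the box and beyond the coordinate 2m + 1, which lies
       outside the box and will be flipped. *)
    destruct (ex_blocks dc Hd Hg Hnwd Ha (succ_omega Hm))
      as (n & z & Hn & Hz & Hn0 & _ & Hmono & Hblk).
    destruct (@ex_patch _ _ (fun i => i ∈ app d (succ m)) x z) as (v & Hv & V1 & V2);
      [dfn|exact Hx|exact Hz|].
    assert (Hdm : app d (succ m) ∈ omega) by auto using dbl_omega, succ_omega.
    assert (Hmd : forall i, i ∈ m -> i ∈ omega /\ i ∈ app d (succ m)).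
    { intros i Hi. split; [exact (omega_trans Hm Hi)|].
      apply sub_dbl; auto using succ_omega. apply in_succ. auto. }
    (* Such a [y] lies in [U] and, agreeing with [z] on all blocks, outside every nowhere dense set
       covering the symmetric difference [X]; hence it lies in [Y]. *)
    assert (K : forall y, y ∈ cantor -> (forall i, i ∈ m -> app y i = app x i) ->
      (forall i, i ∈ omega -> ~ i ∈ app d (succ m) -> app y i = app z i) -> split_eq y).
    { intros y Hy E1 E2. assert (HyX : ~ y ∈ X).
      { intros HyX. apply HgX in HyX as (j & Hj & HyX).
        destruct (Hab j empty Hj zero_omega) as (k & Hk & Ek & _). rewrite <- Ek in HyX.
        revert HyX. apply Hblk; [exact Hk|exact Hy|]. intros i Hi Hni. apply E2.
        - eapply omega_trans; [|exact Hi]. apply (dbl_omega Hd), (fun_app_in Hn).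
          now apply succ_omega.
        - intros Hi'. apply Hni. rewrite <- Hn0 in Hi'. clear Hi Hni. revert i Hi'.
          apply dbl_sub; [exact Hd| | |].
          + apply (fun_app_in Hn), zero_omega.
          + now apply (fun_app_in Hn).
          + apply Hmono; [exact Hk|now apply empty_in_succ]. }
      apply HY. apply NNPP. intros HyY. apply HyX, HX. right. auto. }
    set (l := succ (app d m)).
    assert (Hlo : l ∈ omega) by (apply succ_omega; now apply dbl_omega).
    assert (Hl : l ∈ app d (succ m)).
    { apply dbl_mono; auto using succ_omega. apply in_succ. auto. }
    assert (Hlm : forall i, i ∈ m -> i <> l).
    { intros i Hi ->. apply (nat_asym Hm Hi). now apply dbl_ge. }
    assert (W : exists w, w ∈ two /\ w <> app v l).
    { destruct (cantor_val Hv Hlo) as [E|E]; rewrite E.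
      - exists one. rewrite in_two. split; [auto|exact one_neq_zero].
      - exists empty. rewrite in_two. split; [auto|]. intros E'. now apply one_neq_zero. }
    destruct W as (w & Hw & Hwv).
    destruct (ex_update Hv Hlo Hw) as (v' & Hv' & El & E').
    destruct (K v) as (p & q & Hp & Hq & Ep & Eq & Epq); [exact Hv| | |].
    { intros i Hi. apply V1; now apply Hmd. }
    { exact V2. }
    destruct (K v') as (p' & q' & Hp' & Hq' & Ep' & Eq' & Epq'); [exact Hv'| | |].
    { intros i Hi. rewrite E'; [apply V1; now apply Hmd|now apply Hmd|auto]. }
    { intros i Hi Hni. rewrite E'; [now apply V2|exact Hi|]. intros ->. auto. }
    (* The flipped coordinate is odd: the even halves coincide and the odd halves differ exactly at
       m, yet [split_eq] makes both odd halves share the [f]-value of the common even half. *)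
    assert (p = p').
    { apply cantor_ext; auto. intros i Hi. rewrite Ep, Ep' by exact Hi. symmetry.
      apply E'; [auto using dbl_omega|now apply dbl_parity]. }
    subst p'. apply (Hflip q q' m); auto; [| |congruence].
    - rewrite Eq, Eq' by exact Hm. fold l. rewrite El. auto.
    - intros i Hi Him. rewrite Eq, Eq' by exact Hi. symmetry. apply E'.
      + auto using succ_omega, dbl_omega.
      + unfold l. intros E. apply Him. apply (dbl_inj Hd Hi Hm).
        apply succ_inj; auto using dbl_omega. }
  (* As [U] is empty, [X] and [Y] have the same elements. The blocks now start at 0 and cover omega;
     the even and odd halves of [z] are the two points to be pasted together. *)
  destruct (ex_blocks dc Hd Hg Hnwd Ha zero_omega) as (n & z & Hn & Hz & Hn0 & Hgr & Hmono & Hblk).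
  assert (Hno : forall k, k ∈ omega -> app n k ∈ omega) by (intros k; now apply fun_app_in).
  (* Coordinate i of a half belongs to block k exactly when 2i and 2i + 1 belong to the k-th block
     of [z]. *)
  pose (in_block := fun i k => k ∈ omega /\ i ∈ app n (succ k) /\ ~ i ∈ app n k).
  assert (Bex : forall i, i ∈ omega -> exists k, in_block i k).
  { intros i Hi. cut (forall k, k ∈ omega -> i ∈ app n k -> exists k, in_block i k).
    { intros K. apply (K (succ i)); auto using succ_omega. }
    intros k Hk. nat_induct Hk; [unfold in_block; dfn| |].
    - rewrite Hn0. intros K. now apply in_empty in K.
    - intros k Hk IH K. destruct (classic (i ∈ app n k)); [auto|]. exists k. split; auto. }
  assert (Bun : forall i k k', in_block i k -> in_block i k' -> k = k').
  { assert (L : forall i k k', in_block i k -> in_block i k' -> ~ k ∈ k').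
    { intros i k k' (Hk & Hi & Hni) (Hk' & Hi' & Hni') H. apply Hni'.
      apply (Hmono (succ k) k'); [exact Hk'|now apply succ_in_succ|exact Hi]. }
    intros i k k' H H'. destruct (nat_total (proj1 H) (proj1 H')) as [K|[K|K]]; [|exact K|]; exfalso;
      [exact (L _ _ _ H H' K)|exact (L _ _ _ H' H K)]. }
  pose (H := fun s x => forall i, i ∈ omega -> exists k, in_block i k /\
    ((app s (app b k) = empty /\ app x i = app z (app d i)) \/
     (app s (app b k) = one /\ app x i = app z (succ (app d i))))).
  assert (Hex : forall s, s ∈ cantor -> exists x, x ∈ cantor /\ H s x).
  { intros s Hs. apply (@ex_cantor _ _ (fun i v => exists k, in_block i k /\
      ((app s (app b k) = empty /\ v = app z (app d i)) \/
       (app s (app b k) = one /\ v = app z (succ (app d i)))))).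
    - unfold in_block, one. dfn.
    - intros i Hi. destruct (Bex i Hi) as (k & Hk).
      assert (Hbk : app b k ∈ omega) by (apply (fun_app_in Hb), Hk).
      apply in_cantor in Hz.
      destruct (cantor_val Hs Hbk) as [E|E].
      + exists (app z (app d i)). split; [apply (fun_app_in Hz); auto using dbl_omega|eauto].
      + exists (app z (succ (app d i))).
        split; [apply (fun_app_in Hz); auto using succ_omega, dbl_omega|eauto].
    - intros i v v' _ (k & Hk & C) (k' & Hk' & C').
      rewrite <- (Bun _ _ _ Hk Hk') in C'. pose proof one_neq_zero.
      destruct C as [[C ->]|[C ->]], C' as [[C' ->]|[C' ->]]; congruence. }
  assert (Hun : forall s x x', x ∈ cantor -> x' ∈ cantor -> H s x -> H s x' -> x = x').
  { intros s x x' Hx Hx' K K'. apply cantor_ext; auto. intros i Hi.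
    destruct (K i Hi) as (k & Hk & C). destruct (K' i Hi) as (k' & Hk' & C').
    rewrite <- (Bun _ _ _ Hk Hk') in C'. pose proof one_neq_zero.
    destruct C as [[C ->]|[C ->]], C' as [[C' ->]|[C' ->]]; congruence. }
  assert (Hsep : forall s t x y i, s ∈ cantor -> t ∈ cantor -> x ∈ cantor -> y ∈ cantor ->
    H s x -> H t y -> i ∈ omega -> app s i = empty -> app t i = one -> app f x <> app f y).
  { intros s t x y i Hs Ht Hx Hy Hsx Hty Hi Es Et E.
    destruct (ex_interleave Hd Hx Hy) as (c & Hc & Cx & Cy).
    assert (HcX : c ∈ X).
    { apply HX. left. split; [|apply HUe]. apply HY. split; [exact Hc|]. exists x, y.
      split; [exact Hx|]. split; [exact Hy|]. split; [|split]; [| |exact E]; intros j Hj; symmetry; auto. }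
    (* Choose the block k that treats the j-th nowhere dense set and copies bit i. On it [x] equals
       the even and [y] the odd half of [z], so the interleaved point [c] agrees with [z] on the
       whole block. *)
    apply HgX in HcX as (j & Hj & HcX). destruct (Hab j i Hj Hi) as (k & Hk & Ea & Eb).
    rewrite <- Ea in HcX. revert HcX. apply Hblk; [exact Hk|exact Hc|].
    pose proof one_neq_zero as H10.
    intros l Hl Hnl. assert (Hlo : l ∈ omega).
    { eapply omega_trans; [|exact Hl]. auto using dbl_omega, succ_omega. }
    destruct (dbl_cases Hd Hlo) as (q & Hq & Elq).
    assert (Hqk : in_block q k).
    { split; [exact Hk|]. split.
      - apply (dbl_lt_inv Hd); auto using succ_omega. destruct Elq as [->| ->]; [exact Hl|].
        eapply nat_trans; [|apply in_succ; right; reflexivity|exact Hl]. auto using dbl_omega, succ_omega.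
      - intros K. apply Hnl. destruct Elq as [->| ->]; [apply dbl_mono'|apply dbl_mono]; auto. }
    destruct Elq as [->| ->].
    - rewrite Cx by exact Hq. destruct (Hsx q Hq) as (k' & Hk' & C).
      rewrite (Bun _ _ _ Hk' Hqk), Eb in C. destruct C as [[_ C]|[C _]]; congruence.
    - rewrite Cy by exact Hq. destruct (Hty q Hq) as (k' & Hk' & C).
      rewrite (Bun _ _ _ Hk' Hqk), Eb in C. destruct C as [[C _]|[_ C]]; congruence. }
  destruct (@ex_fun _ _ cantor A (fun s v => exists x, x ∈ cantor /\ H s x /\ v = app f x))
    as (h & Hh & Eh).
  - unfold H, in_block, one, cantor, two, one. dfn.
  - intros s Hs. destruct (Hex s Hs) as (x & Hx & K). exists (app f x).
    split; [now apply (fun_app_in Hf)|eauto].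
  - intros s v v' _ (x & Hx & K & ->) (x' & Hx' & K' & ->). now rewrite (Hun _ _ _ Hx Hx' K K').
  - exists h. apply injection_intro; [exact Hh|]. intros s t Hs Ht E. apply NNPP. intros N.
    destruct (Eh s Hs) as (x & Hx & Kx & Ex). destruct (Eh t Ht) as (y & Hy & Ky & Ey).
    apply N, cantor_ext; auto. intros i Hi.
    destruct (cantor_val Hs Hi) as [Es|Es], (cantor_val Ht Hi) as [Et|Et]; try congruence.
    + exfalso. apply (Hsep s t x y i); auto. congruence.
    + exfalso. apply (Hsep t s y x i); auto. congruence.
Qed.

(** Disequality is symmetric, so it suffices to treat a bit that is switched from 0 to 1; in both
    applications this means inserting one element. *)
Lemma card_le_switch (f A : M) : is_fun f cantor A ->
  (forall x y m, x ∈ cantor -> y ∈ cantor -> m ∈ omega -> app x m = empty -> app y m = one ->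
    (forall i, i ∈ omega -> i <> m -> app x i = app y i) -> app f x <> app f y) ->
  card_le cantor A.
Proof.
  intros Hf H. apply (card_le_flip Hf). intros x y m Hx Hy Hm N E.
  destruct (cantor_val Hx Hm) as [Ex|Ex], (cantor_val Hy Hm) as [Ey|Ey]; try congruence.
  - now apply (H x y m).
  - intros K. symmetry in K. revert K. apply (H y x m); auto. intros i Hi Him. symmetry. auto.
Qed.
End Key.

(** * Slenderness *)

Section Groups.
Context {M : eps_structure} {zf : ZF M}.
Variables A m : M.
Hypothesis HA : is_group A m.

Definition mul (m x y : M) : M := app m (pair x y).

Lemma rel2_iff (x y z : M) : rel2 m x y z <-> x ∈ A /\ y ∈ A /\ z = mul m x y.
Proof.
  destruct HA as ([H1 H2] & _).
  assert (Hf : is_fun m (prod A A) A).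
  { split; [split|].
    - intros t Ht. destruct (H1 t Ht) as (a & b & c & p & Ha & Hb & Hc & Hp & E).
      apply is_opair_iff in Hp. subst p. exists (pair a b), c. now rewrite pair_in_prod.
    - intros p Hp. apply in_prod in Hp as (a & b & Ha & Hb & ->).
      destruct (H2 a b Ha Hb) as (c & (p & Hp & Hc) & U). apply is_opair_iff in Hp. subst p.
      exists c. split; [exact Hc|]. intros c' Hc'. apply U. exists (pair a b).
      now rewrite is_opair_iff.
    - intros p c Hr. apply rel_iff in Hr.
      destruct (H1 _ Hr) as (a & b & c' & p' & Ha & Hb & Hc & Hp & E).
      apply is_opair_iff, pair_inj in E as [-> ->]. exact Hc. }
  split.
  - intros (p & Hp & Hr). apply is_opair_iff in Hp. subst p.
    apply (fun_rel _ _ Hf) in Hr as [Hp ->]. apply pair_in_prod in Hp. unfold mul. tauto.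
  - intros (Hx & Hy & ->). exists (pair x y). rewrite is_opair_iff. split; [reflexivity|].
    apply (fun_app_rel Hf). now apply pair_in_prod.
Qed.

Lemma mul_in (x y : M) : x ∈ A -> y ∈ A -> mul m x y ∈ A.
Proof.
  intros Hx Hy. assert (K : rel2 m x y (mul m x y)) by now apply rel2_iff.
  destruct K as (p & _ & t & Ht & E). destruct HA as ([H1 _] & _).
  destruct (H1 t Ht) as (a & b & c & p' & _ & _ & Hc & _ & E').
  apply is_opair_iff in E, E'. subst t. apply pair_inj in E' as [_ ->]. exact Hc.
Qed.

Lemma mul_assoc (x y z : M) : x ∈ A -> y ∈ A -> z ∈ A ->
  mul m (mul m x y) z = mul m x (mul m y z).
Proof.
  intros Hx Hy Hz. destruct HA as (_ & Has & _).
  assert (K : rel2 m (mul m x y) z (mul m (mul m x y) z)) by (apply rel2_iff; auto using mul_in).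
  apply (Has x y z _ (mul m y z)) in K; [|now apply rel2_iff|now apply rel2_iff].
  apply rel2_iff in K. tauto.
Qed.

Lemma group_unit : exists e, e ∈ A /\ (forall x, x ∈ A -> mul m e x = x /\ mul m x e = x) /\
  (forall u v w, u ∈ A -> v ∈ A -> w ∈ A -> mul m u v = mul m u w -> v = w) /\
  (forall u v w, u ∈ A -> v ∈ A -> w ∈ A -> mul m v u = mul m w u -> v = w).
Proof.
  pose proof HA as (_ & _ & e & [He Hid] & Hinv). exists e.
  assert (Hid' : forall x, x ∈ A -> mul m e x = x /\ mul m x e = x).
  { intros x Hx. destruct (Hid x Hx) as [H1 H2]. apply rel2_iff in H1, H2. split; symmetry; tauto. }
  split; [exact He|]. split; [exact Hid'|]. split.
  - intros u v w Hu Hv Hw E. destruct (Hinv u Hu) as (u' & Hu' & _ & K).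
    apply rel2_iff in K as (_ & _ & K). apply (f_equal (mul m u')) in E.
    rewrite <- !mul_assoc, <- K in E by assumption.
    now rewrite (proj1 (Hid' v Hv)), (proj1 (Hid' w Hw)) in E.
  - intros u v w Hu Hv Hw E. destruct (Hinv u Hu) as (u' & Hu' & K & _).
    apply rel2_iff in K as (_ & _ & K). apply (f_equal (fun t => mul m t u')) in E.
    rewrite !mul_assoc, <- K in E by assumption.
    now rewrite (proj2 (Hid' v Hv)), (proj2 (Hid' w Hw)) in E.
Qed.
End Groups.

(** * Infinite sums of selected terms of a sequence *)

Section Sums.
Context {M : eps_structure} {zf : ZF M}.
Hypothesis dc : DC M.
Variable s : M.
Hypothesis Hs : addition s.

Definition plus (s x y : M) : M := app (app s y) x.
(* [app T x] is the sum of the sequences [p n] with [x n = 1], finite in each coordinate. *)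
Lemma ex_subsums (p : M) : is_fun p omega (funs omega omega) ->
  (forall n i, n ∈ omega -> i ∈ n -> app (app p n) i = empty) ->
  exists T, is_fun T cantor (funs omega omega) /\
    forall x y n, x ∈ cantor -> y ∈ cantor -> n ∈ omega -> app x n = empty -> app y n = one ->
      (forall i, i ∈ omega -> i <> n -> app x i = app y i) ->
      forall i, i ∈ omega ->
        app (app T y) i = plus s (app (app T x) i) (app (app p n) i).
Proof.
  intros Hp Hp0.
  assert (Hpo : forall n i, n ∈ omega -> i ∈ omega -> app (app p n) i ∈ omega).
  { intros n i Hn Hi. apply (@fun_app_in _ _ _ omega); [|exact Hi]. apply in_funs.
    now apply (fun_app_in Hp). }
  assert (Hpl : forall a b, a ∈ omega -> b ∈ omega -> plus s a b ∈ omega)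
    by (intros a b; apply plus_omega; exact Hs).
  assert (H10 := one_neq_zero).
  destruct (@ex_fun _ _ (prod cantor omega) omega (fun _ v => v = empty)) as (S0 & HS0 & E0);
    [dfn|intros; exists empty; auto using zero_omega|congruence|].
  (* The k-th state is the whole table of partial sums over indices below k, for all [x] and [i] at
     once, so one recursion serves every [x]. *)
  pose (Q := fun k f g => forall x i, x ∈ cantor -> i ∈ omega ->
    (app x k = one /\ app g (pair x i) = plus s (app f (pair x i)) (app (app p k) i)) \/
    (app x k = empty /\ app g (pair x i) = app f (pair x i))).
  destruct (@dc_sequence _ _ dc (funs (prod cantor omega) omega) S0 Q) as (z & Hz & Hz0 & Hzs).
  - unfold Q, cantor, two, one. dfn.
  - now apply in_funs.
  - intros k f Hk Hf. apply in_funs in Hf.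
    destruct (@ex_fun _ _ (prod cantor omega) omega (fun t v => exists x i, t = pair x i /\
      ((app x k = one /\ v = plus s (app f (pair x i)) (app (app p k) i)) \/
       (app x k = empty /\ v = app f (pair x i))))) as (g & Hg & E).
    + unfold one. dfn.
    + intros t Ht. pose proof (fun_app_in Hf Ht) as Hft.
      apply in_prod in Ht as (x & i & Hx & Hi & ->).
      destruct (cantor_val Hx Hk) as [V|V].
      * exists (app f (pair x i)). split; [exact Hft|]. exists x, i. auto.
      * exists (plus s (app f (pair x i)) (app (app p k) i)). split; [auto|]. exists x, i. auto.
    + intros t v v' _ (x & i & -> & C) (x' & i' & E' & C'). apply pair_inj in E' as [<- <-].
      destruct C as [[C ->]|[C ->]], C' as [[C' ->]|[C' ->]]; congruence.
    + exists g. split; [now apply in_funs|]. intros x i Hx Hi.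
      destruct (E (pair x i)) as (x' & i' & E' & C); [now apply pair_in_prod|].
      apply pair_inj in E' as [<- <-]. exact C.
  - pose (S := fun k x i => app (app z k) (pair x i)).
    assert (HSo : forall k x i, k ∈ omega -> x ∈ cantor -> i ∈ omega -> S k x i ∈ omega).
    { intros k x i Hk Hx Hi. apply (@fun_app_in _ _ _ (prod cantor omega)); [|now apply pair_in_prod].
      apply in_funs. now apply (fun_app_in Hz). }
    (* Coordinate i is read off at stage i + 1: [p n] vanishes at i whenever n > i, so later terms
       contribute nothing there. *)
    destruct (@ex_fun _ _ cantor (funs omega omega) (fun x t => t ∈ funs omega omega /\
      forall i, i ∈ omega -> app t i = app (app z (succ i)) (pair x i))) as (T & HT & ET).
    + dfn.
    + intros x Hx. destruct (@ex_fun _ _ omega omega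
        (fun i v => v = app (app z (succ i)) (pair x i))) as (t & Ht & Et); [dfn| |congruence|].
      * intros i Hi. exists (app (app z (succ i)) (pair x i)). split; [|reflexivity].
        apply HSo; auto using succ_omega.
      * exists t. rewrite in_funs. auto.
    + intros x t t' _ [Ht Et] [Ht' Et']. apply in_funs in Ht, Ht'. apply (fun_ext Ht Ht').
      intros i Hi. now rewrite Et, Et'.
    + exists T. split; [exact HT|]. intros x y n Hx Hy Hn Ex Ey Exy i Hi.
      rewrite (proj2 (ET x Hx) i Hi), (proj2 (ET y Hy) i Hi). fold (S (succ i) x i) (S (succ i) y i).
      (* Up to stage n the two partial sums agree. Stage n + 1 adds the n-th term to that of [y]
         only, and [plus_swap] carries this extra summand through the later stages. *)
      assert (L : forall k, k ∈ omega -> (k ∈ succ n -> S k y i = S k x i) /\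
        (n ∈ k -> S k y i = plus s (S k x i) (app (app p n) i))).
      { intros k Hk. nat_induct Hk; [unfold S; dfn| |].
        - split; [|intros K; now apply in_empty in K]. intros _. unfold S. rewrite Hz0.
          rewrite !E0 by now apply pair_in_prod. reflexivity.
        - intros k Hk [IH1 IH2].
          assert (Sx := Hzs k Hk x i Hx Hi). assert (Sy := Hzs k Hk y i Hy Hi).
          fold (S (succ k) x i) (S k x i) in Sx. fold (S (succ k) y i) (S k y i) in Sy.
          destruct (nat_total Hk Hn) as [K|[->|K]].
          + assert (Exyk : app x k = app y k).
            { apply Exy; [exact Hk|]. intros ->. now apply nat_irrefl in K. }
            split.
            * intros _. rewrite IH1 in Sy by (apply in_succ; auto).
              destruct Sx as [[Vx ->]|[Vx ->]], Sy as [[Vy ->]|[Vy ->]]; congruence.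
            * intros K'. exfalso. apply in_succ in K' as [K'| ->].
              -- exact (nat_asym Hn K K').
              -- now apply nat_irrefl in K.
          + split.
            * intros K. exfalso. apply (nat_irrefl (succ_omega Hn) K).
            * intros _. rewrite IH1 in Sy by (apply in_succ; auto).
              destruct Sx as [[Vx ->]|[Vx ->]], Sy as [[Vy ->]|[Vy ->]]; congruence.
          + assert (Exyk : app x k = app y k).
            { apply Exy; [exact Hk|]. intros ->. now apply nat_irrefl in K. }
            split.
            * intros K'. exfalso. apply (nat_asym (succ_omega Hk) (succ_in_succ Hk K) K').
            * intros _. rewrite (IH2 K) in Sy.
              destruct Sx as [[Vx ->]|[Vx ->]], Sy as [[Vy ->]|[Vy ->]]; try congruence.
              apply plus_swap; auto. }
      destruct (L (succ i) (succ_omega Hi)) as [L1 L2].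
      destruct (nat_total Hn (succ_omega Hi)) as [K|K]; [auto|].
      (* Here n > i: the sum for coordinate i stops before the n-th term, which is 0 at i. *)
      assert (K' : succ i ∈ succ n) by (apply in_succ; intuition congruence).
      rewrite (L1 K'). symmetry.
      rewrite Hp0; [apply plus_0; auto using succ_omega|exact Hn|].
      apply in_succ in K' as [K'|K'].
      * apply (@nat_trans _ _ _ (succ i)); [exact Hn|apply in_succ; auto|exact K'].
      * rewrite <- K'. apply in_succ. auto.
Qed.
End Sums.

(** * Abelian groups that are not slender *)

Section Slender.
Context {M : eps_structure} {zf : ZF M}.
Hypothesis dc : DC M.
Hypothesis bp : all_sets_Baire M.

Lemma int_class_unique (z z' m n : M) : int_class z m n -> int_class z' m n -> z = z'.
Proof.
  intros (_ & _ & H) (_ & _ & H'). apply set_ext. intros p. now rewrite H, H'.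
Qed.

Lemma ex_int_class (m n : M) : m ∈ omega -> n ∈ omega -> exists z, int_class z m n.
Proof.
  intros Hm Hn.
  exists (sep (prod omega omega) (fun p => exists m' n' k, is_nat m' /\ is_nat n' /\
    is_opair p m' n' /\ nat_add m n' k /\ nat_add m' n k)).
  split; [now apply is_nat_iff|]. split; [now apply is_nat_iff|]. intros p.
  rewrite in_sep by dfn. split; [tauto|]. intros H. split; [|exact H].
  destruct H as (m' & n' & k & Hm' & Hn' & Hp & _). apply is_nat_iff in Hm', Hn'.
  apply is_opair_iff in Hp. subst p. now apply pair_in_prod.
Qed.

Lemma not_slender_card (A m : M) : is_group A m -> ~ slender A m -> card_le cantor A.
Proof.
  intros HA Hns.
  assert (K : exists G phi, is_Zomega G /\ is_hom G (@Zomega_add M) A (rel2 m) phi /\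
    forall N, is_nat N -> exists x y, x ∈ G /\ y ∈ G /\ Zomega_proj N x y /\ app phi x <> app phi y).
  { apply NNPP. intros K. apply Hns. intros G HG phi Hphi. apply NNPP. intros L. apply K.
    exists G, phi. split; [exact HG|]. split; [exact Hphi|]. intros N HN. apply NNPP. intros L'.
    apply L. exists N. split; [exact HN|]. intros x y a Hx Hy Hxy.
    destruct Hphi as [Hf _]. rewrite !(fun_rel _ _ Hf).
    assert (E : app phi x = app phi y) by (apply NNPP; intros NE; apply L'; eauto 6).
    rewrite E. tauto. }
  destruct K as (G & phi & (w & Z & Hw & HZ & HG) & [Hphi Hhom] & Hbad).
  apply is_omega_iff in Hw. subst w.
  destruct (ex_addition dc) as [s Hs].
  destruct (group_unit HA) as (e & He & Hid & Hcan & _).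
  assert (Hmul : forall x y z, x ∈ G -> y ∈ G -> z ∈ G -> Zomega_add x y z ->
    app phi z = mul m (app phi x) (app phi y)).
  { intros x y z Hx Hy Hz Hadd.
    assert (R : rel2 m (app phi x) (app phi y) (app phi z)).
    { apply (Hhom x y z); auto; now apply (fun_app_rel Hphi). }
    apply (rel2_iff HA) in R. tauto. }
  (* A sequence of integers is written as a difference of two sequences of naturals; sums are then
     formed in [p] and [q] separately, and [p], [q] determine [x]. *)
  pose (rep := fun x p q => x ∈ G /\ forall i, i ∈ omega -> int_class (app x i) (app p i) (app q i)).
  assert (Hrep : forall p q, p ∈ funs omega omega -> q ∈ funs omega omega -> exists x, rep x p q).
  { intros p q Hp Hq. apply in_funs in Hp, Hq.
    destruct (@ex_fun _ _ omega Z (fun i z => int_class z (app p i) (app q i))) as (x & Hx & Ex).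
    - dfn.
    - intros i Hi. destruct (@ex_int_class (app p i) (app q i)) as (z & Hz);
        [now apply (fun_app_in Hp)|now apply (fun_app_in Hq)|]. exists z. split; [|exact Hz].
      apply HZ. eauto.
    - intros i z z' _. apply int_class_unique.
    - exists x. split; [now apply HG|exact Ex]. }
  assert (Hrepu : forall x x' p q, rep x p q -> rep x' p q -> x = x').
  { intros x x' p q [Hx Ex] [Hx' Ex']. apply HG in Hx, Hx'. apply (fun_ext Hx Hx').
    intros i Hi. apply (int_class_unique (Ex i Hi) (Ex' i Hi)). }
  assert (Hrepadd : forall x y z p q p' q' p'' q'', rep x p q -> rep y p' q' -> rep z p'' q'' ->
    (forall i, i ∈ omega -> app p'' i = plus s (app p i) (app p' i)) ->
    (forall i, i ∈ omega -> app q'' i = plus s (app q i) (app q' i)) -> Zomega_add x y z).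
  { intros x y z p q p' q' p'' q'' [Hx Ex] [Hy Ey] [Hz Ez] Hp Hq i a b c Ha Hb Hc.
    apply HG in Hx, Hy, Hz.
    apply (fun_rel _ _ Hx) in Ha as [Hi ->]. apply (fun_rel _ _ Hy) in Hb as [_ ->].
    apply (fun_rel _ _ Hz) in Hc as [_ ->].
    assert (Cx := Ex i Hi). assert (Cy := Ey i Hi). assert (Cz := Ez i Hi).
    rewrite Hp, Hq in Cz by exact Hi.
    exists (app p i), (app q i), (app p' i), (app q' i), (plus s (app p i) (app p' i)),
      (plus s (app q i) (app q' i)).
    pose proof Cx as (X1 & X2 & _). pose proof Cy as (Y1 & Y2 & _).
    rewrite is_nat_iff in X1, X2, Y1, Y2.
    split; [exact Cx|]. split; [exact Cy|].
    split; [now apply nat_add_plus|]. split; [now apply nat_add_plus|exact Cz]. }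
  (* The representing sequences are chosen, and not just the element of Z^omega, because the
     infinite sums are computed from them. *)
  pose (good := fun n t => exists p q x, t = pair p q /\ rep x p q /\ app phi x <> e /\
    forall i, i ∈ n -> app p i = empty /\ app q i = empty).
  destruct (@ac_omega _ _ dc (prod (funs omega omega) (funs omega omega)) good)
    as (t & Ht & Et).
  { unfold good, rep. dfn. }
  (* [h] and its projection [k] have different images. Replacing the first n coordinates of [h] by 0
     gives an [x] with [k] + [x] = [h], so the image of [x] cannot be the identity. *)
  { intros n Hn. destruct (Hbad n) as (h & k & Hh & Hk & Hpr & Hne); [now apply is_nat_iff|].
    pose proof Hh as Hhf. apply HG in Hhf. pose proof Hk as Hkf. apply HG in Hkf.
    (* An integer is a class of pairs; countable choice picks one representative for each coordinate
       of [h]. *)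
    destruct (@ac_omega _ _ dc (prod omega omega) (fun i c => exists a b, c = pair a b /\
      int_class (app h i) a b)) as (c & Hc & Ec).
    { dfn. }
    { intros i Hi. pose proof (fun_app_in Hhf Hi) as K. apply HZ in K as (a & b & K).
      pose proof K as (Ka & Kb & _). rewrite is_nat_iff in Ka, Kb.
      exists (pair a b). split; [now apply pair_in_prod|eauto]. }
    pose (val := fun i u v => (i ∈ n /\ v = empty) \/ (~ i ∈ n /\ v = u)).
    destruct (@ex_fun _ _ omega omega (fun i v => exists a b, app c i = pair a b /\ val i a v))
      as (p & Hp & Ep).
    { unfold val. dfn. }
    { intros i Hi. pose proof (fun_app_in Hc Hi) as K. apply in_prod in K as (a & b & Ha & Hb & K).
      destruct (classic (i ∈ n)).
      - exists empty. split; [apply zero_omega|]. exists a, b. unfold val. auto.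
      - exists a. split; [exact Ha|]. exists a, b. unfold val. auto. }
    { intros i v v' _ (a & b & K & V) (a' & b' & K' & V'). rewrite K in K'.
      apply pair_inj in K' as [<- <-]. unfold val in *. intuition congruence. }
    destruct (@ex_fun _ _ omega omega (fun i v => exists a b, app c i = pair a b /\ val i b v))
      as (q & Hq & Eq).
    { unfold val. dfn. }
    { intros i Hi. pose proof (fun_app_in Hc Hi) as K. apply in_prod in K as (a & b & Ha & Hb & K).
      destruct (classic (i ∈ n)).
      - exists empty. split; [apply zero_omega|]. exists a, b. unfold val. auto.
      - exists b. split; [exact Hb|]. exists a, b. unfold val. auto. }
    { intros i v v' _ (a & b & K & V) (a' & b' & K' & V'). rewrite K in K'.
      apply pair_inj in K' as [<- <-]. unfold val in *. intuition congruence. }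
    assert (Hpq : pair p q ∈ prod (funs omega omega) (funs omega omega)).
    { apply pair_in_prod. now rewrite !in_funs. }
    pose proof Hpq as Hpq'. apply pair_in_prod in Hpq' as [Hp' Hq'].
    destruct (Hrep p q Hp' Hq') as (x & Hx).
    exists (pair p q). split; [exact Hpq|]. exists p, q, x. split; [reflexivity|].
    split; [exact Hx|]. split.
    - intros Ephi. apply Hne.
      rewrite (Hmul k x h Hk (proj1 Hx) Hh), Ephi; [apply Hid; now apply (fun_app_in Hphi)|].
      intros i a b c' Hra Hrb Hrc.
      pose proof Hra as Ha. apply (fun_rel _ _ Hkf) in Ha as [Hi Ha].
      pose proof Hx as [HxG Ex]. apply HG in HxG.
      apply (fun_rel _ _ HxG) in Hrb as [_ ->].
      destruct (Ec i Hi) as (u & v & Ecu & Huv).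
      pose proof Huv as (Hu & Hv & _). rewrite is_nat_iff in Hu, Hv.
      destruct (Ep i Hi) as (u' & v' & Epi & Vp). rewrite Ecu in Epi. apply pair_inj in Epi as [<- <-].
      destruct (Eq i Hi) as (u' & v' & Eqi & Vq). rewrite Ecu in Eqi. apply pair_inj in Eqi as [<- <-].
      assert (Cx := Ex i Hi).
      destruct (Hpr i c' a Hrc Hra) as [Pin Pout].
      apply (fun_rel _ _ Hhf) in Hrc as [_ ->].
      destruct (classic (i ∈ n)) as [Hin|Hin].
      + rewrite (Pin Hin). assert (E1 : app p i = empty) by (destruct Vp; tauto).
        assert (E2 : app q i = empty) by (destruct Vq; tauto).
        rewrite E1, E2 in Cx. exists u, v, empty, empty, u, v.
        split; [exact Huv|]. split; [exact Cx|].
        split; [rewrite <- (plus_0 Hs Hu) at 2; apply nat_add_plus; auto using zero_omega|].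
        split; [rewrite <- (plus_0 Hs Hv) at 2; apply nat_add_plus; auto using zero_omega|exact Huv].
      + assert (E1 : app p i = u) by (destruct Vp; tauto).
        assert (E2 : app q i = v) by (destruct Vq; tauto). rewrite E1, E2 in Cx.
        destruct (Pout Hin) as (o & Ho & Hoo). apply is_empty_iff in Ho. subst o.
        exists empty, empty, u, v, u, v.
        split; [exact Hoo|]. split; [exact Cx|].
        split; [rewrite <- (plus_0_l Hs Hu) at 2; apply nat_add_plus; auto using zero_omega|].
        split; [rewrite <- (plus_0_l Hs Hv) at 2; apply nat_add_plus; auto using zero_omega|exact Huv].
    - intros i Hi. assert (Hio : i ∈ omega) by exact (omega_trans Hn Hi). split.
      + destruct (Ep i Hio) as (u & v & _ & [[_ V]|[V _]]); tauto.
      + destruct (Eq i Hio) as (u & v & _ & [[_ V]|[V _]]); tauto. }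
  destruct (@ex_fun _ _ omega (funs omega omega) (fun n p => exists q, app t n = pair p q))
    as (p & Hp & Ep).
  { dfn. }
  { intros n Hn. pose proof (fun_app_in Ht Hn) as K. apply in_prod in K as (a & b & Ha & _ & K). eauto. }
  { intros n a a' _ (b & E) (b' & E'). rewrite E in E'. now apply pair_inj in E' as [-> _]. }
  destruct (@ex_fun _ _ omega (funs omega omega) (fun n q => app t n = pair (app p n) q))
    as (q & Hq & Eq).
  { dfn. }
  { intros n Hn. destruct (Ep n Hn) as (b & E). exists b. split; [|exact E].
    pose proof (fun_app_in Ht Hn) as K. rewrite E in K. now apply pair_in_prod in K. }
  { intros n a a' _ E E'. rewrite E in E'. now apply pair_inj in E' as [_ ->]. }
  assert (Hgood : forall n, n ∈ omega -> exists x, rep x (app p n) (app q n) /\ app phi x <> e /\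
    forall i, i ∈ n -> app (app p n) i = empty /\ app (app q n) i = empty).
  { intros n Hn. destruct (Et n Hn) as (p' & q' & x & E & K). rewrite Eq in E by exact Hn.
    apply pair_inj in E as [-> ->]. eauto. }
  destruct (ex_subsums dc Hs Hp) as (Tp & HTp & ETp).
  { intros n i Hn Hi. destruct (Hgood n Hn) as (x & _ & _ & K). now apply K. }
  destruct (ex_subsums dc Hs Hq) as (Tq & HTq & ETq).
  { intros n i Hn Hi. destruct (Hgood n Hn) as (x & _ & _ & K). now apply K. }
  destruct (@ex_fun _ _ cantor A (fun x v => exists g, rep g (app Tp x) (app Tq x) /\ v = app phi g))
    as (f & Hf & Ef).
  { unfold rep. dfn. }
  { intros x Hx. destruct (Hrep (app Tp x) (app Tq x)) as (g & Hg);
      [now apply (fun_app_in HTp)|now apply (fun_app_in HTq)|].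
    exists (app phi g). split; [apply (fun_app_in Hphi), Hg|eauto]. }
  { intros x v v' _ (g & Hg & ->) (g' & Hg' & ->). now rewrite (Hrepu _ _ _ _ Hg Hg'). }
  (* Switching bit n from 0 to 1 adds the n-th chosen element; if the values were equal, cancelling
     the image of [gx] would send that element to the identity. *)
  apply (card_le_switch dc bp Hf). intros x y n Hx Hy Hn Ex Ey Exy E.
  destruct (Ef x Hx) as (gx & Hgx & Efx). destruct (Ef y Hy) as (gy & Hgy & Efy).
  destruct (Hgood n Hn) as (g & Hg & Hge & _). apply Hge.
  assert (Hadd : Zomega_add gx g gy).
  { apply (Hrepadd _ _ _ _ _ _ _ _ _ Hgx Hg Hgy); [now apply ETp|now apply ETq]. }
  apply Hmul in Hadd; [|apply Hgx|apply Hg|apply Hgy].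
  assert (Hgxi : app phi gx ∈ A) by (apply (fun_app_in Hphi), Hgx).
  apply (Hcan (app phi gx)); auto.
  - apply (fun_app_in Hphi), Hg.
  - rewrite (proj2 (Hid _ Hgxi)). congruence.
Qed.
End Slender.

(** * Words *)

Section Words.
Context {M : eps_structure} {zf : ZF M}.

Definition letters : M := prod omega two.

Lemma is_letter_iff (x n : M) : is_letter x n <-> n ∈ omega /\ exists e, e ∈ two /\ x = pair n e.
Proof.
  unfold is_letter. rewrite is_nat_iff. split.
  - intros (Hn & t & e & Ht & He & Hp). apply is_two_iff in Ht. subst t.
    apply is_opair_iff in Hp. eauto.
  - intros (Hn & e & He & ->). split; [exact Hn|]. exists two, e.
    now rewrite is_two_iff, is_opair_iff.
Qed.

Lemma in_letters (x : M) : x ∈ letters <-> exists n, is_letter x n.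
Proof.
  unfold letters. rewrite in_prod. split.
  - intros (n & e & Hn & He & ->). exists n. apply is_letter_iff. eauto.
  - intros (n & Hn). apply is_letter_iff in Hn as (Hn & e & He & ->). exists n, e. auto.
Qed.

Lemma letter_at_pair (R f i x : M) : letter_at (pair R f) i x <-> rel f i x.
Proof.
  split.
  - intros (R' & f' & E & H). apply is_opair_iff, pair_inj in E as [<- <-]. exact H.
  - intros H. exists R, f. now rewrite is_opair_iff.
Qed.

Lemma before_pair (R f i j : M) : before (pair R f) i j <-> rel R i j.
Proof.
  split.
  - intros (R' & f' & E & H). apply is_opair_iff, pair_inj in E as [<- <-]. exact H.
  - intros H. exists R, f. now rewrite is_opair_iff.
Qed.

Definition dom (U : M) : M := iota (fun D => is_dom U D).
(** The conditions of [is_word], expressed through [letter_at] and [before] so that the coding by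
    pairs can mostly be forgotten. The positions of a letter are only required to lie in some finite
    set, which is easier to pass on to other words. *)
Record word_facts (U : M) : Prop := {
  wf_dom : forall i, i ∈ dom U <-> exists x, letter_at U i x;
  wf_fun : forall i x x', letter_at U i x -> letter_at U i x' -> x = x';
  wf_letter : forall i x, letter_at U i x -> x ∈ letters;
  wf_before_dom : forall i j, before U i j -> i ∈ dom U /\ j ∈ dom U;
  wf_irrefl : forall i, ~ before U i i;
  wf_trans : forall i j k, before U i j -> before U j k -> before U i k;
  wf_total : forall i j, i ∈ dom U -> j ∈ dom U -> i = j \/ before U i j \/ before U j i;
  wf_finite : forall n, n ∈ omega -> exists F, is_finite F /\
    forall i x, letter_at U i x -> is_letter x n -> i ∈ F;
  wf_countable : exists g, is_injection g (dom U) omega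
}.

Lemma is_dom_dom (U D : M) : is_dom U D -> dom U = D.
Proof.
  intros H. assert (K : is_dom U (dom U)).
  { apply (iota_spec (P := fun D => is_dom U D)); [eauto|].
    intros a b Ha Hb. apply set_ext. intros i. now rewrite (Ha i), (Hb i). }
  apply set_ext. intros i. now rewrite (K i), (H i).
Qed.

Lemma word_elim (U : M) : is_word U -> word_facts U.
Proof.
  intros (D & R & f & HU & HD & (HR1 & HR2 & HR3 & HR4) & Hf & Hl & Hfin).
  apply is_opair_iff in HU. subst U. destruct (is_fun_on_fun Hf) as (Y & HY).
  assert (HDom : is_dom (pair R f) D).
  { intros i. unfold in_dom. split.
    - intros Hi. exists (app f i). apply letter_at_pair. now apply (fun_app_rel HY).
    - intros (x & Hx). apply letter_at_pair, (fun_rel _ _ HY) in Hx. tauto. }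
  pose proof (is_dom_dom HDom) as ED. split; rewrite ?ED.
  - exact HDom.
  - intros i x x'. rewrite !letter_at_pair, !(fun_rel _ _ HY). intros [_ ->] [_ ->]. reflexivity.
  - intros i x Hx. apply letter_at_pair, Hl in Hx. now apply in_letters.
  - intros i j H. apply before_pair, rel_iff in H. destruct (HR1 _ H) as (i' & j' & Hi & Hj & E).
    apply is_opair_iff, pair_inj in E as [-> ->]. auto.
  - intros i. rewrite before_pair. apply HR2.
  - intros i j k. rewrite !before_pair. apply HR3.
  - intros i j. rewrite !before_pair. apply HR4.
  - intros n Hn. destruct (Hfin n) as (F & HF & K); [now apply is_nat_iff|].
    exists F. split; [exact HF|]. intros i x Hx Hxn. apply K. exists x.
    rewrite <- letter_at_pair. eauto.
  - destruct HD as (w & Hw & g & Hg). apply is_omega_iff in Hw. subst w. eauto.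
Qed.

Lemma word_pair (U : M) : is_word U -> exists R f, U = pair R f /\
  (forall p, p ∈ R <-> exists i j, p = pair i j /\ before U i j) /\
  (forall p, p ∈ f <-> exists i x, p = pair i x /\ letter_at U i x).
Proof.
  intros (D & R & f & HU & _ & (HR & _) & Hf & _). apply is_opair_iff in HU. subst U.
  exists R, f. split; [reflexivity|]. split; intros p; split.
  - intros Hp. destruct (HR p Hp) as (i & j & _ & _ & E). apply is_opair_iff in E. subst p.
    exists i, j. now rewrite before_pair, rel_iff.
  - intros (i & j & -> & H). now apply before_pair, rel_iff in H.
  - intros Hp. destruct Hf as [Hf _]. destruct (Hf p Hp) as (i & x & _ & E).
    apply is_opair_iff in E. subst p. exists i, x. now rewrite letter_at_pair, rel_iff.
  - intros (i & x & -> & H). now apply letter_at_pair, rel_iff in H.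
Qed.

Lemma word_ext (U V : M) : is_word U -> is_word V ->
  (forall i x, letter_at U i x <-> letter_at V i x) ->
  (forall i j, before U i j <-> before V i j) -> U = V.
Proof.
  intros HU HV Hl Hb. destruct (word_pair HU) as (R & f & E & HR & Hf).
  destruct (word_pair HV) as (R' & f' & E' & HR' & Hf'). rewrite E, E'. apply pair_inj. split;
    apply set_ext; intros p.
  - rewrite HR, HR'. split; intros (i & j & -> & K); exists i, j; (split; [reflexivity|]); now apply Hb.
  - rewrite Hf, Hf'. split; intros (i & j & -> & K); exists i, j; (split; [reflexivity|]); now apply Hl.
Qed.

Lemma ex_word (D : M) (B L : M -> M -> Prop) : definable2 B -> definable2 L ->
  (exists g, is_injection g D omega) ->
  (forall i, i ∈ D -> ~ B i i) ->
  (forall i j k, i ∈ D -> j ∈ D -> k ∈ D -> B i j -> B j k -> B i k) ->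
  (forall i j, i ∈ D -> j ∈ D -> i = j \/ B i j \/ B j i) ->
  (forall i, i ∈ D -> exists x, x ∈ letters /\ L i x) ->
  (forall i x x', i ∈ D -> L i x -> L i x' -> x = x') ->
  (forall n, n ∈ omega -> exists F, is_finite F /\
    forall i x, i ∈ D -> L i x -> is_letter x n -> i ∈ F) ->
  exists W, is_word W /\ (forall i x, letter_at W i x <-> i ∈ D /\ L i x) /\
    (forall i j, before W i j <-> i ∈ D /\ j ∈ D /\ B i j).
Proof.
  intros HB HL Hc Hirr Htr Htot Hex Huniq Hfin.
  destruct (ex_fun HL Hex Huniq) as (f & Hf & Ef).
  set (R := sep (prod D D) (fun p => exists i j, p = pair i j /\ B i j)).
  assert (HR : forall i j, rel R i j <-> i ∈ D /\ j ∈ D /\ B i j).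
  { intros i j. rewrite rel_iff. unfold R. rewrite in_sep by dfn. rewrite pair_in_prod. split.
    - intros [[Hi Hj] (i' & j' & E & H)]. apply pair_inj in E as [-> ->]. auto.
    - intros (Hi & Hj & H). split; [auto|]. exists i, j. auto. }
  assert (Hlf : forall i x, rel f i x <-> i ∈ D /\ L i x).
  { intros i x. rewrite (fun_rel _ _ Hf). split.
    - intros [Hi ->]. auto.
    - intros [Hi H]. split; [exact Hi|]. apply (Huniq i); auto. }
  exists (pair R f). split; [|split].
  - exists D, R, f. rewrite is_opair_iff. split; [reflexivity|]. split.
    { exists omega. rewrite is_omega_iff. split; [reflexivity|exact Hc]. }
    split; [split; [|split; [|split]]|split; [|split]].
    + intros p Hp. unfold R in Hp. apply in_sep in Hp as [Hp _]; [|dfn].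
      apply in_prod in Hp as (i & j & Hi & Hj & ->). exists i, j. now rewrite is_opair_iff.
    + intros i H. apply HR in H as (Hi & _ & H). exact (Hirr i Hi H).
    + intros i j k. rewrite !HR. intros (Hi & Hj & H) (_ & Hk & H'). eauto 6.
    + intros i j Hi Hj. rewrite !HR. destruct (Htot i j Hi Hj) as [K|[K|K]]; auto 6.
    + apply Hf.
    + intros i x H. apply in_letters. destruct Hf as [_ Hf]. eauto.
    + intros n Hn. apply is_nat_iff in Hn. destruct (Hfin n Hn) as (F & HF & K).
      exists (sep F (fun i => exists x, rel f i x /\ is_letter x n)). split.
      * apply (fin_sub HF). intros i Hi. apply in_sep in Hi; [tauto|dfn].
      * intros i. rewrite in_sep by dfn. split; [tauto|]. intros H. split; [|exact H].
        destruct H as (x & Hx & Hxn). apply Hlf in Hx as [Hi Hx]. eauto.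
  - intros i x. rewrite letter_at_pair. apply Hlf.
  - intros i j. rewrite before_pair. apply HR.
Qed.

Lemma word_letter_dom (U i x : M) : is_word U -> letter_at U i x -> i ∈ dom U.
Proof. intros HU Hx. apply (wf_dom (word_elim HU)). eauto. Qed.

Lemma ex_restriction (U : M) (P : M -> Prop) : is_word U -> definable1 P ->
  exists V, is_restriction U P V.
Proof.
  intros HU HP. pose proof (word_elim HU) as F.
  set (D := sep (dom U) P).
  assert (HD : forall i, i ∈ D <-> i ∈ dom U /\ P i)
    by (intros i; unfold D; rewrite in_sep by dfn; reflexivity).
  destruct (@ex_word D (fun i j => before U i j) (fun i x => letter_at U i x)) as (V & HV & Vl & Vb).
  - dfn.
  - dfn.
  - destruct (wf_countable F) as (g & Hg).
    destruct (@ex_fun _ _ D omega (fun i v => v = app g i)) as (h & Hh & Eh); [dfn| |congruence|].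
    + intros i Hi. apply HD in Hi as [Hi _]. exists (app g i). split; [|reflexivity].
      now apply (fun_app_in (proj1 Hg)).
    + exists h. apply injection_intro; [exact Hh|]. intros i j Hi Hj. rewrite !Eh by assumption.
      apply HD in Hi as [Hi _], Hj as [Hj _]. now apply (injection_app Hg).
  - intros i _. apply (wf_irrefl F).
  - intros i j k _ _ _. apply (wf_trans F).
  - intros i j Hi Hj. apply HD in Hi as [Hi _], Hj as [Hj _]. now apply (wf_total F).
  - intros i Hi. apply HD in Hi as [Hi _]. apply (wf_dom F) in Hi as (x & Hx).
    exists x. split; [eapply wf_letter; eauto|exact Hx].
  - intros i x x' _. apply (wf_fun F).
  - intros n Hn. destruct (wf_finite F Hn) as (E & HE & K). exists E. eauto.
  - exists V. split; [exact HV|]. split.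
    + intros i x. rewrite Vl, HD. split; [tauto|]. intros [Hx Hp]. split; [|exact Hx].
      split; [exact (word_letter_dom HU Hx)|exact Hp].
    + intros i j. rewrite Vb, !HD. split; [tauto|]. intros (H & Hi & Hj).
      pose proof (wf_before_dom F H). tauto.
Qed.

Lemma restriction_unique (U V V' : M) (P P' : M -> Prop) :
  is_restriction U P V -> is_restriction U P' V' ->
  (forall i x, letter_at U i x -> (P i <-> P' i)) -> is_word U -> V = V'.
Proof.
  intros (HV & Vl & Vb) (HV' & Vl' & Vb') HP HU. pose proof (word_elim HU) as F.
  apply word_ext; auto.
  - intros i x. rewrite Vl, Vl'. split; intros [Hx Hi]; (split; [exact Hx|]); eapply HP; eauto.
  - assert (HPd : forall i, i ∈ dom U -> (P i <-> P' i)).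
    { intros i Hi. apply (wf_dom F) in Hi as (x & Hx). eauto. }
    intros i j. rewrite Vb, Vb'.
    split; intros (H & Hi & Hj); destruct (wf_before_dom F H) as [Di Dj];
      apply HPd in Hi; auto; apply HPd in Hj; auto.
Qed.

Lemma restriction_sub (U V W : M) (P Q : M -> Prop) :
  is_restriction U P V -> is_restriction U Q W ->
  (forall i x, letter_at U i x -> Q i -> P i) -> is_word U -> is_restriction V Q W.
Proof.
  intros (HV & Vl & Vb) (HW & Wl & Wb) HPQ HU. pose proof (word_elim HU) as F.
  assert (HPd : forall i, i ∈ dom U -> Q i -> P i).
  { intros i Hi. apply (wf_dom F) in Hi as (x & Hx). eauto. }
  split; [exact HW|]. split.
  - intros i x. rewrite Vl, Wl. split; [intros [H K]; eauto|tauto].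
  - intros i j. rewrite Vb, Wb. split; [|tauto]. intros (H & Hi & Hj).
    destruct (wf_before_dom F H) as [Di Dj]. auto 6.
Qed.

Lemma restriction_ext (U V : M) (P Q : M -> Prop) :
  is_restriction U P V -> (forall i x, letter_at U i x -> (P i <-> Q i)) -> is_word U ->
  is_restriction U Q V.
Proof.
  intros (HV & Vl & Vb) HPQ HU. pose proof (word_elim HU) as F.
  assert (HPd : forall i, i ∈ dom U -> (P i <-> Q i)).
  { intros i Hi. apply (wf_dom F) in Hi as (x & Hx). eauto. }
  split; [exact HV|]. split.
  - intros i x. rewrite Vl. split; intros [H K]; (split; [exact H|]); eapply HPQ; eauto.
  - intros i j. rewrite Vb.
    split; intros (H & Hi & Hj); destruct (wf_before_dom F H) as [Di Dj];
      (split; [exact H|]); split; apply HPd; auto.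
Qed.

Lemma restriction_self (U : M) (P : M -> Prop) : is_word U ->
  (forall i x, letter_at U i x -> P i) -> is_restriction U P U.
Proof.
  intros HU HP. pose proof (word_elim HU) as F.
  assert (HPd : forall i, i ∈ dom U -> P i).
  { intros i Hi. apply (wf_dom F) in Hi as (x & Hx). eauto. }
  split; [exact HU|]. split.
  - intros i x. split; [eauto|tauto].
  - intros i j. split; [|tauto]. intros H. destruct (wf_before_dom F H). auto.
Qed.

Lemma word_iso_intro (U V f : M) : is_word U -> is_word V -> is_bijection f (dom U) (dom V) ->
  (forall i j, i ∈ dom U -> j ∈ dom U -> (before U i j <-> before V (app f i) (app f j))) ->
  (forall i x, i ∈ dom U -> (letter_at U i x <-> letter_at V (app f i) x)) -> word_iso U V.
Proof.
  intros HU HV Hf Hb Hl. pose proof Hf as [[Hff _] _].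
  exists (dom U), (dom V), f. split; [exact (wf_dom (word_elim HU))|].
  split; [exact (wf_dom (word_elim HV))|]. split; [exact Hf|]. split.
  - intros i j i' j' Hi Hj. apply (fun_rel _ _ Hff) in Hi as [Hi ->], Hj as [Hj ->]. auto.
  - intros i i' x Hi. apply (fun_rel _ _ Hff) in Hi as [Hi ->]. auto.
Qed.

Lemma word_iso_elim (U V : M) : word_iso U V -> exists f, is_bijection f (dom U) (dom V) /\
  (forall i j, i ∈ dom U -> j ∈ dom U -> (before U i j <-> before V (app f i) (app f j))) /\
  (forall i x, i ∈ dom U -> (letter_at U i x <-> letter_at V (app f i) x)).
Proof.
  intros (D & E & f & HD & HE & Hf & Hb & Hl). rewrite (is_dom_dom HD), (is_dom_dom HE).
  pose proof Hf as [[Hff _] _]. exists f. split; [exact Hf|]. split.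
  - intros i j Hi Hj. apply Hb; now apply (fun_app_rel Hff).
  - intros i x Hi. apply Hl. now apply (fun_app_rel Hff).
Qed.

Lemma word_iso_sym (U V : M) : is_word U -> is_word V -> word_iso U V -> word_iso V U.
Proof.
  intros HU HV H. apply word_iso_elim in H as (f & Hf & Hb & Hl). pose proof Hf as [[Hff _] _].
  destruct (@ex_fun _ _ (dom V) (dom U) (fun j i => i ∈ dom U /\ app f i = j)) as (g & Hg & Eg).
  - dfn.
  - intros j Hj. destruct (bijection_surj Hf Hj) as (i & Hi & E). eauto.
  - intros j i i' _ [Hi E] [Hi' E']. apply (injection_app (proj1 Hf)); auto. congruence.
  - apply (@word_iso_intro V U g HV HU).
    + apply bijection_intro; [exact Hg| |].
      * intros j j' Hj Hj' E. destruct (Eg j Hj) as [_ <-], (Eg j' Hj') as [_ <-]. now rewrite E.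
      * intros i Hi. pose proof (fun_app_in Hff Hi) as K. exists (app f i). split; [exact K|].
        destruct (Eg _ K) as [K1 K2]. now apply (injection_app (proj1 Hf)).
    + intros j j' Hj Hj'. destruct (Eg j Hj) as [Hi Ei], (Eg j' Hj') as [Hi' Ei'].
      rewrite (Hb _ _ Hi Hi'), Ei, Ei'. reflexivity.
    + intros j x Hj. destruct (Eg j Hj) as [Hi Ei]. rewrite (Hl _ x Hi), Ei. reflexivity.
Qed.

(** Renaming of positions. It moves domains into omega, tags the two factors of a concatenation, and
    identifies a factor of an infinite concatenation with the original word. *)
Lemma ex_transport (U g Y : M) : is_word U -> is_injection g (dom U) Y ->
  exists V, is_word V /\ word_iso U V /\
    (forall k x, letter_at V k x <-> exists i, k = app g i /\ letter_at U i x) /\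
    (forall k l, before V k l <-> exists i j, k = app g i /\ l = app g j /\ before U i j).
Proof.
  intros HU Hg. pose proof (word_elim HU) as F. pose proof Hg as [Hgf _].
  set (E := sep Y (fun k => exists i, i ∈ dom U /\ k = app g i)).
  assert (HE : forall k, k ∈ E <-> exists i, i ∈ dom U /\ k = app g i).
  { intros k. unfold E. rewrite in_sep by dfn. split; [tauto|]. intros H. split; [|exact H].
    destruct H as (i & Hi & ->). now apply (fun_app_in Hgf). }
  assert (Gi : forall i i', i ∈ dom U -> i' ∈ dom U -> app g i = app g i' -> i = i')
    by (intros i i'; exact (injection_app Hg)).
  assert (Ld : forall i x, letter_at U i x -> i ∈ dom U) by (intros i x; now apply word_letter_dom).
  destruct (@ex_word E
    (fun k l => exists i j, k = app g i /\ l = app g j /\ before U i j)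
    (fun k x => exists i, k = app g i /\ letter_at U i x)) as (V & HV & Vl & Vb).
  - dfn.
  - dfn.
  - destruct (wf_countable F) as (c & Hc).
    destruct (@ex_fun _ _ E omega (fun k v => exists i, i ∈ dom U /\ k = app g i /\ v = app c i))
      as (h & Hh & Eh).
    + dfn.
    + intros k Hk. apply HE in Hk as (i & Hi & ->). exists (app c i).
      split; [now apply (fun_app_in (proj1 Hc))|eauto].
    + intros k v v' _ (i & Hi & -> & ->) (i' & Hi' & K & ->). now rewrite (Gi _ _ Hi Hi' K).
    + exists h. apply injection_intro; [exact Hh|]. intros k l Hk Hl K.
      destruct (Eh k Hk) as (i & Hi & -> & Ei). destruct (Eh l Hl) as (j & Hj & -> & Ej).
      f_equal. apply (injection_app Hc); congruence.
  - intros k _ (i & j & -> & K & H). destruct (wf_before_dom F H) as [Di Dj].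
    apply Gi in K; auto. subst j. exact (wf_irrefl F H).
  - intros k1 k2 k3 _ _ _ (i & j & -> & -> & H) (j' & l & K & -> & H').
    destruct (wf_before_dom F H) as [Di Dj]. destruct (wf_before_dom F H') as [Dj' Dl].
    apply Gi in K; auto. subst j'. exists i, l. split; [reflexivity|]. split; [reflexivity|].
    exact (wf_trans F H H').
  - intros k l Hk Hl. apply HE in Hk as (i & Hi & ->). apply HE in Hl as (j & Hj & ->).
    destruct (wf_total F Hi Hj) as [->|[K|K]]; [auto| |].
    + right; left. exists i, j. auto.
    + right; right. exists j, i. auto.
  - intros k Hk. apply HE in Hk as (i & Hi & ->). apply (wf_dom F) in Hi as (x & Hx).
    exists x. split; [eapply wf_letter; eauto|eauto].
  - intros k x x' _ (i & -> & Hx) (i' & K & Hx'). apply Gi in K; [|eauto|eauto]. subst i'.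
    exact (wf_fun F Hx Hx').
  - intros n Hn. destruct (wf_finite F Hn) as (Fn & HFn & K).
    exists (sep E (fun k => exists i, i ∈ Fn /\ k = app g i)). split.
    + apply (@fin_image _ _ (fun i k => k = app g i) Fn); [dfn|congruence|exact HFn|].
      intros k Hk. apply in_sep in Hk; [tauto|dfn].
    + intros k x Hk (i & -> & Hx) Hxn. apply in_sep; [dfn|]. split; [exact Hk|]. eauto.
  - assert (Vl' : forall k x, letter_at V k x <-> exists i, k = app g i /\ letter_at U i x).
    { intros k x. rewrite Vl. split; [tauto|]. intros H. split; [|exact H].
      destruct H as (i & -> & Hx). apply HE. eauto. }
    assert (Vb' : forall k l, before V k l <-> exists i j, k = app g i /\ l = app g j /\ before U i j).
    { intros k l. rewrite Vb. split; [tauto|]. intros H.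
      pose proof H as (i & j & -> & -> & K). destruct (wf_before_dom F K) as [Di Dj].
      split; [apply HE; eauto|]. split; [apply HE; eauto|exact H]. }
    assert (Dv : forall k, k ∈ dom V <-> k ∈ E).
    { intros k. rewrite (wf_dom (word_elim HV)), HE. split.
      - intros (x & Hx). apply Vl' in Hx as (i & -> & Hx). eauto.
      - intros (i & Hi & ->). apply (wf_dom F) in Hi as (x & Hx). exists x. apply Vl'. eauto. }
    exists V. split; [exact HV|]. split; [|auto].
    destruct (@ex_fun _ _ (dom U) (dom V) (fun i k => k = app g i)) as (h & Hh & Eh);
      [dfn| |congruence|].
    { intros i Hi. exists (app g i). split; [|reflexivity]. apply Dv, HE. eauto. }
    apply (@word_iso_intro U V h HU HV).
    + apply bijection_intro; [exact Hh| |].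
      * intros i i' Hi Hi'. rewrite !Eh by assumption. auto.
      * intros k Hk. apply Dv, HE in Hk as (i & Hi & ->). exists i. auto.
    + intros i j Hi Hj. rewrite !Eh, Vb' by assumption. split.
      * intros H. exists i, j. auto.
      * intros (i' & j' & K & K' & H). destruct (wf_before_dom F H) as [Di Dj].
        apply Gi in K, K'; auto. now subst.
    + intros i x Hi. rewrite !Eh, Vl' by assumption. split.
      * intros H. exists i. auto.
      * intros (i' & K & H). apply Gi in K; [|eauto|eauto]. now subst.
Qed.

(** * Projections, free equality and the classes of words *)

Lemma low_positions_finite (U N : M) : is_word U -> N ∈ omega -> exists F, is_finite F /\
  forall i x, letter_at U i x -> letter_upto N x -> i ∈ F.
Proof.
  intros HU HN. pose proof (wf_finite (word_elim HU)) as Hfin. nat_induct HN; [dfn| |].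
  - destruct (Hfin empty zero_omega) as (F & HF & K). exists F. split; [exact HF|].
    intros i x Hx (n & Hxn & [H| ->]); [now apply in_empty in H|eauto].
  - intros N HN (F & HF & K). destruct (Hfin (succ N) (succ_omega HN)) as (F' & HF' & K').
    exists (cup F F'). split; [now apply fin_cup|]. intros i x Hx (n & Hxn & H). apply in_cup.
    destruct H as [H| ->]; [|eauto]. apply in_succ in H. left. apply (K i x Hx). exists n. auto.
Qed.

Lemma ex_word_proj (N U : M) : is_word U -> exists V, word_proj N U V.
Proof. intros HU. apply ex_restriction; [exact HU|]. dfn. Qed.

Lemma word_proj_finite (N U V : M) : is_word U -> N ∈ omega -> word_proj N U V ->
  is_finite_word N V.
Proof.
  intros HU HN (HV & Vl & Vb). split; [exact HV|].
  assert (Low : forall i x, letter_at V i x -> letter_at U i x /\ letter_upto N x).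
  { intros i x Hx. apply Vl in Hx as (Hx & x' & Hx' & H). split; [exact Hx|].
    now rewrite (wf_fun (word_elim HU) Hx Hx'). }
  split; [|intros i x Hx; exact (proj2 (Low i x Hx))].
  destruct (low_positions_finite HU HN) as (F & HF & K).
  exists (dom V). split; [exact (wf_dom (word_elim HV))|]. apply (fin_sub HF).
  intros i Hi. apply (wf_dom (word_elim HV)) in Hi as (x & Hx). apply Low in Hx as [Hx Hl]. eauto.
Qed.

Lemma word_iso_proj (N U V U' V' : M) : is_word U -> is_word V -> word_iso U V ->
  word_proj N U U' -> word_proj N V V' -> word_iso U' V'.
Proof.
  intros HU HV Hiso (HU' & Ul & Ub) (HV' & Vl & Vb).
  apply word_iso_elim in Hiso as (f & Hf & Hb & Hl). pose proof Hf as [[Hff _] _].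
  pose proof (wf_dom (word_elim HU')) as DU'. pose proof (wf_dom (word_elim HV')) as DV'.
  pose (low := fun U i => exists x, letter_at U i x /\ letter_upto N x).
  assert (DU : forall i, i ∈ dom U' <-> i ∈ dom U /\ low U i).
  { intros i. rewrite DU'. split.
    - intros (x & Hx). apply Ul in Hx as [Hx H]. split; [exact (word_letter_dom HU Hx)|exact H].
    - intros [_ (x & Hx & H)]. exists x. apply Ul. eauto. }
  assert (DV : forall i, i ∈ dom V' <-> i ∈ dom V /\ low V i).
  { intros i. rewrite DV'. split.
    - intros (x & Hx). apply Vl in Hx as [Hx H]. split; [exact (word_letter_dom HV Hx)|exact H].
    - intros [_ (x & Hx & H)]. exists x. apply Vl. eauto. }
  assert (LL : forall i, i ∈ dom U -> (low U i <-> low V (app f i))).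
  { intros i Hi. unfold low. split; intros (x & Hx & H); exists x; (split; [|exact H]);
      now apply Hl. }
  destruct (@ex_fun _ _ (dom U') (dom V') (fun i k => k = app f i)) as (h & Hh & Eh);
    [dfn| |congruence|].
  { intros i Hi. exists (app f i). split; [|reflexivity]. apply DU in Hi as [Hi K]. apply DV.
    split; [now apply (fun_app_in Hff)|now apply LL]. }
  apply (@word_iso_intro U' V' h HU' HV').
  - apply bijection_intro; [exact Hh| |].
    + intros i i' Hi Hi'. rewrite !Eh by assumption. apply DU in Hi as [Hi _], Hi' as [Hi' _].
      now apply (injection_app (proj1 Hf)).
    + intros k Hk. apply DV in Hk as [Hk K]. destruct (bijection_surj Hf Hk) as (i & Hi & <-).
      assert (Hi' : i ∈ dom U') by (apply DU; split; [exact Hi|now apply LL]).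
      exists i. auto.
  - intros i j Hi Hj. rewrite !Eh, Ub, Vb by assumption. apply DU in Hi as [Hi Li], Hj as [Hj Lj].
    rewrite <- (Hb i j Hi Hj). fold (low U i) (low U j) (low V (app f i)) (low V (app f j)).
    rewrite <- !LL by assumption. reflexivity.
  - intros i x Hi. rewrite !Eh, Ul, Vl by assumption. apply DU in Hi as [Hi Li].
    rewrite <- (Hl i x Hi). fold (low U i) (low V (app f i)). rewrite <- LL by assumption. reflexivity.
Qed.

(** Lengthening a chain at its front is what transfers [word_sim] along an isomorphism: the old
    chain is shifted by one index and [X] becomes its new first term. *)
Lemma free_eq_prepend (N X Y Z : M) : is_finite_word N X -> free_step X Y -> free_eq N Y Z ->
  free_eq N X Z.
Proof.
  intros HX Hstep (k & sk & s & z & Hk & Hsk & Hz & Hs & Hfw & Hs0 & Hsk' & Hss).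
  apply is_nat_iff in Hk. apply is_succ_iff in Hsk. apply is_empty_iff in Hz. subst sk z.
  destruct (is_fun_on_fun Hs) as (E & HE).
  apply (fun_rel _ _ HE) in Hs0 as [H0 ->]. apply (fun_rel _ _ HE) in Hsk' as [Hkk ->].
  destruct (@ex_fun _ _ (succ (succ k)) (add E X)
    (fun j v => (j = empty /\ v = X) \/ exists i, i ∈ succ k /\ j = succ i /\ v = app s i))
    as (t & Ht & Et).
  - dfn.
  - intros j Hj. destruct (@nat_cases _ _ j) as [->|(i & Hi & ->)].
    + exact (omega_trans (succ_omega (succ_omega Hk)) Hj).
    + exists X. rewrite in_add. auto.
    + assert (Hik : i ∈ succ k).
      { destruct (nat_total Hi (succ_omega Hk)) as [K|[K|K]]; [exact K| |].
        - exfalso. subst i. now apply nat_irrefl in Hj; auto using succ_omega.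
        - exfalso. apply succ_in_succ in K; [|exact Hi].
          exact (nat_asym (succ_omega Hi) K Hj). }
      exists (app s i). rewrite in_add. split; [left; now apply (fun_app_in HE)|eauto].
  - intros j v v' _ [[-> ->]|(i & Hi & -> & ->)] [[K ->]|(i' & Hi' & K & ->)].
    + reflexivity.
    + exfalso. symmetry in K. exact (succ_neq_empty K).
    + exfalso. exact (succ_neq_empty K).
    + apply succ_inj in K; [now subst|exact (omega_trans (succ_omega Hk) Hi)|
        exact (omega_trans (succ_omega Hk) Hi')].
  - assert (T0 : app t empty = X).
    { destruct (Et empty) as [[_ K]|(i & _ & K & _)]; [now apply empty_in_succ, succ_omega|exact K|].
      exfalso. symmetry in K. exact (succ_neq_empty K). }
    assert (TS : forall i, i ∈ succ k -> app t (succ i) = app s i).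
    { intros i Hi. assert (Hio : i ∈ omega) by exact (omega_trans (succ_omega Hk) Hi).
      destruct (Et (succ i)) as [[K _]|(i' & Hi' & K & ->)].
      - apply succ_in_succ; [now apply succ_omega|exact Hi].
      - exfalso. exact (succ_neq_empty K).
      - apply succ_inj in K; [now subst|exact Hio|]. exact (omega_trans (succ_omega Hk) Hi'). }
    exists (succ k), (succ (succ k)), t, empty.
    rewrite is_nat_iff, is_succ_iff, is_empty_iff.
    split; [now apply succ_omega|]. split; [reflexivity|]. split; [reflexivity|].
    split; [apply Ht|]. split; [|split; [|split]].
    + intros j W Hr. apply (fun_rel _ _ Ht) in Hr as [Hj ->].
      destruct (Et j Hj) as [[_ ->]|(i & Hi & _ & ->)]; [exact HX|].
      apply (Hfw i). now apply (fun_app_rel HE).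
    + apply (fun_rel _ _ Ht). split; [now apply empty_in_succ, succ_omega|auto].
    + apply (fun_rel _ _ Ht). split; [apply in_succ; auto|]. symmetry. apply TS, in_succ. auto.
    + intros j sj W W' Hj Hsj Hr Hr'. apply is_succ_iff in Hsj. subst sj.
      apply (fun_rel _ _ Ht) in Hr as [_ ->]. apply (fun_rel _ _ Ht) in Hr' as [_ ->].
      rewrite (TS j Hj). destruct (Et j) as [[-> ->]|(i & Hi & -> & ->)]; [apply in_succ; auto|exact Hstep|].
      assert (Hio : i ∈ omega) by exact (omega_trans (succ_omega Hk) Hi).
      assert (Hik : i ∈ k).
      { destruct (nat_total Hio Hk) as [K|[K|K]]; [exact K| |]; exfalso.
        - subst i. now apply nat_irrefl in Hj; auto using succ_omega.
        - apply succ_in_succ in K; [|exact Hio]. exact (nat_asym (succ_omega Hio) K Hj). }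
      apply (Hss i (succ i)); [exact Hik|now apply is_succ_iff| |];
        apply (fun_app_rel HE); assumption.
Qed.

(** Projections of isomorphic words are isomorphic, and an isomorphism counts as one elementary
    step. *)
Lemma word_sim_iso (U V W : M) : is_word U -> is_word V -> word_iso U V ->
  word_sim U W -> word_sim V W.
Proof.
  intros HU HV Hiso H N HN V' W' HV' HW'. pose proof HN as HNo. apply is_nat_iff in HNo.
  destruct (ex_word_proj N HU) as (U' & HU').
  apply (free_eq_prepend (Y := U')).
  - exact (word_proj_finite HV HNo HV').
  - left. apply (word_iso_proj HV HU (word_iso_sym HU HV Hiso) HV' HU').
  - exact (H N HN U' W' HU' HW').
Qed.

(** A set containing every word with domain inside omega: it bounds the separation that forms the
    classes, and countable choice of words takes place in it. *)
Definition nat_words : M := prod (power (prod omega omega)) (power (prod omega letters)).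

Lemma in_nat_words (U : M) : is_word U -> (forall i, in_dom U i -> is_nat i) -> U ∈ nat_words.
Proof.
  intros HU Hn. pose proof (word_elim HU) as F.
  assert (Hd : forall i, i ∈ dom U -> i ∈ omega).
  { intros i Hi. apply is_nat_iff, Hn. now apply (wf_dom F). }
  destruct (word_pair HU) as (R & f & E & HR & Hf). rewrite E. unfold nat_words.
  apply pair_in_prod. split; apply in_power; intros p Hp.
  - apply HR in Hp as (i & j & -> & H). destruct (wf_before_dom F H). apply pair_in_prod. auto.
  - apply Hf in Hp as (i & x & -> & H). apply pair_in_prod. split; [|eapply wf_letter; eauto].
    apply Hd. exact (word_letter_dom HU H).
Qed.

Lemma heg_class_unique (h h' U : M) : heg_class h U -> heg_class h' U -> h = h'.
Proof. intros [_ H] [_ H']. apply set_ext. intros V. now rewrite H, H'. Qed.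

Lemma ex_heg_class (U : M) : is_word U -> exists h, heg_class h U.
Proof.
  intros HU. exists (sep nat_words (fun V => is_word V /\ (forall i, in_dom V i -> is_nat i) /\
    word_sim U V)).
  split; [exact HU|]. intros V. rewrite in_sep by dfn. split; [tauto|]. intros H.
  split; [|exact H]. now apply in_nat_words.
Qed.

Lemma heg_class_iso (h U V : M) : is_word V -> word_iso U V -> heg_class h U -> heg_class h V.
Proof.
  intros HV Hiso [HU H]. split; [exact HV|]. intros W. rewrite H.
  split; intros (HW & Hd & Hs); (split; [exact HW|]); (split; [exact Hd|]).
  - exact (word_sim_iso HU HV Hiso Hs).
  - exact (word_sim_iso HV HU (word_iso_sym HU HV Hiso) Hs).
Qed.
End Words.

(** * The Hawaiian earring group *)

Section HEG.
Context {M : eps_structure} {zf : ZF M}.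
Variables G H m phi : M.
Hypothesis HG : is_HEG G.
Hypothesis HH : is_group H m.
Hypothesis Hphi : is_hom G (@heg_mul M) H (rel2 m) phi.

(** Evaluating [phi] on words rather than on classes reduces all computations in HEG to cutting
    words into pieces. *)
Definition value (phi U : M) : M := app phi (iota (fun h => heg_class h U)).
Lemma value_class (h U : M) : heg_class h U -> value phi U = app phi h /\ h ∈ G.
Proof.
  intros Hh. assert (K : heg_class (iota (fun h => heg_class h U)) U).
  { apply (iota_spec (P := fun h => heg_class h U)); [eauto|].
    intros a b. apply heg_class_unique. }
  split; [|apply HG; eauto]. unfold value. now rewrite (heg_class_unique Hh K).
Qed.

Lemma value_in (U : M) : is_word U -> value phi U ∈ H.
Proof.
  intros HU. destruct (ex_heg_class HU) as (h & Hh). destruct (value_class Hh) as [-> K].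
  destruct Hphi as [Hf _]. now apply (fun_app_in Hf).
Qed.

Lemma value_iso (U V : M) : is_word U -> is_word V -> word_iso U V -> value phi U = value phi V.
Proof.
  intros HU HV Hiso. destruct (ex_heg_class HU) as (h & Hh).
  destruct (value_class Hh) as [-> _]. apply (heg_class_iso HV Hiso) in Hh.
  destruct (value_class Hh) as [-> _]. reflexivity.
Qed.

(** The homomorphism property in the form in which it is applied: all pieces are restrictions of one
    ambient word [U], so no nested disjoint unions arise. [Z] is isomorphic to the literal
    concatenation of [X] and [Y]. *)
Lemma value_cut (U X Y Z : M) (P Q R : M -> Prop) : is_word U -> definable1 P -> definable1 Q ->
  is_restriction U P X -> is_restriction U Q Y -> is_restriction U R Z ->
  (forall i x, letter_at U i x -> (R i <-> P i \/ Q i)) ->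
  (forall i j x y, letter_at U i x -> letter_at U j y -> P i -> Q j -> before U i j) ->
  value phi Z = mul m (value phi X) (value phi Y).
Proof.
  intros HU HP HQ (HX & Xl & Xb) (HY & Yl & Yb) (HZ & Zl & Zb) HR HPQ.
  pose proof (word_elim HU) as F.
  assert (HPQn : forall i x, letter_at U i x -> P i -> Q i -> False).
  { intros i x Hx Hp Hq. exact (wf_irrefl F (HPQ _ _ _ _ Hx Hx Hp Hq)). }
  assert (DZ : forall i, i ∈ dom Z -> exists x, letter_at U i x /\ R i).
  { intros i Hi. apply (wf_dom (word_elim HZ)) in Hi as (x & Hx). apply Zl in Hx. eauto. }
  assert (H10 := one_neq_zero).
  (* Positions in [P] are tagged with 0 and the others with 1, exactly as in the disjoint union of
     [is_concat]. *)
  destruct (@ex_fun _ _ (dom Z) (prod two (dom Z))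
    (fun i k => (P i /\ k = pair empty i) \/ (~ P i /\ k = pair one i))) as (g & Hg & Eg).
  { unfold one. dfn. }
  { intros i Hi. destruct (classic (P i)).
    - exists (pair empty i). rewrite pair_in_prod, in_two. auto 6.
    - exists (pair one i). rewrite pair_in_prod, in_two. auto 6. }
  { intros i k k' _. intuition congruence. }
  assert (Gp : forall i x, letter_at Z i x -> P i -> app g i = pair empty i).
  { intros i x Hx Hp. destruct (Eg i); [exact (word_letter_dom HZ Hx)|tauto|tauto]. }
  assert (Gq : forall i x, letter_at Z i x -> Q i -> app g i = pair one i).
  { intros i x Hx Hq. destruct (Eg i) as [[Hp _]|]; [exact (word_letter_dom HZ Hx)| |tauto].
    exfalso. apply Zl in Hx as [Hx _]. eauto. }
  assert (Gi : is_injection g (dom Z) (prod two (dom Z))).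
  { apply injection_intro; [exact Hg|]. intros i j Hi Hj E.
    destruct (Eg i Hi) as [[_ Ei]|[_ Ei]], (Eg j Hj) as [[_ Ej]|[_ Ej]];
      rewrite Ei, Ej in E; apply pair_inj in E; intuition congruence. }
  destruct (ex_transport HZ Gi) as (T & HT & Hiso & Tl & Tb).
  assert (HXZ : forall i x, letter_at X i x <-> letter_at Z i x /\ P i).
  { intros i x. rewrite Xl, Zl. split; [|tauto]. intros [Hx Hp]. rewrite (HR i x Hx). tauto. }
  assert (HYZ : forall i x, letter_at Y i x <-> letter_at Z i x /\ Q i).
  { intros i x. rewrite Yl, Zl. split; [|tauto]. intros [Hx Hp]. rewrite (HR i x Hx). tauto. }
  assert (HZc : forall i x, letter_at Z i x -> P i \/ Q i).
  { intros i x Hx. apply Zl in Hx as [Hx K]. now apply (HR i x Hx). }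
  assert (ZU : forall i x, letter_at Z i x -> letter_at U i x /\ R i) by (intros i x; apply Zl).
  assert (Bd : forall i j, before Z i j ->
    (exists x, letter_at Z i x) /\ (exists y, letter_at Z j y)).
  { intros i j K. destruct (wf_before_dom (word_elim HZ) K) as [Di Dj].
    split; now apply (wf_dom (word_elim HZ)). }
  assert (HC : is_concat X Y T).
  { split; [exact HT|]. split.
    - intros k x. rewrite Tl. split.
      + intros (i & -> & Hx). destruct (HZc i x Hx) as [K|K].
        * left. exists i. split; [|now apply HXZ]. exists empty.
          rewrite is_empty_iff, is_opair_iff. split; [reflexivity|]. eauto.
        * right. exists i. split; [|now apply HYZ]. exists one.
          rewrite is_one_iff, is_opair_iff. split; [reflexivity|]. eauto.
      + intros [(i & (o & Ho & Hk) & Hx)|(i & (o & Ho & Hk) & Hx)]; apply is_opair_iff in Hk.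
        * apply is_empty_iff in Ho. subst o k. apply HXZ in Hx as [Hx Hp]. exists i.
          split; [symmetry; eauto|exact Hx].
        * apply is_one_iff in Ho. subst o k. apply HYZ in Hx as [Hx Hp]. exists i.
          split; [symmetry; eauto|exact Hx].
    - assert (IL : forall i x, letter_at Z i x -> P i -> in_left (app g i) i).
      { intros i x Hx Hp. exists empty. rewrite is_empty_iff, is_opair_iff. eauto. }
      assert (IR : forall i x, letter_at Z i x -> Q i -> in_right (app g i) i).
      { intros i x Hx Hp. exists one. rewrite is_one_iff, is_opair_iff. eauto. }
      assert (XB : forall i j, before X i j <-> before Z i j /\ P i /\ P j).
      { intros i j. rewrite Xb, Zb. split; [|tauto]. intros (K & Hi & Hj).
        destruct (wf_before_dom F K) as [Di Dj].
        apply (wf_dom F) in Di as (x & Dx), Dj as (y & Dy). rewrite (HR i x Dx), (HR j y Dy). tauto. }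
      assert (YB : forall i j, before Y i j <-> before Z i j /\ Q i /\ Q j).
      { intros i j. rewrite Yb, Zb. split; [|tauto]. intros (K & Hi & Hj).
        destruct (wf_before_dom F K) as [Di Dj].
        apply (wf_dom F) in Di as (x & Dx), Dj as (y & Dy). rewrite (HR i x Dx), (HR j y Dy). tauto. }
      intros k l. rewrite Tb. split.
      + intros (i & j & -> & -> & K). destruct (Bd i j K) as [(x & Hx) (y & Hy)].
        destruct (HZc i x Hx) as [Pi|Qi], (HZc j y Hy) as [Pj|Qj].
        * left. exists i, j. split; [eauto|]. split; [eauto|]. apply XB. auto.
        * right; left. exists i, j. split; [eauto|]. split; [eauto|]. split.
          -- exists x. now apply HXZ.
          -- exists y. now apply HYZ.
        * exfalso. apply (wf_irrefl F (i := i)). apply (wf_trans F (j := j)); [now apply Zb|].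
          apply (HPQ j i y x); auto; now apply ZU.
        * right; right. exists i, j. split; [eauto|]. split; [eauto|]. apply YB. auto.
      + intros [(i & j & (o & Ho & Hk) & (o' & Ho' & Hl) & K)|
          [(i & j & (o & Ho & Hk) & (o' & Ho' & Hl) & (x & Hx) & (y & Hy))|
           (i & j & (o & Ho & Hk) & (o' & Ho' & Hl) & K)]];
          apply is_opair_iff in Hk, Hl; rewrite ?is_empty_iff, ?is_one_iff in *; subst o o' k l;
          exists i, j.
        * apply XB in K as (K & Pi & Pj). destruct (Bd i j K) as [(x & Hx) (y & Hy)].
          split; [symmetry; eauto|]. split; [symmetry; eauto|exact K].
        * apply HXZ in Hx as [Hx Pi]. apply HYZ in Hy as [Hy Qj].
          split; [symmetry; eauto|]. split; [symmetry; eauto|]. apply Zb.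
          destruct (ZU _ _ Hx), (ZU _ _ Hy). split; [eauto|auto].
        * apply YB in K as (K & Pi & Pj). destruct (Bd i j K) as [(x & Hx) (y & Hy)].
          split; [symmetry; eauto|]. split; [symmetry; eauto|exact K]. }
  destruct (ex_heg_class HX) as (hx & Hhx). destruct (ex_heg_class HY) as (hy & Hhy).
  destruct (ex_heg_class HZ) as (hz & Hhz).
  destruct (value_class Hhx) as [-> Gx]. destruct (value_class Hhy) as [-> Gy].
  destruct (value_class Hhz) as [-> Gz]. destruct Hphi as [Hf Hhom].
  assert (K : rel2 m (app phi hx) (app phi hy) (app phi hz)).
  { apply (Hhom hx hy hz); auto; try now apply (fun_app_rel Hf).
    exists X, Y, T. split; [exact Hhx|]. split; [exact Hhy|]. split; [exact HC|].
    now apply (heg_class_iso HT Hiso). }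
  apply (rel2_iff HH) in K. tauto.
Qed.

(* If [phi] kills the words in the letters beyond [N], then it factors through
   [p_N], because a word splits at its finitely many other letters. *)
Lemma value_proj (e N : M) : N ∈ omega ->
  (forall W, is_word W -> (forall i x, letter_at W i x -> ~ letter_upto N x) -> value phi W = e) ->
  forall U V, is_word U -> word_proj N U V -> value phi U = value phi V.
Proof.
  intros HN Hhigh.
  assert (K : forall F, is_finite F -> forall U V, is_word U -> word_proj N U V ->
    (forall i x, letter_at U i x -> letter_upto N x -> i ∈ F) -> value phi U = value phi V).
  { intros F HF. fin_induct HF.
    - unfold value. dfn.
    (* If [U] has no low letters, then [V] is empty and thus also a word without low letters; both
       have value [e]. *)
    - intros U V HU (HV & Vl & _) Hlow. rewrite (Hhigh U HU); [rewrite (Hhigh V HV); [reflexivity|]|].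
      + intros i x Hx Hl. apply Vl in Hx as [Hx _]. exact (in_empty (Hlow i x Hx Hl)).
      + intros i x Hx Hl. exact (in_empty (Hlow i x Hx Hl)).
    - intros F p _ IH U V HU HUV Hlow. pose proof (word_elim HU) as WF.
      destruct (classic (exists y, letter_at U p y /\ letter_upto N y)) as [(y & Hy & Hyl)|NL].
      2:{ apply IH; auto. intros i x Hx Hl. pose proof (Hlow i x Hx Hl) as Hi.
          apply in_add in Hi as [Hi| ->]; [exact Hi|]. exfalso. eauto. }
      assert (Hp : p ∈ dom U) by exact (word_letter_dom HU Hy).
      pose (low := fun i => exists x, letter_at U i x /\ letter_upto N x).
      assert (Dlow : definable1 low) by (unfold low; dfn).
      assert (Hlp : low p) by (exists y; auto).
      (* [U] and [V] are both cut at the low position p. The middle factor [U2] is common, and the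
         outer factors of [U] have one low position less to account for. *)
      destruct (@ex_restriction _ _ U (fun i => before U i p) HU) as (U1 & HU1); [dfn|].
      destruct (@ex_restriction _ _ U (fun i => i = p) HU) as (U2 & HU2); [dfn|].
      destruct (@ex_restriction _ _ U (fun i => before U p i) HU) as (U3 & HU3); [dfn|].
      destruct (@ex_restriction _ _ U (fun i => i = p \/ before U p i) HU) as (U23 & HU23); [dfn|].
      destruct (@ex_restriction _ _ U (fun i => before U i p /\ low i) HU) as (V1 & HV1); [dfn|].
      destruct (@ex_restriction _ _ U (fun i => before U p i /\ low i) HU) as (V3 & HV3); [dfn|].
      destruct (@ex_restriction _ _ U (fun i => i = p \/ before U p i /\ low i) HU) as (V23 & HV23);
        [dfn|].
      assert (Tot : forall i x, letter_at U i x -> before U i p \/ i = p \/ before U p i).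
      { intros i x Hx. destruct (wf_total WF (word_letter_dom HU Hx) Hp) as [E|[E|E]]; auto. }
      assert (EU : value phi U = mul m (value phi U1) (mul m (value phi U2) (value phi U3))).
      { rewrite <- (value_cut (U := U) (P := fun i => i = p) (Q := fun i => before U p i)
          (X := U2) (Y := U3) (Z := U23) (R := fun i => i = p \/ before U p i)); auto; try dfn.
        - apply (value_cut (U := U) (P := fun i => before U i p)
            (Q := fun i => i = p \/ before U p i) (R := fun _ => True)); auto; try dfn.
          + now apply restriction_self.
          + intros i x Hx. pose proof (Tot i x Hx). tauto.
          + intros i j x x' _ _ Hi [->|Hj]; [exact Hi|exact (wf_trans WF Hi Hj)].
        - tauto.
        - intros i j x x' _ _ -> Hj. exact Hj. }
      assert (EV : value phi V = mul m (value phi V1) (mul m (value phi U2) (value phi V3))).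
      { rewrite <- (value_cut (U := U) (P := fun i => i = p) (Q := fun i => before U p i /\ low i)
          (X := U2) (Y := V3) (Z := V23) (R := fun i => i = p \/ before U p i /\ low i)); auto; try dfn.
        - apply (value_cut (U := U) (P := fun i => before U i p /\ low i)
            (Q := fun i => i = p \/ before U p i /\ low i) (R := low)); auto; try dfn.
          + intros i x Hx. pose proof (Tot i x Hx). intuition congruence.
          + intros i j x x' _ _ [Hi _] [->|[Hj _]]; [exact Hi|exact (wf_trans WF Hi Hj)].
        - tauto.
        - intros i j x x' _ _ -> [Hj _]. exact Hj. }
      (* Projecting a part of [U] amounts to restricting [U] to the low positions of that part; as
         the part omits p, the induction hypothesis for [F] applies. *)
      assert (Part : forall (P : M -> Prop) W W', is_restriction U P W ->
        is_restriction U (fun i => P i /\ low i) W' -> ~ P p -> value phi W = value phi W').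
      { intros P W W' HW HW' HPp. pose proof HW as (HWw & Wl & _). apply IH; [exact HWw| |].
        - apply (restriction_ext (P := fun i => P i /\ low i)).
          + apply (restriction_sub HW HW'); [tauto|exact HU].
          + intros i x Hx. apply Wl in Hx as [Hx Hi]. split.
            * intros [_ (x' & Hx' & Hl)]. exists x'. split; [now apply Wl|exact Hl].
            * intros (x' & Hx' & Hl). split; [exact Hi|]. exists x'. apply Wl in Hx'. tauto.
          + exact HWw.
        - intros i x Hx Hl. apply Wl in Hx as [Hx Hi]. pose proof (Hlow i x Hx Hl) as K.
          apply in_add in K as [K| ->]; [exact K|contradiction]. }
      rewrite EU, EV, (Part _ _ _ HU1 HV1), (Part _ _ _ HU3 HV3); [reflexivity| |];
        apply (wf_irrefl WF). }
  intros U V HU HUV. destruct (low_positions_finite HU HN) as (F & HF & Hlow). eauto.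
Qed.
End HEG.

(** * Groups that are not n-slender *)

Section NSlender.
Context {M : eps_structure} {zf : ZF M}.
Hypothesis dc : DC M.
Hypothesis bp : all_sets_Baire M.

(** Positions are pairs (n, i) in lexicographic order. Domains inside omega make the result
    countable, and each letter occurs finitely often because the n-th factor omits all letters up to
    a_n. *)
Lemma ex_infinite_concat (w Y : M) : is_fun w omega Y ->
  (forall n, n ∈ omega -> is_word (app w n) /\ sub (dom (app w n)) omega /\
    forall i x, letter_at (app w n) i x -> ~ letter_upto n x) ->
  exists B, is_word B /\
    (forall p x, letter_at B p x <->
      exists n i, n ∈ omega /\ p = pair n i /\ letter_at (app w n) i x) /\
    (forall p q, before B p q <-> exists n i n' i', n ∈ omega /\ n' ∈ omega /\
      p = pair n i /\ q = pair n' i' /\ i ∈ dom (app w n) /\ i' ∈ dom (app w n') /\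
      (n ∈ n' \/ (n = n' /\ before (app w n) i i'))).
Proof.
  intros Hw Hwn.
  assert (Fw : forall n, n ∈ omega -> word_facts (app w n))
    by (intros n Hn; apply word_elim; now apply Hwn).
  set (D := sep (prod omega omega) (fun p => exists n i, p = pair n i /\ i ∈ dom (app w n))).
  assert (HD : forall p, p ∈ D <-> exists n i, n ∈ omega /\ p = pair n i /\ i ∈ dom (app w n)).
  { intros p. unfold D. rewrite in_sep by dfn. rewrite in_prod. split.
    - intros [(n & i & Hn & _ & ->) (n' & i' & E & K)]. apply pair_inj in E as [<- <-]. eauto.
    - intros (n & i & Hn & -> & K). split; [|eauto]. exists n, i. split; [exact Hn|].
      split; [|reflexivity]. now apply (Hwn n Hn). }
  destruct (@ex_word _ _ D
    (fun p q => exists n i n' i', p = pair n i /\ q = pair n' i' /\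
      (n ∈ n' \/ (n = n' /\ before (app w n) i i')))
    (fun p x => exists n i, p = pair n i /\ letter_at (app w n) i x)) as (B & HB & Bl & Bb).
  - dfn.
  - dfn.
  - destruct (ex_pairing dc) as (J & HJ & IJ).
    destruct (@ex_fun _ _ D omega (fun p v => v = app J p)) as (h & Hh & Eh); [dfn| |congruence|].
    + intros p Hp. exists (app J p). split; [|reflexivity]. apply (fun_app_in HJ).
      unfold D in Hp. apply in_sep in Hp; [tauto|dfn].
    + exists h. apply injection_intro; [exact Hh|]. intros p q Hp Hq. rewrite !Eh by assumption.
      apply HD in Hp as (n & i & Hn & -> & Hi), Hq as (n' & i' & Hn' & -> & Hi'). intros E.
      apply pair_inj, IJ; auto; [now apply (Hwn n Hn)|now apply (Hwn n' Hn')].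
  - intros p Hp (n & i & n' & i' & -> & E & K). apply pair_inj in E as [<- <-].
    apply HD in Hp as (n' & i' & Hn & E & Hi). apply pair_inj in E as [<- <-].
    destruct K as [K|[_ K]]; [exact (nat_irrefl Hn K)|exact (wf_irrefl (Fw n Hn) K)].
  - intros p q r Hp Hq Hr (n & i & n' & i' & -> & -> & K) (n1 & i1 & n2 & i2 & E & -> & K').
    apply pair_inj in E as [<- <-].
    apply HD in Hp as (a & b & Hn & E & _). apply pair_inj in E as [<- <-].
    apply HD in Hr as (a & b & Hn2 & E & _). apply pair_inj in E as [<- <-].
    exists n, i, n2, i2. split; [reflexivity|]. split; [reflexivity|].
    destruct K as [K|[<- K]], K' as [K'|[<- K']]; auto.
    + left. exact (nat_trans Hn2 K K').
    + right. split; [reflexivity|]. exact (wf_trans (Fw n Hn) K K').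
  - intros p q Hp Hq. apply HD in Hp as (n & i & Hn & -> & Hi), Hq as (n' & i' & Hn' & -> & Hi').
    destruct (nat_total Hn Hn') as [K|[<-|K]].
    + right; left. exists n, i, n', i'. auto.
    + destruct (wf_total (Fw n Hn) Hi Hi') as [<-|[K|K]]; [auto| |].
      * right; left. exists n, i, n, i'. auto.
      * right; right. exists n, i', n, i. auto.
    + right; right. exists n', i', n, i. auto.
  - intros p Hp. apply HD in Hp as (n & i & Hn & -> & Hi).
    apply (wf_dom (Fw n Hn)) in Hi as (x & Hx). exists x.
    split; [exact (wf_letter (Fw n Hn) Hx)|eauto].
  - intros p x x' Hp (n & i & -> & Hx) (n' & i' & E & Hx'). apply pair_inj in E as [<- <-].
    apply HD in Hp as (n' & i' & Hn & E & _). apply pair_inj in E as [<- <-].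
    exact (wf_fun (Fw n Hn) Hx Hx').
  - intros l Hl.
    (* A finite union over the factors before the k-th; k = l + 1 will do, since the later factors
       omit a_l. *)
    assert (K : forall k, k ∈ omega -> exists F, is_finite F /\ forall n i x, n ∈ k ->
      letter_at (app w n) i x -> is_letter x l -> pair n i ∈ F).
    { intros k Hk. nat_induct Hk; [dfn| |].
      - exists empty. split; [apply fin_empty|]. intros n i x Hn. now apply in_empty in Hn.
      - intros k Hk (F & HF & K). destruct (wf_finite (Fw k Hk) Hl) as (E & HE & KE).
        exists (cup F (sep (prod omega (dom (app w k))) (fun p => exists i, i ∈ E /\ p = pair k i))).
        split.
        + apply fin_cup; [exact HF|].
          apply (@fin_image _ _ (fun i p => p = pair k i) E); [dfn|congruence|exact HE|].
          intros p Hp. apply in_sep in Hp; [tauto|dfn].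
        + intros n i x Hn Hx Hxl. apply in_cup. apply in_succ in Hn as [Hn| ->]; [eauto|].
          right. apply in_sep; [dfn|]. split; [|eauto]. apply pair_in_prod. split; [exact Hk|].
          apply (wf_dom (Fw k Hk)). eauto. }
    destruct (K (succ l) (succ_omega Hl)) as (F & HF & KF). exists F. split; [exact HF|].
    intros p x Hp (n & i & -> & Hx) Hxl.
    apply HD in Hp as (n' & i' & Hn & E & _). apply pair_inj in E as [<- <-].
    apply (KF n i x); auto. apply in_succ.
    destruct (nat_total Hn Hl) as [Q|[Q|Q]]; [auto|auto|]. exfalso.
    destruct (Hwn n Hn) as (_ & _ & Hhigh). apply (Hhigh i x Hx). exists l. auto.
  - exists B. split; [exact HB|]. split.
    + intros p x. rewrite Bl, HD. split.
      * intros [(n & i & Hn & -> & _) (n' & i' & E & Hx)]. apply pair_inj in E as [<- <-]. eauto.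
      * intros (n & i & Hn & -> & Hx). split; [|eauto]. exists n, i. split; [exact Hn|].
        split; [reflexivity|]. apply (wf_dom (Fw n Hn)). eauto.
    + intros p q. rewrite Bb, !HD. split.
      * intros ((n & i & Hn & -> & Hi) & (n' & i' & Hn' & -> & Hi') & (a & b & a' & b' & E & E' & K)).
        apply pair_inj in E as [<- <-], E' as [<- <-]. exists n, i, n', i'. auto 8.
      * intros (n & i & n' & i' & Hn & Hn' & -> & -> & Hi & Hi' & K).
        split; [eauto|]. split; [eauto|]. exists n, i, n', i'. auto.
Qed.

Lemma not_n_slender_card (H m : M) : is_group H m -> ~ n_slender H m -> card_le cantor H.
Proof.
  intros HH Hns.
  assert (K : exists G phi, is_HEG G /\ is_hom G (@heg_mul M) H (rel2 m) phi /\
    forall N, N ∈ omega -> exists U V, is_word U /\ word_proj N U V /\ value phi U <> value phi V).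
  { apply NNPP. intros K. apply Hns. intros G HG phi Hphi. apply NNPP. intros L. apply K.
    exists G, phi. split; [exact HG|]. split; [exact Hphi|]. intros N HN. apply NNPP. intros L'.
    apply L. exists N. split; [now apply is_nat_iff|].
    intros h k a Hh Hk (U & V & HhU & HUV & HkV).
    pose proof Hphi as [Hf _]. rewrite !(fun_rel _ _ Hf).
    assert (E : value phi U = value phi V).
    { apply NNPP; intros NE; apply L'. exists U, V. split; [exact (proj1 HhU)|split; assumption]. }
    rewrite (proj1 (value_class phi HG HhU)), (proj1 (value_class phi HG HkV)) in E.
    rewrite E. tauto. }
  destruct K as (G & phi & HG & Hphi & Hbad).
  destruct (group_unit HH) as (e & He & Hid & Hcan & Hcan').
  destruct (@ac_omega _ _ dc nat_words (fun n W => is_word W /\ (forall i, in_dom W i -> is_nat i) /\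
    (forall i x, letter_at W i x -> ~ letter_upto n x) /\ value phi W <> e)) as (w & Hw & Ew).
  { unfold value. dfn. }
  { intros n Hn. destruct (Hbad n Hn) as (U & V & HU & HUV & Hne).
    (* If every word in the letters beyond a_n were sent to the identity, [value_proj] would give
       [U] and its projection [V] the same value. *)
    assert (K : exists W, is_word W /\ (forall i x, letter_at W i x -> ~ letter_upto n x) /\
      value phi W <> e).
    { apply NNPP. intros K. apply Hne. apply (value_proj HG HH Hphi (e := e) Hn); auto.
      intros W HW Hhigh. apply NNPP. intros NE. eauto. }
    destruct K as (W & HW & Hhigh & HWe).
    (* Choice needs a set to choose from, so the word is moved to a domain inside omega, where it
       belongs to [nat_words]. *)
    destruct (wf_countable (word_elim HW)) as (g & Hg).
    destruct (ex_transport HW Hg) as (T & HT & Hiso & Tl & _).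
    assert (Hd : forall i, in_dom T i -> is_nat i).
    { intros i (x & Hx). apply Tl in Hx as (j & -> & Hx). apply is_nat_iff.
      apply (fun_app_in (proj1 Hg)). exact (word_letter_dom HW Hx). }
    exists T. split; [now apply in_nat_words|]. split; [exact HT|]. split; [exact Hd|]. split.
    - intros i x Hx. apply Tl in Hx as (j & -> & Hx). eauto.
    - now rewrite <- (value_iso phi HG HW HT Hiso). }
  destruct (ex_infinite_concat Hw) as (B & HB & Bl & Bb).
  { intros n Hn. destruct (Ew n Hn) as (HW & Hd & Hhigh & _). split; [exact HW|].
    split; [|exact Hhigh]. intros i Hi. apply is_nat_iff, Hd. now apply (wf_dom (word_elim HW)). }
  (* Every concatenation of selected words is a restriction of the one word [B], which can then
     serve as the ambient word of [value_cut]. *)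
  pose (sel := fun a p => exists n i, p = pair n i /\ app a n = one).
  assert (Dsel : definable2 sel) by (unfold sel, one; dfn).
  destruct (@ex_fun _ _ cantor H (fun a v => exists V, is_restriction B (fun p => sel a p) V /\
    v = value phi V)) as (f & Hf & Ef).
  { unfold is_restriction, value. dfn. }
  { intros a Ha. destruct (@ex_restriction _ _ B (fun p => sel a p) HB) as (V & HV); [dfn|].
    exists (value phi V). split; [|eauto]. apply (value_in HG Hphi). apply HV. }
  { intros a v v' _ (V & HV & ->) (V' & HV' & ->).
    now rewrite (restriction_unique HV HV' ltac:(tauto) HB). }
  apply (card_le_switch dc bp Hf). intros x y n Hx Hy Hn Ex Ey Exy E.
  destruct (Ef x Hx) as (X & HX & Efx). destruct (Ef y Hy) as (Y & HY & Efy).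
  destruct (Ew n Hn) as (HW & Hd & _ & HWe).
  (* Around the n-th factor, [X] is V1 V3 and [Y] is V1 V2 V3. The outer parts are the same for
     both, since [x] and [y] agree off n; so [lt] and [gt] are written with [x] alone. Cancelling V1
     on the left and V3 on the right isolates V2. *)
  pose (lt := fun p => exists k i, p = pair k i /\ k ∈ n /\ app x k = one).
  pose (eqn := fun p => exists i, p = pair n i).
  pose (gt := fun p => exists k i, p = pair k i /\ n ∈ k /\ app x k = one).
  assert (Dlt : definable1 lt) by (unfold lt, one; dfn).
  assert (Deqn : definable1 eqn) by (unfold eqn; dfn).
  assert (Dgt : definable1 gt) by (unfold gt, one; dfn).
  destruct (@ex_restriction _ _ B lt HB Dlt) as (V1 & HV1).
  destruct (@ex_restriction _ _ B eqn HB Deqn) as (V2 & HV2).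
  destruct (@ex_restriction _ _ B gt HB Dgt) as (V3 & HV3).
  destruct (@ex_restriction _ _ B (fun p => eqn p \/ gt p) HB) as (V23 & HV23); [dfn|].
  assert (H10 := one_neq_zero).
  assert (Bfst : forall p u, letter_at B p u -> exists k i, k ∈ omega /\ p = pair k i /\
    i ∈ dom (app w k)).
  { intros p u Hu. apply Bl in Hu as (k & i & Hk & -> & Hu). exists k, i.
    split; [exact Hk|]. split; [reflexivity|].
    apply (word_letter_dom (proj1 (Ew k Hk)) Hu). }
  assert (Cx : forall p u, letter_at B p u -> (sel x p <-> lt p \/ gt p)).
  { intros p u Hu. destruct (Bfst p u Hu) as (k & i & Hk & -> & _). split.
    - intros (k' & i' & E' & K). apply pair_inj in E' as [<- <-].
      destruct (nat_total Hk Hn) as [Q|[->|Q]]; [left|congruence|right]; exists k, i; auto.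
    - intros [(k' & i' & -> & _ & K)|(k' & i' & -> & _ & K)]; exists k', i'; auto. }
  assert (Cy : forall p u, letter_at B p u -> (sel y p <-> lt p \/ (eqn p \/ gt p))).
  { intros p u Hu. destruct (Bfst p u Hu) as (k & i & Hk & -> & _). split.
    - intros (k' & i' & E' & K). apply pair_inj in E' as [<- <-].
      destruct (nat_total Hk Hn) as [Q|[->|Q]].
      + left. exists k, i. rewrite Exy; auto. intros ->. now apply nat_irrefl in Q.
      + right; left. exists i. reflexivity.
      + right; right. exists k, i. rewrite Exy; auto. intros ->. now apply nat_irrefl in Q.
    - intros [(k' & i' & E' & Q & K)|[(i' & E')|(k' & i' & E' & Q & K)]];
        apply pair_inj in E' as [<- <-]; exists k, i; (split; [reflexivity|]); [|exact Ey|];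
        rewrite <- Exy; auto; intros ->; now apply nat_irrefl in Q. }
  assert (Bfst_lt : forall p q u v, letter_at B p u -> letter_at B q v -> forall k i l j,
    p = pair k i -> q = pair l j -> k ∈ l -> before B p q).
  { intros p q u v Hu Hv k i l j -> -> Hkl.
    destruct (Bfst _ _ Hu) as (k' & i' & Hk & E1 & Di). destruct (Bfst _ _ Hv) as (l' & j' & Hl & E2 & Dj).
    apply pair_inj in E1 as [<- <-], E2 as [<- <-]. apply Bb. exists k, i, l, j. auto 10. }
  assert (VX : value phi X = mul m (value phi V1) (value phi V3)).
  { apply (value_cut HG HH Hphi HB Dlt Dgt HV1 HV3 HX Cx).
    intros p q u v Hu Hv (k & i & Ep & Hk & _) (l & j & Eq & Hl & _).
    destruct (Bfst _ _ Hv) as (l' & j' & Hlo & E2 & _). rewrite Eq in E2.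
    apply pair_inj in E2 as [<- <-].
    exact (Bfst_lt p q u v Hu Hv k i l j Ep Eq (nat_trans Hlo Hk Hl)). }
  assert (VY : value phi Y = mul m (value phi V1) (value phi V23)).
  { apply (value_cut (P := lt) (Q := fun p => eqn p \/ gt p) HG HH Hphi HB Dlt ltac:(dfn) HV1 HV23 HY Cy).
    intros p q u v Hu Hv (k & i & Ep & Hk & _) [(j & Eq)|(l & j & Eq & Hl & _)].
    - exact (Bfst_lt p q u v Hu Hv k i n j Ep Eq Hk).
    - destruct (Bfst _ _ Hv) as (l' & j' & Hlo & E2 & _). rewrite Eq in E2.
      apply pair_inj in E2 as [<- <-].
      exact (Bfst_lt p q u v Hu Hv k i l j Ep Eq (nat_trans Hlo Hk Hl)). }
  assert (V23v : value phi V23 = mul m (value phi V2) (value phi V3)).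
  { apply (value_cut HG HH Hphi HB Deqn Dgt HV2 HV3 HV23); [tauto|].
    intros p q u v Hu Hv (i & Ep) (l & j & Eq & Hl & _).
    exact (Bfst_lt p q u v Hu Hv n i l j Ep Eq Hl). }
  (* After the renaming of positions i -> (n, i), the n-th chosen word and V2 are the same set, by
     [word_ext]. *)
  assert (V2v : value phi V2 = value phi (app w n)).
  { destruct (@ex_fun _ _ (dom (app w n)) (prod omega omega) (fun i p => p = pair n i))
      as (g & Hg & Eg); [dfn| |congruence|].
    { intros i Hi. exists (pair n i). split; [|reflexivity]. apply pair_in_prod.
      split; [exact Hn|]. apply is_nat_iff, Hd. now apply (wf_dom (word_elim HW)). }
    assert (Gi : is_injection g (dom (app w n)) (prod omega omega)).
    { apply injection_intro; [exact Hg|]. intros i j Hi Hj. rewrite !Eg by assumption.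
      intros E'. now apply pair_inj in E'. }
    destruct (ex_transport HW Gi) as (T & HT & Hiso & Tl & Tb).
    rewrite (value_iso phi HG HW HT Hiso). f_equal.
    destruct HV2 as (HV2w & V2l & V2b). apply word_ext; auto.
    - intros p u. rewrite V2l, Tl, Bl. split.
      + intros [(k & i & Hk & -> & Hu) (i' & E')]. apply pair_inj in E' as [-> <-].
        exists i. rewrite Eg; [auto|]. exact (word_letter_dom HW Hu).
      + intros (i & -> & Hu). rewrite Eg by exact (word_letter_dom HW Hu).
        split; [|exists i; reflexivity]. exists n, i. auto.
    - intros p q. rewrite V2b, Tb, Bb. split.
      + intros ((k & i & l & j & Hk & Hl & -> & -> & Hi & Hj & K) & (i' & E1) & (j' & E2)).
        apply pair_inj in E1 as [-> <-], E2 as [-> <-].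
        destruct K as [K|[_ K]]; [now apply nat_irrefl in K|].
        exists i, j. rewrite !Eg by assumption. auto.
      + intros (i & j & -> & -> & K). destruct (wf_before_dom (word_elim HW) K) as [Di Dj].
        rewrite !Eg by assumption. split.
        * exists n, i, n, j. auto 10.
        * split; [exists i|exists j]; reflexivity. }
  apply HWe. rewrite <- V2v.
  assert (I1 : value phi V1 ∈ H) by (apply (value_in HG Hphi), HV1).
  assert (I2 : value phi V2 ∈ H) by (apply (value_in HG Hphi), HV2).
  assert (I3 : value phi V3 ∈ H) by (apply (value_in HG Hphi), HV3).
  apply (Hcan' (value phi V3)); auto. rewrite (proj1 (Hid _ I3)), <- V23v.
  apply (Hcan (value phi V1)); auto; [apply (value_in HG Hphi), HV23|]. congruence.
Qed.
End NSlender.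

Theorem theorem3p6 (S : eps_structure)
    (zf : ZF S) (dc : DC S) (bp : all_sets_Baire S) :
  (forall A m : S, is_abelian_group A m -> ~ slender A m ->
     exists C, is_cantor C /\ card_le C A) /\
  (forall H m : S, is_group H m -> ~ n_slender H m ->
     exists C, is_cantor C /\ card_le C H).
Proof.
  split.
  - intros A m [HA _] Hns. exists cantor. split; [exact is_cantor_cantor|].
    exact (not_slender_card dc bp HA Hns).
  - intros H m HH Hns. exists cantor. split; [exact is_cantor_cantor|].
    exact (not_n_slender_card dc bp HH Hns).
Qed.
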